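(* Let $H$ be a bipartite graph with at least one edge. There is a function $f(n;H)=o(n)$ (as $n\to\infty$) such that every $H$-packing of order $n$ can be completed to an $H$-design on at most $n+f(n;H)$ vertices.
   Context: All graphs are finite and simple. An $H$-packing of order $n$ is a set $\{H_1,\dots,H_m\}$ of pairwise edge-disjoint copies of $H$ (subgraphs isomorphic to $H$) of the complete graph on an $n$-element vertex set $V$. An $H$-design on a vertex set $V'$ is an $H$-packing whose copies of $H$ partition the edge set of the complete graph on $V'$. An $H$-packing $\mathcal{P}$ on $V$ is completed to an $H$-design on $V'\supseteq V$ if there is an $H$-design on $V'$ containing every copy of $H$ in $\mathcal{P}$. *)

(* Defs.v *)
From HB Require Import structures.
From mathcomp Require Import all_boot.

Set Implicit Arguments.
Unset Strict Implicit.
Unset Printing Implicit Defensive.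

Section Graphs.
Variable T : finType.

(* Edges of the complete graph on W, as two-element sets. *)
Definition pairs (W : {set T}) : {set {set T}} :=
  [set e : {set T} | (e \subset W) && (#|e| == 2)].

(* A finite simple graph whose vertex set is an arbitrary subset of T;
   equivalently, a subgraph of the complete graph on T. *)
Record sgraph := SGraph {
  sgval : {set T} * {set {set T}};
  sgvalP : sgval.2 \subset pairs sgval.1
}.

HB.instance Definition _ := [isSub for sgval].
HB.instance Definition _ := [Finite of sgraph by <:].

Definition vset (G : sgraph) : {set T} := (sgval G).1.
Definition eset (G : sgraph) : {set {set T}} := (sgval G).2.

Definition bipartite (G : sgraph) : Prop :=
  exists A B : {set T},
    [/\ A :|: B = vset G, A :&: B = set0
      & forall e, e \in eset G -> #|e :&: A| = 1 /\ #|e :&: B| = 1].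

End Graphs.

Definition maps_onto (T T' : finType) (f : T -> T')
    (G : sgraph T) (G' : sgraph T') : Prop :=
  vset G' = f @: vset G /\ eset G' = [set f @: e | e : {set T} in eset G].

Definition isomorphic (T T' : finType) (G : sgraph T) (G' : sgraph T') : Prop :=
  exists f : T -> T', {in vset G &, injective f} /\ maps_onto f G G'.

(* The vertex set of the packing is the whole type V, so that its order is #|V|.
   Copies of H are subgraphs and not embeddings: two embeddings with the same
   image give the same copy. *)
Definition packing (U V : finType) (H : sgraph U) (P : {set sgraph V}) : Prop :=
  (forall A, A \in P -> isomorphic H A) /\
  (forall A B, A \in P -> B \in P -> A != B -> [disjoint eset A & eset B]).

Definition design (U V : finType) (H : sgraph U) (D : {set sgraph V}) : Prop :=
  packing H D /\ \bigcup_(A in D) eset A = pairs [set: V].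

(* The inclusion of V in V' is rendered by an injection i : V -> V'. *)
Definition completed (U V V' : finType) (H : sgraph U) (P : {set sgraph V}) : Prop :=
  exists (i : V -> V') (D : {set sgraph V'}),
    [/\ injective i, design H D
      & forall A, A \in P -> exists2 B, B \in D & maps_onto i A B].
Arguments completed {U V} V' H P.

(* Main.v *)
Require Import Defs.
From mathcomp Require Import all_boot all_order all_algebra.
From mathcomp Require Import fingroup perm cyclic.
From mathcomp Require Import zify ring boolp.
Set Implicit Arguments.
Unset Strict Implicit.
Unset Printing Implicit Defensive.

(** For a modulus M depending on H, every complete bipartite graph whose two
    parts have size divisible by M, and every complete graph of order 1 mod M,
    decomposes into copies of H.

    Some completion always exists: take a family of copies of H covering every
    pair of vertices q times, q a large prime, blow every vertex up to a space
    of functions with values in F_q, and spread the q copies through a pair over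
    the q labels of that pair; interpolation makes the labels consistent.  It
    follows that if K_T - G decomposes for some T containing the vertices D of
    G, then so does K_T' - (K_D - G) for some T'.

    To add only o(n) vertices, remove copies of H from the uncovered graph until
    none is left.  Boundedly many vertices then have large degree, so the rest L
    has an orientation with small in-degrees.  Cut the out-edges at each vertex
    into stars of equal size and cover each star by a copy of H whose other
    vertices lie in a set E of at most n / N new vertices.  Stars sharing a leaf
    use different blocks of E, so that almost all the edges between old and new
    vertices form complete bipartite pieces; the few others at an old vertex are
    covered by copies of H having only this vertex outside E.  All that is left
    is a graph on E and one old vertex, to which the argument is applied again;
    below a fixed order, the existence of some completion is enough. *)

(** * Decompositions *)

(** The obstacle is divisibility. The pairs left at an old vertex must split into groups whose sizes
    are degrees of H, and the uncovered graph alone does not tell whether they can. Hence the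
    induction carries the hypothesis that the complement of [F] has some completion, of whatever
    order: counting the pairs at a vertex in it shows that the degree of this vertex in [F] is,
    modulo M, a sum of degrees of H. A number in such a residue class is itself such a sum as soon
    as it exceeds a constant, so a constant surplus of new vertices at each old vertex is enough.
    The hypothesis passes to the graph of the next round, because a completion can be combined with
    the pairs already covered.

    All orders are kept at 1 modulo M. Complete graphs of such an order decompose, but the old
    vertices form a side of size divisible by M only after one vertex [o] is set aside; this is the
    old vertex that survives into the next round. With at most |D| / N0 new vertices per round, the
    rounds add up to a geometric series, and N0 is arbitrary. *)

Section Decompositions.
Variables (X : finType) (adj : rel X).

(* Graphs are nat-valued weights on pairs of vertices, so that a union of
   edge-disjoint graphs is a sum; [wt f] is the weight of the copy of H embedded
   by [f]. *)
Definition wt (T : eqType) (f : X -> T) (x y : T) : nat :=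
  \sum_(p : X * X | adj p.1 p.2) ((f p.1 == x) && (f p.2 == y)).

Definition decomposable (T : finType) (m : T -> T -> nat) : Prop :=
  exists (I : finType) (f : I -> X -> T),
    (forall i, injective (f i)) /\ forall x y, m x y = \sum_i wt (f i) x y.

Lemma dec_ext (T : finType) (m m' : T -> T -> nat) :
  (forall x y, m x y = m' x y) -> decomposable m -> decomposable m'.
Proof.
by move=> e [I [f [fi fm]]]; exists I, f; split=> // x y; rewrite -e fm.
Qed.

Lemma dec0 (T : finType) : decomposable (fun _ _ : T => 0).
Proof. by exists void, (@of_void (X -> T)); split=> [[]|x y]; rewrite big_pred0 // => [[]]. Qed.

Lemma decD (T : finType) (m1 m2 : T -> T -> nat) :
  decomposable m1 -> decomposable m2 -> decomposable (fun x y => m1 x y + m2 x y).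
Proof.
move=> [I [f [fi fm]]] [J [g [gi gm]]].
exists (I + J)%type, (fun k => match k with inl i => f i | inr j => g j end).
by split=> [[]//|x y]; rewrite big_sumType /= fm gm.
Qed.

Lemma dec_sum (T J : finType) (P : pred J) (m : J -> T -> T -> nat) :
  (forall j, P j -> decomposable (m j)) -> decomposable (fun x y => \sum_(j | P j) m j x y).
Proof.
move=> mP; elim: (index_enum J) => [|j s IH].
  by apply: dec_ext (dec0 T) => x y; rewrite big_nil.
have [Pj|nPj] := boolP (P j).
  by apply: dec_ext (decD (mP j Pj) IH) => x y; rewrite big_cons Pj.
by apply: dec_ext IH => x y; rewrite big_cons (negPf nPj).
Qed.

Lemma wt_comp (T T' : eqType) (g : T -> T') (f : X -> T) x y :
  injective g -> wt (g \o f) (g x) (g y) = wt f x y.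
Proof. by move=> gi; apply: eq_bigr => p _ /=; rewrite !(inj_eq gi). Qed.

Lemma wt_gt0P (T : eqType) (f : X -> T) x y :
  reflect (exists a b, [/\ adj a b, f a = x & f b = y]) (0 < wt f x y).
Proof.
apply: (iffP idP) => [|[a [b [ab <- <-]]]].
  rewrite lt0n sum_nat_eq0 => /forallPn[p]; rewrite negb_imply eqb0 negbK.
  by case/and3P=> ? /eqP ? /eqP ?; exists p.1, p.2.
by rewrite /wt (bigD1 (a, b)) //= !eqxx.
Qed.

Lemma wt_eq0 (T : eqType) (f : X -> T) x y :
  (forall a b, adj a b -> f a = x -> f b = y -> False) -> wt f x y = 0.
Proof.
move=> nf; apply/eqP; rewrite -leqn0 leqNgt; apply/wt_gt0P => -[a [b [ab fa fb]]].
exact: nf ab fa fb.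
Qed.

Lemma wt_inj (T : eqType) (f : X -> T) a b :
  injective f -> wt f (f a) (f b) = adj a b.
Proof.
move=> fi; rewrite /wt (eq_bigr (fun p => nat_of_bool (p == (a, b)))); last first.
  by move=> p _; rewrite !(inj_eq fi) -pair_eqE.
case ab: (adj a b).
  rewrite (bigD1 (a, b)) //= eqxx big1 // => p /andP[_ /negPf->//].
by rewrite big1 // => p; case: eqP => // ->; rewrite ab.
Qed.

Lemma dec_pull (T T' : finType) (g : T -> T') (m : T' -> T' -> nat) :
  injective g -> (forall x y, x \notin codom g -> m x y = 0) ->
  (forall x y, y \notin codom g -> m x y = 0) ->
  decomposable (fun x y => m (g x) (g y)) -> decomposable m.
Proof.
move=> gi m1 m2 [I [f [fi fm]]]; exists I, (fun i => g \o f i).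
split=> [i|x y]; first exact: inj_comp.
have [/codomP[x' ->]|nx] := boolP (x \in codom g); last first.
  rewrite m1 // big1 // => i _; apply: wt_eq0 => a b _ fa _.
  by case/negP: nx; rewrite -fa /= codom_f.
have [/codomP[y' ->]|ny] := boolP (y \in codom g); last first.
  rewrite m2 // big1 // => i _; apply: wt_eq0 => a b _ _ fa.
  by case/negP: ny; rewrite -fa /= codom_f.
by rewrite fm; apply: eq_bigr => i _; rewrite wt_comp.
Qed.

Lemma sum1_nat (I : finType) (P : pred I) i0 :
  P i0 -> (forall i, P i -> i = i0) -> \sum_i (P i : nat) = 1.
Proof.
move=> P0 Pu; rewrite (bigD1 i0) //= P0 big1 // => i ni.
by case Pi: (P i) => //; rewrite (Pu i Pi) eqxx in ni.
Qed.

Lemma sum_wt1 (I : finType) (T : eqType) (f : I -> X -> T) i0 a0 b0 x y :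
  adj a0 b0 -> f i0 a0 = x -> f i0 b0 = y -> 
  (forall i a b, adj a b -> f i a = x -> f i b = y -> [/\ i = i0, a = a0 & b = b0]) ->
  \sum_i wt (f i) x y = 1.
Proof.
move=> ab fa fb u; rewrite (bigD1 i0) //= big1 => [|i ni]; last first.
  by apply: wt_eq0 => a b ab' fa' fb'; case: (u i a b) => // e; rewrite e eqxx in ni.
rewrite addn0 /wt (bigD1 (a0, b0)) //= fa fb !eqxx big1 // => -[a b] /= /andP[ab'].
apply: contraNeq; rewrite eqb0 negbK => /andP[/eqP fa' /eqP fb'].
by have [_ -> ->] := u _ _ _ ab' fa' fb'.
Qed.

Lemma sum_wt0 (I : finType) (T : eqType) (f : I -> X -> T) x y :
  (forall i a b, adj a b -> f i a = x -> f i b = y -> False) ->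
  \sum_i wt (f i) x y = 0.
Proof. by move=> u; rewrite big1 // => i _; apply: wt_eq0; apply: u. Qed.

(** It suffices that a covered ordered pair determines the copy: injectivity of the copy then
    determines the edge, so every weight is 0 or 1. *)
Lemma sum_wt_rel (I : finType) (T : eqType) (f : I -> X -> T) (g : rel T) :
  (forall i, injective (f i)) ->
  (forall i a b, adj a b -> g (f i a) (f i b)) ->
  (forall x y, g x y -> exists i a b, [/\ adj a b, f i a = x & f i b = y]) ->
  (forall i a b i' a' b', adj a b -> adj a' b' ->
     f i a = f i' a' -> f i b = f i' b' -> i = i') ->
  forall x y, \sum_i wt (f i) x y = g x y.
Proof.
move=> fi fg ex un x y; case gxy: (g x y); last first.
  by rewrite sum_wt0 // => i a b ab fa fb; rewrite -fa -fb fg in gxy.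
have [i [a [b [ab fa fb]]]] := ex _ _ gxy.
rewrite (sum_wt1 ab fa fb) // => i' a' b' ab' fa' fb'.
have e : i' = i by apply: (un _ _ _ _ _ _ ab' ab); rewrite ?fa ?fb.
subst i'.
by split=> //; apply: (fi i); rewrite ?fa ?fb.
Qed.

Lemma dec_intro (I T : finType) (f : I -> X -> T) (g : rel T) :
  (forall i, injective (f i)) ->
  (forall i a b, adj a b -> g (f i a) (f i b)) ->
  (forall x y, g x y -> exists i a b, [/\ adj a b, f i a = x & f i b = y]) ->
  (forall i a b i' a' b', adj a b -> adj a' b' ->
     f i a = f i' a' -> f i b = f i' b' -> i = i') ->
  decomposable (fun x y => nat_of_bool (g x y)).
Proof.
move=> fi fg ex un; exists I, f; split=> // x y.
by rewrite (sum_wt_rel fi fg ex un).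
Qed.

Definition biclique (T : finType) (A B : {set T}) (x y : T) : nat :=
  (x \in A) && (y \in B) + (x \in B) && (y \in A).

Definition clique (T : finType) (A : {set T}) (x y : T) : nat :=
  [&& x \in A, y \in A & x != y].

End Decompositions.

Lemma inl_pair_inj (A B C : Type) (x x' : A) (y y' : B) :
  inl (x, y) = inl (x', y') :> (A * B) + C -> x = x' /\ y = y'.
Proof. by case. Qed.

Lemma inr_pair_inj (A B C : Type) (x x' : A) (y y' : B) :
  inr (x, y) = inr (x', y') :> C + (A * B) -> x = x' /\ y = y'.
Proof. by case. Qed.

(** * Complete bipartite graphs and complete graphs *)

(* The translates of H by [G * G] cover each pair [(i, k)] once for each edge of
   H, and [idx] numbers these translates.  Split [i] into the vertices [(i, u)]
   and [k] into the vertices [(k, w)]: the translate numbered [u + w i] is the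
   one covering the pair [(i, u)], [(k, w)]. *)
Section BipartiteBase.
Variables (X : finType) (adj : rel X) (cl : X -> bool).
Hypothesis adj_sym : symmetric adj.
Hypothesis adj_cl : forall a b, adj a b -> cl a != cl b.
Variables (a0 b0 : X).
Hypothesis adj0 : adj a0 b0.
Hypothesis cl0 : cl a0.

Import GRing.Theory.
Local Open Scope ring_scope.

Definition cross (L R : Type) (x y : L + R) : bool :=
  match x, y with inl _, inr _ | inr _, inl _ => true | _, _ => false end.

(** The shape [_.-1.+1] gives the ordinals the group structure of Z_n, here with n = #|X| and in
    [Lam] with n the number of edges of H; both numbers are positive because of the edge [a0 b0]. *)
Let G := 'I_#|X|.-1.+1.
Let iota (a : X) : G := inord (enum_rank a).
Let Ed := [set p : X * X | adj p.1 p.2 && cl p.1].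
Let Lam := 'I_#|Ed|.-1.+1.
Let idx (p : X * X) : Lam := inord (index p (enum Ed)).
Let idxg (g : G) (b : X) : Lam :=
  if [pick a | iota a == g] is Some a then idx (a, b) else 0.

Let iota_inj : injective iota.
Proof.
move=> a b /(congr1 val) /=; have X0 : (0 < #|X|)%N by apply/card_gt0P; exists a0.
by rewrite !inordK ?prednK // => /ord_inj /enum_rank_inj.
Qed.

Let Ed_gt0 : (0 < #|Ed|)%N.
Proof. by apply/card_gt0P; exists (a0, b0); rewrite inE adj0 cl0. Qed.

Let idx_inj p p' : p \in Ed -> p' \in Ed -> idx p = idx p' -> p = p'.
Proof.
move=> pE pE' /(congr1 val) /=; rewrite !inordK ?prednK //; last 2 first.
- by rewrite cardE index_mem mem_enum.
- by rewrite cardE index_mem mem_enum.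
move=> e; rewrite -(nth_index p (s := enum Ed) (x := p)) ?mem_enum // e.
by rewrite nth_index // mem_enum.
Qed.

Let idx_surj l : exists2 p, p \in Ed & idx p = l.
Proof.
have lt : (l < #|Ed|)%N by apply: leq_trans (ltn_ord l) _; rewrite prednK.
exists (enum_val (Ordinal lt)); first exact: enum_valP.
apply: ord_inj; rewrite inordK (enum_val_nth (a0, b0)) index_uniq ?enum_uniq -?cardE //.
exact: ltn_ord l.
Qed.

Let idxgE a b : idxg (iota a) b = idx (a, b).
Proof.
by rewrite /idxg; case: pickP => [a' /eqP/iota_inj->//|/(_ a)]; rewrite eqxx.
Qed.

Let L := (G * Lam)%type.
Let R := (G * {ffun G -> Lam})%type.
(** An edge (a, b) whose left end is moved to i = iota a + s gets the left label - w i and a right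
    label with value w i + idx (a, b) at i. Their sum is the number of the edge, whatever [w] is; so
    the labels give the edge, then the shifts, then [w]. *)
Let phi (i : G * G * {ffun G -> Lam}) (a : X) : L + R :=
  let: (s, t, w) := i in
  if cl a then inl (iota a + s, - w (iota a + s))
  else inr (iota a + t, [ffun j => w j + idxg (j - s) a]).

Let phi_inj i : injective (phi i).
Proof.
case: i => [[s t] w] a b /=; case: (cl a); case: (cl b) => //.
  by move=> E; have [/addIr/iota_inj] := inl_pair_inj E.
by move=> E; have [/addIr/iota_inj] := inr_pair_inj E.
Qed.

Let phi_uniq i a b i' a' b' : adj a b -> adj a' b' -> cl a ->
  phi i a = phi i' a' -> phi i b = phi i' b' -> i = i'.
Proof.
case: i i' => [[s t] w] [[s' t'] w'] ab ab' ca /=.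
move: (adj_cl ab) (adj_cl ab'); rewrite ca; case cb: (cl b) => // _.
case ca': (cl a') => //; case cb': (cl b') => // _.
move=> E1 E2; have [e1 e2] := inl_pair_inj E1; have [e3 /ffunP e4] := inr_pair_inj E2.
have := e4 (iota a + s); rewrite !ffunE {4}e1 !addrK !idxgE.
rewrite -e1 in e2; move/oppr_inj: e2 => -> /addrI eidx.
have [] : (a, b) = (a', b') by apply: idx_inj eidx; rewrite inE /= ?ab ?ab' ?ca.
move=> ea eb; subst a' b'.
move/addrI: e1 => es; move/addrI: e3 => et; subst s' t'.
by congr (_, _); apply/ffunP => j; have := e4 j; rewrite !ffunE => /addIr.
Qed.

Let phi_surj i u k w' : exists j a b,
  [/\ adj a b, phi j a = inl (i, u) & phi j b = inr (k, w')].
Proof.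
have [[a b]] := idx_surj (u + w' i); rewrite inE /= => /andP[ab ca] e.
have cb : cl b = false by move: (adj_cl ab); rewrite ca; case: (cl b).
pose s := i - iota a.
exists (s, k - iota b, [ffun j => w' j - idxg (j - s) b]), a, b.
have si : iota a + s = i by rewrite addrC subrK.
split=> //=; rewrite ?ca ?cb ?si ?ffunE.
  have -> : i - s = iota a by rewrite -si addrK.
  by rewrite idxgE e opprB addrK.
rewrite [iota b + _]addrC subrK; congr (inr (_, _)).
by apply/ffunP => j; rewrite !ffunE subrK.
Qed.

Lemma biclique_base : exists L R : finType, [/\ (0 < #|L|)%N, (0 < #|R|)%N &
  decomposable adj (fun x y : L + R => nat_of_bool (cross x y))].
Proof.
exists L, R; split.
- by apply/card_gt0P; exists (0, 0).
- by apply/card_gt0P; exists (0, [ffun=> 0]).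
apply: (dec_intro (f := phi)) => [|i a b ab|x y xy|i a b i' a' b' ab ab' ea eb].
- exact: phi_inj.
- case: i => [[s t] w] /=.
  by move: (adj_cl ab); case: (cl a); case: (cl b).
- case: x y xy => [[i u]|[k w]] [[i' u']|[k' w']] //= _.
  have [j [a [b [ab ea eb]]]] := phi_surj i' u' k w.
  by exists j, b, a; rewrite adj_sym.
- case ca: (cl a); first exact: phi_uniq ab ab' ca ea eb.
  apply: (phi_uniq _ _ _ eb ea); rewrite ?(adj_sym b) ?(adj_sym b') //.
  by move: (adj_cl ab); rewrite ca; case: (cl b).
Qed.
End BipartiteBase.

Lemma subset_of_size (T : finType) (A : {set T}) k :
  k <= #|A| -> exists2 B : {set T}, B \subset A & #|B| = k.
Proof.
move=> kA; exists [set x in take k (enum A)].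
  by apply/subsetP => x; rewrite inE => /mem_take; rewrite mem_enum.
rewrite cardsE (card_uniqP _) ?take_uniq ?enum_uniq //.
by rewrite size_takel -?cardE.
Qed.

Lemma chunk_ind (T : finType) N (P : {set T} -> Prop) :
  0 < N -> P set0 ->
  (forall A1 A2 : {set T}, [disjoint A1 & A2] -> #|A1| = N ->
     N %| #|A2| -> P A2 -> P (A1 :|: A2)) ->
  forall A : {set T}, N %| #|A| -> P A.
Proof.
move=> N0 P0 PU A; have [n] := ubnP #|A|; elim: n A => // n IH A An NA.
have [->//|/set0Pn[x xA]] := eqVneq A set0.
have NlA : N <= #|A| by apply: dvdn_leq => //; apply/card_gt0P; exists x.
have [B BA cB] := subset_of_size NlA.
rewrite -(setID A B) (setIidPr BA).
have cD : #|A :\: B| = #|A| - N by rewrite cardsD (setIidPr BA) cB.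
have ND : N %| #|A :\: B| by rewrite cD dvdn_sub.
apply: PU => //; first by rewrite -setI_eq0; apply/eqP/setP => y; rewrite !inE; case: (y \in B).
by apply: IH => //; rewrite cD; lia.
Qed.

Section Blocks.
Variables (T : finType).
Implicit Types A B C : {set T}.

Lemma bicliqueC A B x y : biclique A B x y = biclique B A x y.
Proof. by rewrite /biclique addnC; congr (_ + _); rewrite andbC. Qed.

Lemma bicliqueUl A1 A2 B x y : [disjoint A1 & A2] ->
  biclique (A1 :|: A2) B x y = biclique A1 B x y + biclique A2 B x y.
Proof.
move=> /disjointFr d; rewrite /biclique !inE.
have := d x; have := d y.
by do 2!case: (_ \in A1); do 2!case: (_ \in A2); do 2!case: (_ \in B) => //;
   move=> // h1 h2; try (by have := h1 isT); try (by have := h2 isT).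
Qed.

(** Gluing at the common vertex [o]: if #|A| and #|B| - 1 are multiples of M, both complete graphs
    have order 1 modulo M and both sides of the bipartite graph have size divisible by M. *)
Lemma cliqueU A B o x y : [disjoint A & B] -> o \in B ->
  clique (A :|: B) x y = clique (o |: A) x y + clique B x y + biclique A (B :\ o) x y.
Proof.
move=> /disjointFr d oB; rewrite /clique /biclique !inE.
have dx := d x; have dy := d y.
have ox : (x == o) -> x \in B by move/eqP->.
have oy : (y == o) -> y \in B by move/eqP->.
have exy : x == y -> x == o = (y == o) by move/eqP->.
have exy' : x == o -> y == o -> x == y by move=> /eqP-> /eqP->.
have exA : x == y -> (x \in A) = (y \in A) by move/eqP->.
have exB : x == y -> (x \in B) = (y \in B) by move/eqP->.
move: dx dy ox oy exy exy' exA exB.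
case: (x \in A) (y \in A) (x \in B) (y \in B) => [] [] [] [] dx dy;
  try (by have := dx isT); try (by have := dy isT);
  move=> ox oy; case: (x == o) ox => ox; try (by have := ox isT);
  case: (y == o) oy => oy; try (by have := oy isT);
  case: (x == y) => // exy exy' exA exB;
  try (by have := exy isT); try (by have := exy' isT isT);
  try (by have := exA isT); try (by have := exB isT).
Qed.

End Blocks.

Section Multiples.
Variables (X : finType) (adj : rel X).

Section FromBase.
Variables (L R : finType).
Hypothesis L0 : 0 < #|L|.
Hypothesis R0 : 0 < #|R|.
Hypothesis base : decomposable adj (fun x y : L + R => nat_of_bool (cross x y)).

Lemma biclique_small (T : finType) (A B : {set T}) :
  [disjoint A & B] -> #|A| = #|L| -> #|B| = #|R| -> decomposable adj (biclique A B).
Proof.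
move=> dAB cA cB.
pose gl (l : L) : T := enum_val (cast_ord (esym cA) (enum_rank l)).
pose gr (r : R) : T := enum_val (cast_ord (esym cB) (enum_rank r)).
pose g (x : L + R) : T := match x with inl l => gl l | inr r => gr r end.
have glA l : gl l \in A by apply: enum_valP.
have grB r : gr r \in B by apply: enum_valP.
have glB l : gl l \in B = false by rewrite (disjointFr dAB).
have grA r : gr r \in A = false by rewrite (disjointFl dAB).
have gi : injective g.
  move=> [l|r] [l'|r'] /= e.
  - by move/enum_val_inj/cast_ord_inj/enum_rank_inj: e => ->.
  - by have := glB l; rewrite e grB.
  - by have := grA r; rewrite e glA.
  - by move/enum_val_inj/cast_ord_inj/enum_rank_inj: e => ->.
have gA x : x \in A -> x \in codom g.
  move=> xA; apply/codomP.
  exists (inl (enum_val (cast_ord cA (enum_rank_in xA x)))) => /=.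
  by rewrite /gl enum_valK cast_ordK enum_rankK_in.
have gB x : x \in B -> x \in codom g.
  move=> xB; apply/codomP.
  exists (inr (enum_val (cast_ord cB (enum_rank_in xB x)))) => /=.
  by rewrite /gr enum_valK cast_ordK enum_rankK_in.
apply: (dec_pull gi) => [x y nx|x y ny|].
- have := contra (gA x) nx; have := contra (gB x) nx.
  by rewrite /biclique => /negPf-> /negPf->.
- have := contra (gA y) ny; have := contra (gB y) ny.
  by rewrite /biclique => /negPf-> /negPf->; rewrite !andbF.
- apply: dec_ext base => -[l|r] [l'|r'] /=;
  by rewrite /biclique ?glA ?grB ?glB ?grA.
Qed.

Lemma biclique_mult (T : finType) (A B : {set T}) :
  [disjoint A & B] -> #|L| %| #|A| -> #|R| %| #|B| -> decomposable adj (biclique A B).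
Proof.
move=> dAB LA RB; move: A LA dAB; apply: chunk_ind => // [|A1 A2 dA cA _ IH dAB].
  by move=> _; apply: dec_ext (dec0 adj T) => x y; rewrite /biclique !inE !andbF.
suff H (B' : {set T}) : #|R| %| #|B'| -> [disjoint A1 & B'] -> decomposable adj (biclique A1 B').
  have d1 : [disjoint A1 & B] by apply: disjointWl dAB; apply: subsetUl.
  have d2 : [disjoint A2 & B] by apply: disjointWl dAB; apply: subsetUr.
  by apply: dec_ext (decD (H B RB d1) (IH d2)) => x y; rewrite bicliqueUl.
move: B' {dAB RB}; apply: chunk_ind => // [_|B1 B2 dB cB _ IHB dAB].
  by apply: dec_ext (dec0 adj T) => x y; rewrite /biclique !inE !andbF.
have d1 : [disjoint A1 & B1] by apply: disjointWr dAB; apply: subsetUl.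
have d2 : [disjoint A1 & B2] by apply: disjointWr dAB; apply: subsetUr.
apply: dec_ext (decD (biclique_small d1 cA cB) (IHB d2)) => x y.
by rewrite [RHS]bicliqueC bicliqueUl // -!(bicliqueC A1).
Qed.
End FromBase.

(** * Complete graphs of order 2 Q^2 + 1 by cyclic differences *)

Section Cyclic.
Variables (Q : nat).
Hypothesis Q0 : 0 < Q.
Hypothesis bipQ : forall (T : finType) (A B : {set T}),
  [disjoint A & B] -> Q %| #|A| -> Q %| #|B| -> decomposable adj (biclique A B).
Import GRing.Theory.

Let p := (2 * Q * Q).
Let Zp := 'I_p.+1.

(* The differences between multiples [Q, 2Q, ..., Q^2] and [0, ..., Q - 1] run
   over [1, ..., Q^2], one of each pair of opposite elements of Z_(2Q^2+1). *)
Let A (z : Zp) := [set x : Zp | val (x - z)%R < Q].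
Let B (z : Zp) := [set y : Zp | [&& Q %| val (y - z)%R, 0 < val (y - z)%R & val (y - z)%R <= Q * Q]].

Let cA z : #|A z| = Q.
Proof.
have <- : #|[set x : Zp | x < Q]| = Q.
  have h : Q <= p.+1 by rewrite /p; nia.
  rewrite -[RHS]card_ord -(card_image (f := widen_ord h)).
    apply: eq_card => x; rewrite inE; apply/idP/imageP => [xQ|[y _ ->]].
      by exists (Ordinal xQ) => //; apply: val_inj.
    exact: ltn_ord y.
  by move=> x y /(congr1 val)/= /val_inj.
rewrite -[RHS](card_imset _ (addIr z)); apply: eq_card => x; rewrite inE.
apply/idP/imsetP => [xA|[y]]; last by rewrite inE => yQ ->; rewrite addrK.
by exists (x - z)%R; rewrite ?inE // subrK.
Qed.

Let cB z : #|B z| = Q.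
Proof.
have h (l : 'I_Q) : Q * l.+1 < p.+1 by have := ltn_ord l; rewrite /p; nia.
pose f (l : 'I_Q) : Zp := Ordinal (h l).
have fi : injective f.
  move=> l l' /(congr1 val) /= /eqP; rewrite eqn_pmul2l // => /eqP[].
  exact: val_inj.
rewrite -[RHS]card_ord -(card_image (f := fun l => (f l + z)%R)); last first.
  by move=> l l' /addIr/fi.
apply: eq_card => y; rewrite inE; apply/idP/imageP => [/and3P[Qy y0 yQ]|[l _ ->]].
  have hl : ((y - z)%R %/ Q).-1 < Q.
    have : (y - z)%R %/ Q <= Q by rewrite leq_divLR.
    by case: (_ %/ _) => // ; lia.
  exists (Ordinal hl) => //; apply: (addIr (- z)%R); rewrite addrK.
  apply: val_inj => /=; rewrite prednK ?divn_gt0 //; last exact: dvdn_leq.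
  by rewrite mulnC divnK.
by rewrite addrK /= dvdn_mulr // leq_pmul2l // ltn_ord muln_gt0 Q0.
Qed.

Let dAB z : [disjoint A z & B z].
Proof.
rewrite -setI_eq0; apply/eqP/setP => x; rewrite !inE.
apply/negP => /andP[xQ /and3P[dv x0 _]].
by have := dvdn_leq x0 dv; rewrite leqNgt xQ.
Qed.

Let count x y : \sum_z ((x \in A z) && (y \in B z)) =
  (0 < val (y - x)%R <= Q * Q) :> nat.
Proof.
set D := val (y - x)%R.
have yz z : val (y - z)%R = (D + val (x - z)%R) %% p.+1.
  by rewrite -[RHS]/(val ((y - x) + (x - z))%R) addrA subrK.
have Dp : D < p.+1 := ltn_ord _.
have pQ : Q * Q + Q <= p by rewrite /p; nia.
have [/andP[D0 DQ]|/negbTE nD] := boolP (0 < D <= Q * Q); last first.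
  rewrite big1 // => z _; apply/eqP; rewrite eqb0 !inE yz; apply/negP.
  move: (val (x - z)%R) => i /andP[iQ /and3P[dv]].
  have [lt|ge] := ltnP (D + i) p.+1.
    rewrite modn_small // => h1 h2; rewrite modn_small // in dv.
    have [D0|D0] := posnP D.
      by move: dv h1; rewrite D0 add0n => /dvdn_leq h /h; rewrite leqNgt iQ.
    by move: nD; rewrite D0 /= ; lia.
  (* After wrapping round, the residue is below i < Q, so it is not a positive multiple of Q. *)
  have e : (D + i) %% p.+1 = D + i - p.+1.
    rewrite -{1}(subnK ge) modnDr modn_small //.
    by have : Q <= p; rewrite /p; nia.
  rewrite e in dv *.
  by move=> h1 h2; have := dvdn_leq h1 dv; lia.
(* D + i is D rounded up to a multiple of Q. As x - z is below Q, the difference y - z can only be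
   this multiple, which determines z. *)
pose i := (Q * ((D + Q.-1) %/ Q)) - D.
have hdiv := divn_eq (D + Q.-1) Q.
have hmod : (D + Q.-1) %% Q < Q by rewrite ltn_mod.
have hq : (D + Q.-1) %/ Q <= Q.
  by rewrite -ltnS ltn_divLR //; nia.
set q := (D + Q.-1) %/ Q in i hdiv hq *.
have ile : D <= Q * q by rewrite mulnC; lia.
have iQ : i < Q by rewrite /i; lia.
have ei : D + i = Q * q by rewrite /i; lia.
have QQ : Q * q <= Q * Q by rewrite leq_pmul2l.
have ip : i < p.+1 by rewrite /p; nia.
have Qp : Q * Q < p.+1 by rewrite /p; nia.
apply: (@sum1_nat _ _ (x - Ordinal ip)%R).
  rewrite !inE yz opprB addrC subrK /= iQ ei modn_small ?dvdn_mulr //=; last by lia.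
  by rewrite QQ andbT -ei; lia.
move=> z; rewrite !inE yz => /andP[zQ].
have lt : D + val (x - z)%R < p.+1 by move: zQ; rewrite /=; lia.
rewrite modn_small // => /and3P[/dvdnP[k ek] _ _].
suff e : (x - z)%R = Ordinal ip by rewrite -e opprB addrC subrK.
apply: val_inj; rewrite [RHS]/=; move: zQ ek; move: (val (x - z)%R) => j jQ ek.
have : k = q.
  have [h|h|//] := ltngtP k q.
    have : k.+1 * Q <= q * Q by rewrite leq_mul2r h orbT.
    by rewrite mulSn; lia.
  have : q.+1 * Q <= k * Q by rewrite leq_mul2r h orbT.
  by rewrite mulSn; lia.
by move=> ekq; rewrite ekq mulnC in ek; lia.
Qed.

Lemma clique_base : decomposable adj (clique [set: Zp]).
Proof.
apply: dec_ext (dec_sum (P := predT) (m := fun z => biclique (A z) (B z)) _) => [x y|z _].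
  rewrite /biclique big_split /= count.
  rewrite (eq_bigr (fun z => nat_of_bool ((y \in A z) && (x \in B z)))); last first.
    by move=> z _; rewrite andbC.
  rewrite count /clique !in_setT !andTb.
  have [->|ne] := eqVneq x y; first by rewrite !subrr.
  have : val (y - x)%R != 0 by apply: contra ne => /eqP e; rewrite eq_sym -subr_eq0; apply/eqP/val_inj.
  have -> : (x - y = - (y - x))%R by rewrite opprB.
  have := ltn_ord (y - x)%R; move: (y - x)%R => u up u0.
  have u0' : 0 < u by rewrite lt0n.
  have -> : val (- u)%R = p.+1 - u by rewrite /= modn_small //; lia.
  have -> : val u = u by [].
  have ep : p = Q * Q + Q * Q by rewrite /p; lia.
  have [h|h] := leqP u (Q * Q).
    have -> : (p.+1 - u <= Q * Q) = false by lia.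
    by rewrite andbF u0'.
  have -> : (p.+1 - u <= Q * Q) by lia.
  by rewrite andbF andbT; lia.
by apply: bipQ; rewrite ?cA ?cB ?dvdnn.
Qed.
End Cyclic.

End Multiples.

Section Modulus.
Variables (X : finType) (adj : rel X) (cl : X -> bool).
Hypothesis adj_sym : symmetric adj.
Hypothesis adj_cl : forall a b, adj a b -> cl a != cl b.
Variables (a0 b0 : X).
Hypothesis adj0 : adj a0 b0.
Hypothesis cl0 : cl a0.

Lemma clique_pull (T S : finType) (A : {set T}) :
  #|A| = #|S| -> decomposable adj (clique [set: S]) -> decomposable adj (clique A).
Proof.
move=> cA base.
pose g (s : S) : T := enum_val (cast_ord (esym cA) (enum_rank s)).
have gA s : g s \in A by apply: enum_valP.
have gi : injective g by move=> s t /enum_val_inj/cast_ord_inj/enum_rank_inj.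
have Ag x : x \in A -> x \in codom g.
  move=> xA; apply/codomP; exists (enum_val (cast_ord cA (enum_rank_in xA x))).
  by rewrite /g enum_valK cast_ordK enum_rankK_in.
apply: (dec_pull gi) => [x y nx|x y ny|].
- by rewrite /clique (negPf (contra (Ag x) nx)).
- by rewrite /clique (negPf (contra (Ag y) ny)) andbF.
- by apply: dec_ext base => x y; rewrite /clique !gA !inE (inj_eq gi).
Qed.

(** M = 2 Q^2, so that the cyclic construction has order M + 1; larger orders in the same class
    arise by gluing complete graphs of order M + 1 at one vertex. The prescribed divisor [d] will be
    a degree of H, which makes M a sum of degrees. *)
Lemma exists_modulus d : 0 < d -> exists M, [/\ 1 < M, d %| M,
  forall (T : finType) (A B : {set T}), [disjoint A & B] ->
    M %| #|A| -> M %| #|B| -> decomposable adj (biclique A B) &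
  forall (T : finType) (A : {set T}), #|A| = 1 %[mod M] -> decomposable adj (clique A)].
Proof.
move=> d0; have [L [R [L0 R0 base]]] := biclique_base adj_sym adj_cl adj0 cl0.
pose Q := #|L| * #|R| * d; have Q0 : 0 < Q by rewrite !muln_gt0 L0 R0.
have bipQ (T : finType) (A B : {set T}) : [disjoint A & B] ->
    Q %| #|A| -> Q %| #|B| -> decomposable adj (biclique A B).
  move=> dAB QA QB; apply: (biclique_mult L0 R0 base dAB).
    by apply: dvdn_trans QA; rewrite /Q -mulnA dvdn_mulr.
  by apply: dvdn_trans QB; rewrite /Q mulnAC dvdn_mull.
have QM : Q %| 2 * Q * Q by rewrite dvdn_mull.
have M1 : 1 < 2 * Q * Q by nia.
have bipM (T : finType) (A B : {set T}) : [disjoint A & B] ->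
    2 * Q * Q %| #|A| -> 2 * Q * Q %| #|B| -> decomposable adj (biclique A B).
  by move=> dAB QA QB; apply: bipQ => //; [apply: dvdn_trans QA|apply: dvdn_trans QB].
exists (2 * Q * Q); split=> //.
  by apply: dvdn_trans QM; rewrite dvdn_mull.
have KM := clique_base Q0 bipQ.
move=> T A cA; have /set0Pn[o oA] : A != set0.
  by apply: contraTneq M1 => A0; rewrite -leqNgt; move: cA; rewrite A0 cards0 mod0n;
     case: (2 * Q * Q) => [|[|k]] //; rewrite modn_small.
have cA' : 2 * Q * Q %| #|A :\ o|.
  move: cA; rewrite (cardsD1 o) oA -{2}[1]addn0 => /eqP.
  by rewrite eqn_modDl mod0n.
rewrite -(setD1K oA); move: (setD11 o A) => /negbT.
move: (A :\ o) cA'; apply: chunk_ind => [|_|A1 A2 dA cA1 cA2' IH oU]; first by lia.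
  by apply: dec_ext (dec0 adj T) => x y; rewrite /clique setU0 !inE; case: eqP => // ->; rewrite eq_sym; case: eqP.
move: (oU); rewrite inE negb_or => /andP[o1 o2].
have dA1 : [disjoint A1 & o |: A2].
  rewrite -setI_eq0; apply/eqP/setP => x; rewrite !inE.
  case xA: (x \in A1) => //=; rewrite (disjointFr dA xA) orbF.
  by apply: contraNF o1 => /eqP <-.
have cA2 : #|o |: A1| = #|'I_(2 * Q * Q).+1| by rewrite cardsU1 o1 cA1 card_ord.
have K1 := clique_pull cA2 KM.
have eD : (o |: A2) :\ o = A2 by rewrite setU1K.
have -> : o |: (A1 :|: A2) = A1 :|: (o |: A2) by rewrite setUCA.
apply: dec_ext (decD (decD K1 (IH o2)) (bipM _ A1 A2 dA _ cA2')) => [x y|].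
  by rewrite (cliqueU _ _ dA1 (setU11 _ _)) eD.
by rewrite cA1.
Qed.

End Modulus.

(** The bijection is the explicit one matching two enumerations, so that the same formula can serve
    in a definition such as [lab]. *)
Lemma relabel (A B : finType) (b0 : B) (C : {set A}) (E : {set B}) :
  #|C| = #|E| ->
  let h a := nth b0 (enum E) (index a (enum C)) in
  [/\ {in C, forall a, h a \in E}, {in C &, injective h} &
     {in E, forall b, exists2 a, a \in C & h a = b}].
Proof.
move=> cCE h.
have sz : size (enum C) = size (enum E) by rewrite -!cardE.
split=> [a aC|a a' aC aC' e|b bE].
- by rewrite -mem_enum mem_nth // -sz index_mem mem_enum.
- have : index a (enum C) == index a' (enum C).
    rewrite -(nth_uniq b0 _ _ (enum_uniq E)) -?sz ?index_mem ?mem_enum //.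
    exact/eqP.
  move/eqP=> ei; rewrite -(nth_index a (s := enum C) (x := a)) ?mem_enum // ei.
  by rewrite nth_index ?mem_enum.
- have lt : index b (enum E) < #|C| by rewrite cCE cardE index_mem mem_enum.
  exists (enum_val (Ordinal lt)); first exact: enum_valP.
  rewrite /h (enum_val_nth (enum_val (Ordinal lt))) index_uniq ?enum_uniq -?cardE //=.
  by rewrite nth_index ?mem_enum.
Qed.

(** * Existence of a completion *)

Section Interpolation.
Variables (K : finFieldType) (n : nat) (S : finType) (pt : S -> K).
Hypothesis cS : #|S| = n.
Hypothesis pt_inj : injective pt.
Import GRing.Theory.
Local Open Scope ring_scope.

Definition evalp (n : nat) (t : {ffun 'I_n -> K}) (c : K) : K :=
  \sum_(k < n) t k * c ^+ k.

Lemma evalp_inj (t t' : {ffun 'I_n -> K}) :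
  (forall s, evalp t (pt s) = evalp t' (pt s)) -> t = t'.
Proof.
move=> e; apply/ffunP => i; apply/eqP; rewrite -subr_eq0.
pose p := \poly_(k < n) (if insub k is Some i then t i - t' i else 0).
suff p0 : p = 0.
  have := coef_poly n (fun k => if insub k is Some i then t i - t' i else 0) i.
  by rewrite ltn_ord valK -/p p0 coef0 => <-.
apply/eqP; apply: contraTT isT => p0.
have := @max_poly_roots _ p (map pt (enum S)) p0.
rewrite map_inj_uniq // enum_uniq size_map -cardE cS => h.
have := leq_trans (h _ isT) (size_poly _ _); rewrite ltnn; apply.
apply/allP => _ /mapP[s _ ->]; apply/rootP; rewrite horner_poly.
rewrite (eq_bigr (fun i => t i * pt s ^+ i - t' i * pt s ^+ i)).
  by rewrite sumrB; apply/eqP; rewrite subr_eq0; apply/eqP/e.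
by move=> k _; rewrite valK mulrBl.
Qed.

(** Interpolation by counting: evaluation is an injective map between finite sets of the same
    size. *)
Lemma evalp_surj (v : S -> K) : exists t : {ffun 'I_n -> K}, forall s, evalp t (pt s) = v s.
Proof.
pose f (t : {ffun 'I_n -> K}) : {ffun S -> K} := [ffun s => evalp t (pt s)].
have fi : injective f.
  by move=> t t' /ffunP e; apply: evalp_inj => s; have := e s; rewrite !ffunE.
have : [ffun s => v s] \in codom f.
  by apply: inj_card_onto fi _ _; rewrite !card_ffun cS card_ord.
by case/codomP=> t /ffunP e; exists t => s; have := e s; rewrite !ffunE.
Qed.
End Interpolation.

Section Rest.
Variables (X : finType) (adj : rel X).
Hypothesis adj_sym : symmetric adj.
Hypothesis adj_irr : irreflexive adj.
Variables (a0 b0 : X).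
Hypothesis adj0 : adj a0 b0.

Lemma wtC (T : eqType) (f : X -> T) x y : wt adj f x y = wt adj f y x.
Proof.
rewrite /wt [LHS](reindex_inj (h := fun p => (p.2, p.1))).
  by apply: eq_big => p /=; rewrite 1?adj_sym // andbC.
by apply: (can_inj (g := fun p => (p.2, p.1))) => -[].
Qed.

Lemma wt_le1 (T : eqType) (f : X -> T) x y : injective f -> wt adj f x y <= 1.
Proof.
move=> fi; have [|] := posnP (wt adj f x y); first by move->.
by case/wt_gt0P=> a [b [_ <- <-]]; rewrite wt_inj //; case: adj.
Qed.

Lemma wtxx (T : eqType) (f : X -> T) x : injective f -> wt adj f x x = 0.
Proof.
move=> fi; apply: wt_eq0 => a b ab <- /fi e; by move: ab; rewrite e adj_irr.
Qed.

Lemma decC (T : finType) (m : T -> T -> nat) x y : decomposable adj m -> m x y = m y x.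
Proof. by case=> I [f [_ fm]]; rewrite !fm; apply: eq_bigr => i _; rewrite wtC. Qed.

Lemma decxx (T : finType) (m : T -> T -> nat) x : decomposable adj m -> m x x = 0.
Proof. by case=> I [f [fi fm]]; rewrite fm big1 // => i _; rewrite wtxx. Qed.

Lemma dec_wt (T : finType) (f : X -> T) : injective f -> decomposable adj (wt adj f).
Proof.
move=> fi; exists unit, (fun _ => f); split=> // x y.
by rewrite (bigD1 tt) //= big1 ?addn0 // => -[].
Qed.

Lemma dec_muln (T : finType) (m : T -> T -> nat) k :
  decomposable adj m -> decomposable adj (fun x y => k * m x y).
Proof.
move=> dm; apply: dec_ext (dec_sum (P := predT) (J := 'I_k) (fun _ _ => dm)) => x y.
by rewrite sum_nat_const card_ord.
Qed.

(** The symmetric group of T is doubly transitive and permutes the injections into T. *)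
Lemma sum_all_inj (T : finType) (x y x' y' : T) : x != y -> x' != y' ->
  \sum_(f : {ffun X -> T} | injectiveb f) wt adj f x y =
  \sum_(f : {ffun X -> T} | injectiveb f) wt adj f x' y'.
Proof.
move=> nxy nxy'.
have [s [sx sy]] : exists s : {perm T}, s x = x' /\ s y = y'.
  exists (tperm x x' * tperm (tperm x x' y) y')%g; rewrite !permM tpermL.
  split; last exact: tpermL.
  rewrite tpermD //; last by rewrite eq_sym.
  by apply: contra nxy => /eqP/(canRL (tpermK _ _)); rewrite tpermR => ->.
rewrite [RHS](reindex_inj (h := fun f : {ffun X -> T} => [ffun a => s (f a)])).
  apply: eq_big => f.
    apply/injectiveP/injectiveP => fi a b e; apply: fi.
      by move: e; rewrite !ffunE => /perm_inj.
    by rewrite !ffunE e.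
  move=> _; rewrite -sx -sy -(wt_comp _ f _ _ (@perm_inj _ s)).
  by apply: eq_bigr => p _; rewrite !ffunE.
by move=> f g /ffunP e; apply/ffunP => a; have := e a; rewrite !ffunE => /perm_inj.
Qed.

(** All injections of the vertices of H into T together cover each pair equally often. The copies
    making up [F] are distinct as functions, since a repeated one would cover the image of the edge
    [a0 b0] twice; deleting them from the family of all injections leaves [r]. *)
Lemma dec_rest (T : finType) (F : rel T) : decomposable adj (fun x y => nat_of_bool (F x y)) ->
  exists lam r, decomposable adj r /\ forall x y, r x y + F x y = lam * (x != y).
Proof.
move=> dF; have F0 x : nat_of_bool (F x x) = 0 := decxx x dF; case: (dF) => I [f [fi fm]].
pose ff i := finfun (f i).
have ffi : injective ff.
  move=> i j e; apply/eqP; apply: contraT => nij.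
  have fE : f j a0 = f i a0 /\ f j b0 = f i b0.
    by move/ffunP: e => e; have := e a0; have := e b0; rewrite !ffunE.
  have : F (f i a0) (f i b0) <= 1 by case: (F _ _).
  rewrite fm (bigD1 i) //= (bigD1 j) /=; last by rewrite eq_sym.
  have -> : wt adj (f i) (f i a0) (f i b0) = 1 by rewrite wt_inj // adj0.
  by have -> : wt adj (f j) (f i a0) (f i b0) = 1 by rewrite -fE.1 -fE.2 wt_inj // adj0.
pose r x y := \sum_(g : {ffun X -> T} | injectiveb g && (g \notin codom ff)) wt adj g x y.
have rF x y : r x y + F x y = \sum_(g : {ffun X -> T} | injectiveb g) wt adj g x y.
  rewrite [RHS](bigID (mem (codom ff))) /= addnC; congr (_ + _).
  rewrite fm.
  rewrite (eq_bigl (mem (ff @: [set: I]))); last first.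
    move=> g /=; apply/andP/imsetP => [[_ /codomP[i ->]]|[i _ ->]]; first by exists i.
    split; last exact: codom_f.
    by apply/injectiveP => a b; rewrite !ffunE => /fi.
  rewrite big_imset /=; last by move=> i j _ _; apply: ffi.
  by apply: eq_big => i; rewrite ?inE // => _; apply: eq_bigr => p _; rewrite !ffunE.
have dr : decomposable adj r.
  by apply: dec_sum => g /andP[/injectiveP gi _]; apply: dec_wt.
have [|/pred0Pn[[x y] /= nxy]] := boolP (pred0b (fun p : T * T => p.1 != p.2)).
  move/pred0P=> h; exists 0, r; split=> // x y; have := h (x, y) => /negbFE/eqP /= ->.
  by rewrite F0 decxx.
exists (\sum_(g : {ffun X -> T} | injectiveb g) wt adj g x y), r; split=> // u v.
rewrite rF; have [->|nuv] := eqVneq u v; last by rewrite muln1; apply: sum_all_inj.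
by rewrite muln0 big1 // => g /injectiveP gi; rewrite wtxx.
Qed.
End Rest.

Section Img.
Variables (D T : finType) (g : D -> T) (F : rel D).

Definition img : rel T := fun x y =>
  [exists p : D * D, [&& g p.1 == x, g p.2 == y & F p.1 p.2]].

Definition cmpl : rel T := fun x y => (x != y) && ~~ img x y.

Hypothesis gi : injective g.

Lemma img_in a b : img (g a) (g b) = F a b.
Proof.
apply/existsP/idP => [[[c d] /= /and3P[/eqP/gi-> /eqP/gi->]]//|Fab].
by exists (a, b); rewrite /= !eqxx.
Qed.

Lemma img_outl x y : x \notin codom g -> img x y = false.
Proof.
move=> nx; rewrite /img; apply/existsP => -[p] /and3P[/eqP e _ _].
by case/negP: nx; rewrite -e codom_f.
Qed.

Lemma img_outr x y : y \notin codom g -> img x y = false.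
Proof.
move=> nx; rewrite /img; apply/existsP => -[p] /and3P[_ /eqP e _].
by case/negP: nx; rewrite -e codom_f.
Qed.
End Img.

(* [psi] covers every pair [#|K|] times, the edges of [F] once less.  The copies
   covering [i, k] are numbered by the labels in [K] (without 0 if [i, k] is an
   edge of [F]), and the label of a pair [(i, u)], [(k, w)] with [i] before [k]
   is [u k - w i].  A polynomial [t] places [i] at the function
   [c |-> t (xi i c)], shifted by the label of the copy at the later end; since
   [xi i k = xi k i], two functions with the right label prescribe [t] at [n]
   points.  The pairs of label 0 over the edges of [F] form disjoint copies of
   [F], one for each [t], and only the one at [t = 0] is left uncovered. *)
Section Blowup.
Variables (X : finType) (adj : rel X) (cl : X -> bool).
Hypothesis adj_sym : symmetric adj.
Hypothesis adj_cl : forall a b, adj a b -> cl a != cl b.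

Let adj_irr : irreflexive adj.
Proof. by move=> a; apply/negP => /adj_cl; rewrite eqxx. Qed.

Variables (D E I : finType) (K : finFieldType).
Variables (F : rel D) (psi : I -> X -> D).
Local Notation Cd := (D + E)%type.
Variable num : {set Cd} -> K.
Hypothesis num_inj : injective num.
Hypothesis psi_inj : forall i, injective (psi i).
Hypothesis psiF : forall x y, x != y -> \sum_i wt adj (psi i) x y + F x y = #|K|.
Hypothesis dF : decomposable adj (fun x y => nat_of_bool (F x y)).

Import GRing.Theory.
Local Open Scope ring_scope.

Let FC x y : F x y = F y x.
Proof.
by have := decC adj_sym x y dF; case: (F x y); case: (F y x).
Qed.

Let Fxx x : F x x = false.
Proof. by have := decxx adj_irr x dF; case: (F x x). Qed.

Let xi (i : D) (c : Cd) : K := num [set inl i; c].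

Let xi_inj i : injective (xi i).
Proof.
move=> c c' /num_inj/setP e.
have := e c; have := e c'; rewrite !inE !eqxx !orbT.
move=> /orP[/eqP ci'|/eqP->//].
by move=> /esym /orP[/eqP ci|/eqP//]; rewrite ci ci'.
Qed.

Let xi_eq i k c c' : i != k -> xi i c = xi k c' -> c = inl k /\ c' = inl i.
Proof.
move=> nik /num_inj/setP e.
have := e (inl i); have := e (inl k); rewrite !inE !eqxx !orTb.
rewrite !(inj_eq inl_inj) (negPf nik) eq_sym (negPf nik) /= => /eqP-> /esym/eqP->.
by split.
Qed.

Let xi_sym i k : xi i (inl k) = xi k (inl i).
Proof. by rewrite /xi setUC. Qed.

(** The functions at i and at k both prescribe the value at the point of {i, k}; the condition in
    [S] counts this point only once. *)
Let n := (#|{: Cd}| + #|{: Cd}|.-1)%N.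
Let S i := (Cd + {c : Cd | c != inl i})%type.
Let pt i k (s : S i) := match s with inl c => xi i c | inr c => xi k (val c) end.

Let cS i : #|{: S i}| = n.
Proof. by rewrite card_sum card_sig cardC1. Qed.

Let pt_inj i k : i != k -> injective (@pt i k).
Proof.
move=> nik [c|c] [c'|c'] /=; first by move/xi_inj->.
- by case/xi_eq=> // _ e; case/eqP: (valP c').
- by move/esym; case/xi_eq=> // _ e; case/eqP: (valP c).
- by move/xi_inj/val_inj->.
Qed.

Let poly := {ffun 'I_n -> K}.
Let Gam := {ffun Cd -> K}.
Let T := (D * Gam)%type.

Let interp_inj i k (t t' : poly) : i != k ->
  (forall c, evalp t (xi i c) = evalp t' (xi i c)) ->
  (forall c, evalp t (xi k c) = evalp t' (xi k c)) -> t = t'.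
Proof.
move=> nik e1 e2; apply: (evalp_inj (cS i) (pt_inj nik)) => -[c|c] /=.
  exact: e1.
exact: e2.
Qed.

Let interp_surj i k (u w : Gam) : i != k -> u (inl k) = w (inl i) ->
  exists t : poly, (forall c, evalp t (xi i c) = u c) /\ (forall c, evalp t (xi k c) = w c).
Proof.
move=> nik e.
have [t te] := evalp_surj (cS i) (pt_inj nik)
  (fun s : S i => match s with inl c => u c | inr c => w (val c) end).
exists t; split=> c; first exact: te (inl c).
have [->|nc] := eqVneq c (inl i); first by rewrite xi_sym (te (inl (inl k))).
exact: te (inr (exist _ c nc)).
Qed.

Let lt (i k : D) := (enum_rank i < enum_rank k)%N.

Let lt_total i k : i != k -> lt k i = ~~ lt i k.
Proof.
move=> nik; have : nat_of_ord (enum_rank i) <> enum_rank k.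
  by move/ord_inj/enum_rank_inj => e; rewrite e eqxx in nik.
by rewrite /lt; lia.
Qed.

Let cov i k := [set j | (0 < wt adj (psi j) i k)%N].
Let labs i k := [set z : K | ~~ (F i k && (z == 0))].

Let card_cov i k : i != k -> #|cov i k| = #|labs i k|.
Proof.
move=> nik; have := psiF nik.
have -> : (\sum_j wt adj (psi j) i k = #|cov i k|)%N.
  rewrite -sum1dep_card [RHS]big_mkcond; apply: eq_bigr => j _.
  by have := wt_le1 adj i k (@psi_inj j); case: (wt _ _ _ _) => [|[]].
move=> h; apply/eqP; rewrite -(eqn_add2r (F i k)) h; apply/eqP.
case Fik: (F i k); last first.
  by rewrite addn0; apply: eq_card => z; rewrite !inE Fik.
rewrite -[LHS]cardsT (cardsD1 0 [set: K]) in_setT [RHS]addnC; congr (_ + _)%N.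
by apply: eq_card => z; rewrite !inE Fik andbT.
Qed.

Let lab j i k : K := nth 0 (enum (labs i k)) (index j (enum (cov i k))).

Let shift j (i : D) (c : Cd) : K :=
  if c is inl l then (if lt l i then lab j l i else 0) else 0.

Let pos j (t : poly) (i : D) : Gam := [ffun c => evalp t (xi i c) - shift j i c].
Let phi (jt : I * poly) (a : X) : T := (psi jt.1 a, pos jt.1 jt.2 (psi jt.1 a)).

Let g1 : rel T := fun x y =>
  (x.1 != y.1) && ~~ (F x.1 y.1 && (x.2 (inl y.1) == y.2 (inl x.1))).

Let g1C x y : g1 x y = g1 y x.
Proof. by rewrite /g1 FC eq_sym [in X in _ && ~~ (_ && X)]eq_sym. Qed.

Let pos_diff j t i k : lt i k ->
  pos j t i (inl k) - pos j t k (inl i) = lab j i k.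
Proof.
move=> ik; have nki : lt k i = false.
  by rewrite lt_total ?ik //; apply: contraTneq ik => ->; rewrite /lt ltnn.
by rewrite !ffunE /= ik nki subr0 xi_sym opprB addrC subrK.
Qed.

Let covP j a b : adj a b -> j \in cov (psi j a) (psi j b).
Proof. by move=> ab; rewrite inE wt_inj // ab. Qed.

Let psi_neq j a b : adj a b -> psi j a != psi j b.
Proof. by move=> ab; apply: contraTneq ab => /psi_inj->; rewrite adj_irr. Qed.

Let g1_phi jt a b : adj a b -> g1 (phi jt a) (phi jt b).
Proof.
wlog ltab : a b / lt (psi jt.1 a) (psi jt.1 b) => [IH|].
  move=> ab; have [/IH->//|] := boolP (lt (psi jt.1 a) (psi jt.1 b)).
  by rewrite -lt_total ?psi_neq // g1C => /IH; apply; rewrite adj_sym.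
move=> ab; rewrite /g1 /= psi_neq //= -subr_eq0 pos_diff //.
have [h _ _] := relabel 0 (card_cov (psi_neq jt.1 ab)).
by have := h _ (covP _ ab); rewrite inE.
Qed.

Let phi_surj x y : g1 x y -> exists jt a b, [/\ adj a b, phi jt a = x & phi jt b = y].
Proof.
wlog ltxy : x y / lt x.1 y.1 => [IH|].
  move=> gxy; have [/IH|] := boolP (lt x.1 y.1); first by apply.
  rewrite -lt_total; last by case/andP: gxy.
  move/IH; rewrite g1C => /(_ gxy) [jt [a [b [ab ea eb]]]].
  by exists jt, b, a; rewrite adj_sym.
case: x y ltxy => [i u] [k w] /= ik; rewrite /g1 /= -subr_eq0 => /andP[nik nF].
have [_ _ h] := relabel 0 (card_cov nik).
have [|j jc elab] := h (u (inl k) - w (inl i)); first by rewrite inE.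
move: jc; rewrite inE => /wt_gt0P[a [b [ab ea eb]]].
have [|t [t1 t2]] := @interp_surj i k [ffun c => u c + shift j i c] [ffun c => w c + shift j k c] nik.
  have nki : lt k i = false by rewrite lt_total ?ik.
  by rewrite !ffunE /= nki ik addr0 -[lab j i k]/(nth _ _ _) elab addrC subrK.
exists (j, t), a, b; split=> //; rewrite /phi /= ?ea ?eb; congr (_, _).
  by apply/ffunP => c; rewrite ffunE t1 ffunE addrK.
by apply/ffunP => c; rewrite ffunE t2 ffunE addrK.
Qed.

Let phi_uniq jt a b jt' a' b' : adj a b -> adj a' b' ->
  phi jt a = phi jt' a' -> phi jt b = phi jt' b' -> jt = jt'.
Proof.
wlog ltab : a b a' b' / lt (psi jt.1 a) (psi jt.1 b) => [IH|].
  move=> ab ab'; have [/IH|] := boolP (lt (psi jt.1 a) (psi jt.1 b)); first by apply.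
  rewrite -lt_total ?psi_neq // => /IH h ea eb; apply: (h b' a') => //.
    by rewrite adj_sym.
  by rewrite adj_sym.
case: jt ltab => j t; case: jt' => j' t' /= lab_ ab ab' [e1 p1] [e2 p2].
have nab := psi_neq j ab.
have ej : j = j'.
  have [_ h _] := relabel 0 (card_cov nab).
  apply: h; first exact: covP.
    by rewrite inE e1 e2 wt_inj // ab'.
  rewrite -!/(lab _ _ _) -(pos_diff j t) // p1 p2.
  have := pos_diff j' t' lab_; rewrite -e1 -e2.
  by move=> <-.
subst j'; congr (_, _); apply: (interp_inj nab) => c.
  by have /ffunP/(_ c) := p1; rewrite !ffunE -e1 => /addIr.
by have /ffunP/(_ c) := p2; rewrite !ffunE -e2 => /addIr.
Qed.

Let dec_g1 : decomposable adj (fun x y => nat_of_bool (g1 x y)).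
Proof.
apply: (dec_intro (f := phi)) => //.
by move=> jt a b [/psi_inj].
Qed.

Let pos0 (t : poly) (i : D) : Gam := [ffun c => evalp t (xi i c)].
Let emb t (i : D) : T := (i, pos0 t i).

Hypothesis fibre : forall A : {set T}, #|A| = #|{: Gam}| -> decomposable adj (clique A).

(** The complement of the copy of [F] at t = 0 is the disjoint union of [g1], the complete graphs on
    the fibres over D, and the copies [emb t] of [F] with t nonzero. *)
Lemma blowup_dec : decomposable adj (cmpl (fun i : D => (i, [ffun=> 0]) : T) F).
Proof.
have emb_inj t : injective (emb t) by move=> i k [].
have dt t : decomposable adj (fun x y => nat_of_bool (img (emb t) F x y)).
  apply: (dec_pull (emb_inj t)) => [x y nx|x y ny|].
  - by rewrite img_outl.
  - by rewrite img_outr.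
  - by apply: dec_ext dF => x y; rewrite img_in.
have zero i : (i, [ffun=> 0]) = emb [ffun=> 0] i.
  congr (_, _); apply/ffunP => c; rewrite !ffunE /evalp big1 // => k _.
  by rewrite ffunE mul0r.
pose fib i : {set T} := [set x | x.1 == i].
have dfib i : decomposable adj (clique (fib i)).
  apply: fibre; rewrite -[RHS](card_image (f := fun u : Gam => (i, u))).
    apply: eq_card => -[k u]; rewrite inE /=; apply/eqP/imageP => [->|[v _ /(congr1 fst)]//].
    by exists u.
  by move=> u v /(congr1 snd).
have dfibs := dec_sum (P := predT) (fun i _ => dfib i).
have drest := dec_sum (P := fun t : poly => t != [ffun=> 0]) (fun t _ => dt t).
apply: dec_ext (decD (decD dec_g1 dfibs) drest) => x y.
have imgE t u v : img (emb t) F u v = [&& F u.1 v.1, u == emb t u.1 & v == emb t v.1].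
  apply/existsP/and3P => [[[i k]] /= /and3P[/eqP<- /eqP<-]|[Fuv /eqP eu /eqP ev]].
    by rewrite /= => ->; split.
  by exists (u.1, v.1); rewrite /= -eu -ev !eqxx.
have -> : cmpl (fun i : D => (i, [ffun=> 0])) F x y = (x != y) && ~~ img (emb [ffun=> 0]) F x y.
  congr (_ && ~~ _); apply/existsP/existsP => -[p]; rewrite ?zero => h;
  by exists p; rewrite ?zero // -!zero.
case: x y => [i u] [k w].
have [<-|nik] := eqVneq i k.
  rewrite /g1 /= eqxx /= (bigD1 i) //= /clique !inE !eqxx /= big1 => [|l nl]; last first.
    by rewrite !inE /= eq_sym (negPf nl).
  rewrite big1 => [|t _]; last by rewrite imgE /= Fxx.
  by rewrite imgE /= Fxx andbT !addn0.
rewrite /g1 /= nik /= big1 => [|l _]; last first.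
  by rewrite /clique !inE /=; case: eqP => // <-; rewrite eq_sym (negPf nik).
rewrite addn0 -!pair_eqE /= (negPf nik) /=.
case Fik: (F i k); last first.
  rewrite /= big1 => [|t _]; last by rewrite imgE /= Fik.
  by rewrite imgE /= Fik addn0.
rewrite /=; case: eqP => /= [e|ne]; last first.
  rewrite big1 => [|t _]; first rewrite imgE /= Fik.
    case: eqP => //= -[e1]; case: eqP => //= -[e2]; case: ne.
    by rewrite e1 e2 !ffunE xi_sym.
  rewrite imgE /= Fik; apply/eqP; rewrite eqb0; apply/negP => /and3P[_ /eqP/(congr1 snd)/= e1 /eqP/(congr1 snd)/= e2].
  by case: ne; rewrite e1 e2 !ffunE xi_sym.
(* Two functions with label 0 lie on exactly one polynomial [t0], so their pair belongs to exactly
   one copy of [F] and stays uncovered only if [t0] is zero. *)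
have [t0 [t01 t02]] := interp_surj nik e.
have imgt t : img (emb t) F (i, u) (k, w) = (t == t0).
  rewrite imgE /= Fik /=; apply/andP/eqP => [[/eqP/(congr1 snd)/= e1 /eqP/(congr1 snd)/= e2]|->].
    apply: (interp_inj nik) => c; first by rewrite t01 e1 ffunE.
    by rewrite t02 e2 ffunE.
  by split; apply/eqP; congr (_, _); apply/ffunP => c; rewrite ffunE ?t01 ?t02.
rewrite imgt add0n (eq_bigr (fun t => nat_of_bool (t == t0))); last by move=> t _; rewrite imgt.
rewrite eq_sym; have [t00|nt0] := eqVneq t0 [ffun=> 0].
  by rewrite big1 // => t; rewrite -t00 => /negPf->.
rewrite (bigD1 t0) //= eqxx big1 // => t /andP[_ /negPf->//].
Qed.

End Blowup.

Lemma inj_of_card (A B : finType) : #|A| <= #|B| -> exists f : A -> B, injective f.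
Proof.
move=> h; exists (fun a => enum_val (widen_ord h (enum_rank a))) => a a'.
by move=> /enum_val_inj/(congr1 val) /= /val_inj/enum_rank_inj.
Qed.

Lemma modn_succ1 M s : M %| s -> s.+1 = 1 %[mod M].
Proof. by move=> /eqP e; rewrite -addn1 -modnDml e add0n. Qed.

Lemma modn1_dvd M m n : n = 1 %[mod M] -> m + n = 1 %[mod M] -> M %| m.
Proof.
by move=> n1; rewrite -modnDmr n1 modnDmr -{2}[1]add0n => /eqP; rewrite eqn_modDr mod0n.
Qed.

Section Completion.
Variables (X : finType) (adj : rel X) (cl : X -> bool).
Hypothesis adj_sym : symmetric adj.
Hypothesis adj_cl : forall a b, adj a b -> cl a != cl b.
Variables (a0 b0 : X).
Hypothesis adj0 : adj a0 b0.
Variable M : nat.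
Hypothesis M1 : 1 < M.
Hypothesis bipM : forall (T : finType) (A B : {set T}), [disjoint A & B] ->
  M %| #|A| -> M %| #|B| -> decomposable adj (biclique A B).
Hypothesis KM : forall (T : finType) (A : {set T}), #|A| = 1 %[mod M] -> decomposable adj (clique A).

Let adj_irr : irreflexive adj.
Proof. by move=> a; apply/negP => /adj_cl; rewrite eqxx. Qed.

Definition completable (D : finType) (F : rel D) : Prop :=
  exists (T : finType) (g : D -> T), [/\ injective g, #|T| = 1 %[mod M] &
    decomposable adj (fun x y => nat_of_bool (cmpl g F x y))].

Lemma weak_completion (D : finType) (F : rel D) : #|D| = 1 %[mod M] ->
  decomposable adj (fun x y => nat_of_bool (F x y)) -> completable F.
Proof.
move=> cD dF; have [lam [r [dr rF]]] := dec_rest adj_irr adj0 dF.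
have phiM : 0 < totient M by rewrite totient_gt0; lia.
(* Dummy coordinates make the number of coordinates a multiple of the totient of M; by Euler's
   theorem the fibres then have order 1 modulo M. *)
pose E := 'I_(#|D| * (totient M).-1).
have cCd : #|{: D + E}| = #|D| * totient M.
  by rewrite card_sum card_ord -{1}[#|D|]muln1 -mulnDr add1n prednK.
(* The prime exceeds [lam], so that [q - lam] is a true difference; the number of sets of
   coordinates, so that [num] exists; and M, so that it is coprime to M. *)
have [q qlt qP] := prime_above (lam + #|{set D + E}| + M).
have cK : #|'F_q| = q by rewrite card_Fp.
have [num num_inj] : exists num : {set D + E} -> 'F_q, injective num.
  by apply: inj_of_card; rewrite cK; apply: leq_trans (ltnW qlt); rewrite addnAC leq_addl.
have Fxx x : F x x = false by have := decxx adj_irr x dF; case: (F x x).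
have KD : decomposable adj (clique [set: D]) by apply: KM; rewrite cardsT.
(* [r] covers each pair [lam] times, edges of [F] once less; [q - lam] decompositions of the
   complete graph on D raise this to q. *)
have [I [psi [psi_inj psiE]]] := decD dr (dec_muln (q - lam) KD).
have psiF x y : x != y -> \sum_i wt adj (psi i) x y + F x y = #|'F_q|.
  by move=> nxy; rewrite -psiE addnAC rF /clique !in_setT nxy cK !muln1; lia.
have cG : #|{: {ffun D + E -> 'F_q}}| = 1 %[mod M].
  rewrite card_ffun cK cCd mulnC expnM -modnXm Euler_exp_totient.
    by rewrite modnXm exp1n.
  rewrite prime_coprime //; apply/negP => /dvdn_leq.
  by lia.
exists (D * {ffun D + E -> 'F_q})%type, (fun i : D => (i, [ffun=> 0%R])); split.
- by move=> i k [].
- by rewrite card_prod -modnMm cG cD modnMm.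
- apply: (blowup_dec adj_sym adj_cl num_inj psi_inj psiF dF) => A cA.
  by apply: KM; rewrite cA.
Qed.

(* Complete the packing of [K_T - (K_D - F)] on T', then add [K_T - K_D], which
   consists of a complete graph on [T - D] and one vertex of [D] and of a
   complete bipartite graph. *)
Lemma completable_compl (D : finType) (F : rel D) :
  symmetric F -> irreflexive F -> #|D| = 1 %[mod M] ->
  completable (fun x y => (x != y) && ~~ F x y) -> completable F.
Proof.
move=> FC Fxx cD [T [g [gi cT dT]]].
have [T' [g' [gi' cT' dT']]] := weak_completion cT dT.
exists T', (g' \o g); split=> //; first exact: inj_comp.
have /card_gt0P[o _] : 0 < #|D|.
  by case: #|D| cD => //; rewrite mod0n modn_small.
pose GD := g @: [set: D]; pose S := ~: GD.
have cGD : #|GD| = #|D| by rewrite card_imset // cardsT.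
have oGD : g o \in GD by apply: imset_f.
have cS : M %| #|S|.
  by apply: (@modn1_dvd _ _ #|GD|); rewrite ?cGD // addnC -cGD cardsC.
have dK : decomposable adj (clique (g o |: S)).
  by apply: KM; rewrite cardsU1 !inE oGD /= add1n modn_succ1.
have dB : decomposable adj (biclique S (GD :\ g o)).
  apply: bipM => //; last first.
    apply: (@modn1_dvd _ _ 1) => //; rewrite addn1.
    by have := cardsD1 (g o) GD; rewrite oGD cGD add1n => <-.
  rewrite -setI_eq0; apply/eqP/setP => x; rewrite !inE.
  by case: (x \in GD); rewrite ?andbF.
have dKB : decomposable adj (fun x y => nat_of_bool [&& x != y & ~~ ((x \in GD) && (y \in GD))]).
  apply: dec_ext (decD dK dB) => x y; rewrite /clique /biclique !inE.
  have [<-|nxy] := eqVneq x y.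
    by rewrite !andbF; case: (x \in GD); rewrite ?andbF.
  case: (eqVneq x (g o)) => [ex|nx]; case: (eqVneq y (g o)) => [ey|ny];
    rewrite ?ex ?ey ?oGD //=; try by case: (x \in GD); case: (y \in GD).
  by rewrite ex ey eqxx in nxy.
have dKB' : decomposable adj (fun x y => nat_of_bool (img g' (fun x y =>
    [&& x != y & ~~ ((x \in GD) && (y \in GD))]) x y)).
  apply: (dec_pull gi') => [x y nx|x y ny|].
  - by rewrite img_outl.
  - by rewrite img_outr.
  - by apply: dec_ext dKB => x y; rewrite img_in.
apply: dec_ext (decD dT' dKB') => x y.
have imgC (u v : T) : img (g' \o g) F (g' u) (g' v) = img g F u v.
  apply/existsP/existsP => -[p /and3P[/eqP e1 /eqP e2 e3]]; exists p.
    by move: (gi' _ _ e1) (gi' _ _ e2) => -> ->; rewrite !eqxx.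
  by rewrite /= e1 e2 !eqxx.
have [/codomP[u ->]|nx] := boolP (x \in codom g'); last first.
  have nx' : x \notin codom (g' \o g) by apply: contra nx => /codomP[v ->]; apply: codom_f.
  by rewrite /cmpl !img_outl // addn0.
have [/codomP[v ->]|ny] := boolP (y \in codom g'); last first.
  have ny' : y \notin codom (g' \o g) by apply: contra ny => /codomP[w ->]; apply: codom_f.
  by rewrite /cmpl !img_outr // addn0.
rewrite /cmpl imgC !img_in // (inj_eq gi').
have [<-|nuv] /= := eqVneq u v.
  by [].
have [/andP[/imsetP[c _ eu] /imsetP[d _ ev]]|nGD] := boolP ((u \in GD) && (v \in GD)).
  by move: nuv; rewrite eu ev (inj_eq gi) !img_in // => ->; case: (F c d).
have -> : img g F u v = false.
  rewrite /img; apply/existsP => -[p /and3P[/eqP e1 /eqP e2 _]]; case/negP: nGD.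
  by rewrite -e1 -e2 !imset_f.
have -> : img g (fun x y => (x != y) && ~~ F x y) u v = false.
  rewrite /img; apply/existsP => -[p /and3P[/eqP e1 /eqP e2 _]]; case/negP: nGD.
  by rewrite -e1 -e2 !imset_f.
by [].
Qed.

End Completion.

(** * Counting tools *)

Section DegreeSums.
Variables (X : finType) (adj : rel X).

Definition deg (a : X) : nat := #|[set b | adj a b]|.

(** The monoid generated by the degrees of H; it contains the degree of every vertex in a
    decomposable graph. *)
Inductive degsum : nat -> Prop :=
| degsum0 : degsum 0
| degsumS a n : degsum n -> degsum (deg a + n).

Lemma degsumD m n : degsum m -> degsum n -> degsum (m + n).
Proof. by elim=> [//|a k _ IH /IH]; rewrite -addnA; apply: degsumS. Qed.

Lemma degsum_muln k n : degsum n -> degsum (k * n).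
Proof.
move=> dn; elim: k => [|k IH]; first exact: degsum0.
by rewrite mulSn; apply: degsumD.
Qed.

Lemma degsum_deg a : degsum (deg a).
Proof. by rewrite -[deg a]addn0; apply/degsumS/degsum0. Qed.

Lemma degsum_sum (I : finType) (P : pred I) (F : I -> nat) :
  (forall i, P i -> degsum (F i)) -> degsum (\sum_(i | P i) F i).
Proof. by move=> h; apply: big_ind => //; [apply: degsum0|apply: degsumD]. Qed.

Lemma sum_adj (a : X) : \sum_b adj a b = deg a.
Proof. by rewrite /deg -sum1dep_card [RHS]big_mkcond. Qed.

Lemma degsum_dec (T : finType) (m : T -> T -> nat) v :
  decomposable adj m -> degsum (\sum_y m v y).
Proof.
case=> I [f [fi fm]]; rewrite (eq_bigr (fun y => \sum_i wt adj (f i) v y)) //.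
rewrite exchange_big /=; apply: degsum_sum => i _.
rewrite exchange_big /=.
rewrite (eq_bigr (fun p : X * X => adj p.1 p.2 * (f i p.1 == v))); last first.
  move=> [a b] /= ab; rewrite ab mul1n; case: eqP => _ /=; last by rewrite big1.
  by rewrite (sum1_nat (P := fun y => f i b == y) (i0 := f i b)) // => y /eqP.
rewrite big_mkcond /= -(pair_bigA _ (fun a b => if adj a b then adj a b * (f i a == v) else 0)) /=.
apply: degsum_sum => a _; rewrite (eq_bigr (fun b => (f i a == v) * adj a b)).
  by rewrite -big_distrr /= sum_adj; apply/degsum_muln/degsum_deg.
by move=> b _ /=; case: (adj a b); rewrite ?muln0 ?muln1 ?mul1n.
Qed.

Variable M : nat.
Hypothesis M0 : 0 < M.
Hypothesis degsumM : degsum M.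

(** The monoid contains M, so in each residue class that it meets it contains every number from some
    point on, and there are only M classes. The class of r is met, since r is congruent to (M - 1)
    s. *)
Lemma degsum_large : exists K, forall r s, K <= r -> degsum s -> M %| r + s -> degsum r.
Proof.
have [K KP] : exists K, forall rho, rho < M -> (exists2 s, degsum s & s = rho %[mod M]) ->
    exists s, [/\ degsum s, s <= K & s = rho %[mod M]].
  elim: {1}M => [|k [K IH]]; first by exists 0.
  have [[s ds es]|ns] := EM (exists2 s, degsum s & s = k %[mod M]).
    exists (maxn K s) => rho; rewrite ltnS leq_eqVlt => /orP[/eqP-> _|lt].
      by exists s; rewrite leq_maxr.
    move/(IH _ lt) => [t [dt tK et]].
    by exists t; split=> //; apply: leq_trans (leq_maxl _ _).
  exists K => rho; rewrite ltnS leq_eqVlt => /orP[/eqP-> //|lt]; exact: IH.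
exists K => r s Kr ds dv.
have e1 : M.-1 * s = r %[mod M].
  apply/eqP; rewrite -(eqn_modDr s) -mulSnr prednK //.
  by rewrite (eqP dv) modnMr.
have [||t [dt tK et]] := KP (r %% M); first by rewrite ltn_mod.
  by exists (M.-1 * s); [apply: degsum_muln|rewrite modn_mod].
have tr : t <= r by apply: leq_trans Kr.
rewrite modn_mod in et.
have : M %| r - t by rewrite -eqn_mod_dvd // et.
case/dvdnP=> k ek; rewrite -(subnKC tr) ek.
by apply: degsumD => //; apply: degsum_muln.
Qed.

(** Each part is indexed by one of its own elements, the members of [act]; [nu p] maps the
    neighbours of the vertex [xs p] of H bijectively to the part of p. Thus no new index type is
    needed, and the number of parts is at most #|A|. *)
Lemma degsum_partition (T : finType) (A : {set T}) (x0 : X) : degsum #|A| ->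
  exists (act : {set T}) (xs : T -> X) (nu : T -> X -> T),
  [/\ act \subset A,
    forall p b, p \in act -> adj (xs p) b -> nu p b \in A,
    forall r, r \in A -> exists p b, [/\ p \in act, adj (xs p) b & nu p b = r] &
    forall p b p' b', p \in act -> p' \in act -> adj (xs p) b -> adj (xs p') b' ->
      nu p b = nu p' b' -> p = p' /\ b = b'].
Proof.
move: {2}#|A| (erefl #|A|) => n nA; rewrite nA => dn.
elim: dn A nA => [|a m _ IH] A cA.
  exists set0, (fun _ => x0), (fun p _ => p); split=> [|p b|r|p b p' b']; rewrite ?inE ?sub0set //.
  by rewrite (cards0_eq cA) inE.
(* An isolated vertex of H would give an empty part, with no element to represent it. *)
have [d0|d0] := posnP (deg a); first by apply: IH; rewrite cA d0.
have [|B BA cB] := @subset_of_size _ A (deg a); first by rewrite cA leq_addr.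
have cD : #|A :\: B| = m by rewrite cardsD (setIidPr BA) cA cB addKn.
have [act [xs [nu [actA nuA nuS nuI]]]] := IH _ cD.
have /card_gt0P[p0 p0B] : 0 < #|B| by rewrite cB.
have [bB bI bS] := relabel p0 (esym cB).
set be := (fun b => nth _ _ _) in bB bI bS.
have p0n : p0 \notin act by apply: contraL p0B => /(subsetP actA); rewrite inE => /andP[].
pose xs' p := if p == p0 then a else xs p.
pose nu' p b := if p == p0 then be b else nu p b.
have nD q b : q \in act -> q != p0 -> adj (xs q) b -> nu q b \in A /\ nu q b \notin B.
  by move=> qa _ /(nuA _ _ qa); rewrite inE => /andP[].
exists (p0 |: act), xs', nu'; split.
- by rewrite subUset sub1set (subsetP BA) //= (subset_trans actA) ?subsetDl.
- move=> p b; rewrite !inE /xs' /nu'; case: eqP => /= [_ _ ab|/eqP np pa ab].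
    by apply: (subsetP BA); apply: bB; rewrite inE.
  by have [] := nD p b pa np ab.
- move=> r rA; have [rB|rB] := boolP (r \in B).
    have [b bn eb] := bS r rB; exists p0, b; rewrite /xs' /nu' !eqxx setU11.
    by rewrite inE in bn.
  have [|p [b [pa ab eb]]] := nuS r; first by rewrite inE rB.
  have np : p != p0 by apply: contraTneq pa => ->.
  by exists p, b; rewrite /xs' /nu' (negPf np) inE pa orbT.
- move=> p b p' b'; rewrite !inE /xs' /nu'.
  case: eqP => [->|/eqP np]; case: eqP => [->|/eqP np'] //= pa pa' ab ab' e.
  + by split=> //; apply: bI e; rewrite inE.
  + have [_ /negP[]] := nD p' b' pa' np' ab'; rewrite -e; apply: bB; by rewrite inE.
  + have [_ /negP[]] := nD p b pa np ab; rewrite e; apply: bB; by rewrite inE.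
  + exact: nuI e.
Qed.

End DegreeSums.

(** * Greedy choices and balanced classes *)

Lemma card_fibers (I K : finType) (A : {set I}) (f : I -> K) :
  #|A| = \sum_k #|[set i in A | f i == k]|.
Proof.
rewrite -sum1_card (partition_big f predT) //=; apply: eq_bigr => k _.
by rewrite -sum1_card; apply: eq_bigl => i; rewrite !inE.
Qed.

(** At each step at most [Delta] colours occur at neighbours, and at most #|I| / cap colours are
    already used [cap] times; the hypothesis leaves one more colour. *)
Lemma greedy_coloring (I K : finType) (c : rel I) (Delta cap : nat) :
  symmetric c -> (forall i, #|[set j | c i j]| <= Delta) ->
  #|I| < cap * (#|K| - Delta) ->
  exists chi : I -> K, (forall i j, i != j -> c i j -> chi i != chi j) /\
    (forall k, #|[set i | chi i == k]| <= cap).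
Proof.
move=> cC cD hI.
have k0 : K.
  have : 0 < #|K| by case: #|K| hI => //; rewrite sub0n muln0.
  by move=> h; apply: (enum_val (Ordinal h)).
suff H (s : seq I) : uniq s -> exists chi : I -> K,
    (forall i j, i \in s -> j \in s -> i != j -> c i j -> chi i != chi j) /\
    (forall k, #|[set i in s | chi i == k]| <= cap).
  have [chi [h1 h2]] := H _ (enum_uniq I); exists chi; split=> [i j|k].
    by apply: h1; rewrite mem_enum.
  by apply: leq_trans (h2 k); apply: subset_leq_card; apply/subsetP => i; rewrite !inE mem_enum.
elim: s => [_|i s IH /= /andP[ni us]].
  by exists (fun _ => k0); split=> // k; rewrite (_ : [set _ in _ | _] = set0) ?cards0 //; apply/setP => i; rewrite !inE.
have [chi [h1 h2]] := IH us.
pose full := [set k | cap <= #|[set i in s | chi i == k]|].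
pose nb := chi @: [set j | c i j].
have cnb : #|nb| <= Delta by apply: leq_trans (leq_imset_card _ _) (cD i).
have cfull : cap * #|full| <= #|I|.
  apply: leq_trans (max_card (mem [set i in s])); rewrite (card_fibers _ chi).
  rewrite mulnC -sum_nat_const big_mkcond /=; apply: leq_sum => k _.
  by rewrite inE; case: ifP => // ck; apply: leq_trans ck _; apply/eq_leq/eq_card => j; rewrite !inE.
have : #|full :|: nb| < #|K|.
  apply: leq_ltn_trans (leq_card_setU _ _) _.
  have : cap * #|full| < cap * (#|K| - Delta) by apply: leq_ltn_trans hI.
  rewrite ltn_mul2l => /andP[_]; lia.
move=> lt.
have [k kn] : exists k, k \notin full :|: nb.
  apply/existsP; apply: contraTT lt; rewrite negb_exists -leqNgt => /forallP h.
  by rewrite -cardsT; apply/subset_leq_card/subsetP => k _; have := h k; rewrite negbK.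
move: kn; rewrite !inE negb_or -ltnNge => /andP[kf knb].
exists (fun j => if j == i then k else chi j); split=> [j j'|k'].
  rewrite !inE; case: eqP => [->|/eqP nj]; case: eqP => [->|/eqP nj'] //=.
  - by rewrite eqxx.
  - move=> _ js' _ cij; apply: contraNneq knb => ->; apply: imset_f; by rewrite inE.
  - move=> js _ _ cij; apply: contraNneq knb => <-; apply: imset_f; by rewrite inE cC.
  - exact: h1.
have [->|nk] := eqVneq k' k.
  rewrite (_ : [set _ in _ | _] = i |: [set j in s | chi j == k]); last first.
    by apply/setP => j; rewrite !inE; case: (eqVneq j i) => [->|]; rewrite ?eqxx.
  by rewrite cardsU1 inE (negPf ni) /= add1n.
apply: leq_trans (h2 k'); apply/subset_leq_card/subsetP => j; rewrite !inE.
by case: (eqVneq j i) => [_|_] //=; rewrite eq_sym (negPf nk).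
Qed.

(** The weight depends on the pair because in the application most pairs exclude a single value, and
    only a few exclude many. *)
Lemma greedy_choice (I K : finType) (bad : I -> I -> K -> K -> bool) (w : I -> I -> nat) :
  (forall i j k k', bad i j k k' = bad j i k' k) ->
  (forall i j k, #|[set k' | bad j i k k']| <= w i j) ->
  (forall i, \sum_j w i j < #|K|) ->
  exists chi : I -> K, forall i j, i != j -> ~~ bad i j (chi i) (chi j).
Proof.
move=> bC bw hw.
have [I0|/card_gt0P[i0 _]] := posnP #|I|.
  have no (i : I) : False by have := card0_eq I0 i; rewrite inE.
  by exists (fun i => False_rect K (no i)) => i; case: (no i).
have /card_gt0P[k0 _] : 0 < #|K| by apply: leq_ltn_trans (hw i0).
suff H (s : seq I) : uniq s -> exists chi : I -> K,
    forall i j, i \in s -> j \in s -> i != j -> ~~ bad i j (chi i) (chi j).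
  have [chi h] := H _ (enum_uniq I); exists chi => i j.
  by apply: h; rewrite mem_enum.
elim: s => [_|i s IH /= /andP[ni us]]; first by exists (fun _ => k0).
have [chi h] := IH us.
pose forb := \bigcup_(j in s) [set k' | bad j i (chi j) k'].
have lt : #|forb| < #|K|.
  apply: leq_ltn_trans (hw i); rewrite [X in _ <= X](bigID (mem s)) /=.
  apply: leq_trans (leq_addr _ _).
  rewrite /forb; apply: (big_ind2 (fun (A : {set K}) m => #|A| <= m)) => [|A m B m' hA hB|j _].
  - by rewrite cards0.
  - by apply: leq_trans (leq_card_setU _ _) _; apply: leq_add.
  - exact: bw.
have [k kn] : exists k, k \notin forb.
  apply/existsP; apply: contraTT lt; rewrite negb_exists -leqNgt => /forallP hk.
  by rewrite -cardsT; apply/subset_leq_card/subsetP => k _; have := hk k; rewrite negbK.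
have kj j : j \in s -> ~~ bad j i (chi j) k.
  by move=> js; apply: contra kn => b; apply/bigcupP; exists j; rewrite ?inE.
exists (fun j => if j == i then k else chi j) => j j'.
rewrite !inE; case: eqP => [->|/eqP nj]; case: eqP => [->|/eqP nj'] //=.
- by rewrite eqxx.
- by move=> _ js' _; rewrite bC kj.
- by move=> js _ _; rewrite kj.
- exact: h.
Qed.

(** [A] is cut into k chunks of size M along its enumeration and whole chunks are distributed, so
    class sizes stay divisible by M. Greedy colouring without conflicts bounds the number of chunks
    per class. *)
Lemma balanced_classes (V : finType) (A : {set V}) (M k J cap : nat) :
  0 < M -> #|A| = k * M -> k < cap * J ->
  exists cls : V -> 'I_J, forall j,
    M %| #|[set v in A | cls v == j]| /\ #|[set v in A | cls v == j]| <= cap * M.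
Proof.
move=> M0 cA kJ.
have [|||chi [_ ch]] := @greedy_coloring 'I_k 'I_J (fun _ _ => false) 0 cap.
- by [].
- by move=> i; rewrite (_ : [set _ | _] = set0) ?cards0 //; apply/setP => x; rewrite !inE.
- by rewrite !card_ord subn0.
have J0 : 0 < J by case: J kJ {chi ch} => //; rewrite muln0.
have ib (v : V) : index v (enum A) < #|A| -> index v (enum A) %/ M < k.
  by rewrite cA ltn_divLR.
(* Outside [A] the index is #|A|, its quotient by M is k, and the default class 0 is taken. *)
pose cls (v : V) : 'I_J :=
  if insub (index v (enum A) %/ M) is Some t then chi t else Ordinal J0.
exists cls => j.
suff -> : #|[set v in A | cls v == j]| = #|[set i | chi i == j]| * M.
  by rewrite dvdn_mull // leq_mul2r ch orbT.
pose f (p : 'I_k * 'I_M) : nat := p.1 * M + p.2.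
have fk p : f p < #|A|.
  rewrite cA /f; apply: (@leq_trans (p.1 * M + M)); first by rewrite ltn_add2l.
  by rewrite -mulSnr leq_mul2r ltn_ord orbT.
pose g (p : 'I_k * 'I_M) : V := enum_val (Ordinal (fk p)).
have fdiv p : f p %/ M = p.1 by rewrite /f divnMDl // divn_small ?addn0.
have fmod p : f p %% M = p.2 by rewrite /f modnMDl modn_small.
have gi : injective g.
  move=> p p' /enum_val_inj/(congr1 val) /= e.
  case: p p' e => [i l] [i' l'] e; congr (_, _); apply: val_inj => /=.
    by rewrite -[LHS](fdiv (i, l)) e fdiv.
  by rewrite -[LHS](fmod (i, l)) e fmod.
have idx p : index (g p) (enum A) = f p.
  by rewrite /g (enum_val_nth (g p)) index_uniq ?enum_uniq -?cardE.
have clsg p : cls (g p) = chi p.1.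
  rewrite /cls idx; case: insubP => [t _ et|]; last by rewrite fdiv ltn_ord.
  by congr chi; apply: val_inj; rewrite /= et fdiv.
rewrite -[M in RHS]card_ord -cardsT -cardsX -(card_imset _ gi).
apply: eq_card => v; rewrite inE; apply/andP/imsetP => [[vA cv]|[[i l]]].
  have lt : index v (enum A) < #|A| by rewrite cardE index_mem mem_enum.
  exists (Ordinal (ib v lt), Ordinal (ltn_pmod (index v (enum A)) M0)).
    rewrite !inE andbT /= -(eqP cv) /cls insubT //= ?ib // => lt'.
    by apply/eqP; congr chi; apply: val_inj.
  rewrite /g (enum_val_nth v) /f /= -divn_eq nth_index ?mem_enum //.
rewrite !inE /= andbT => ci ->; split; first exact: enum_valP.
by rewrite clsg.
Qed.

Lemma inj_into (X T : finType) (A : {set T}) : #|X| <= #|A| ->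
  exists f : X -> T, injective f /\ forall x, f x \in A.
Proof.
move=> h; exists (fun x => enum_val (widen_ord h (enum_rank x))); split.
  by move=> x y /enum_val_inj/(congr1 val) /= /val_inj/enum_rank_inj.
by move=> x; apply: enum_valP.
Qed.

(** * Graphs without a copy of H *)

Section Free.
Variables (X : finType) (adj : rel X) (cl : X -> bool).
Hypothesis adj_sym : symmetric adj.
Hypothesis adj_cl : forall a b, adj a b -> cl a != cl b.

Let adj_irr : irreflexive adj.
Proof. by move=> a; apply/negP => /adj_cl; rewrite eqxx. Qed.

Definition copy_free (D : finType) (L : rel D) : Prop :=
  forall f : X -> D, injective f -> ~ forall a b, adj a b -> L (f a) (f b).

(* As in the Kovari-Sos-Turan theorem, many edges from [S]
   give many vertices with [#|X|] neighbours in [S], and by pigeonhole [#|X|] of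
   them share the same neighbours. *)
Lemma few_high (D : finType) (L : rel D) (S : {set D}) k :
  symmetric L -> irreflexive L -> copy_free L ->
  (forall s, s \in S -> k <= #|[set u | L s u]|) ->
  #|S| * k <= #|D| * #|X| + #|S| * (2 ^ #|S| * #|X|).
Proof.
move=> LC Lirr fr hS; set h := #|X|.
pose N u := [set s in S | L s u].
pose good := [set u | h <= #|N u|].
have gl : #|good| <= 2 ^ #|S| * h.
  (* A canonical set of h neighbours of [u] in [S], so that pigeonhole runs over the subsets of
     [S]. *)
  pose be u := [set s in take h (enum (N u))].
  rewrite (card_fibers _ be) -card_powerset -sum_nat_const [X in _ <= X]big_mkcond /=.
  apply: leq_sum => B _; case: ifP => BS; last first.
    rewrite leqn0 cards_eq0; apply/eqP/setP => u; rewrite !inE; apply/negP.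
    move=> /andP[_ /eqP eB]; move: BS; rewrite -eB powersetE => /negP; apply.
    by apply/subsetP => s; rewrite inE => /mem_take; rewrite mem_enum inE => /andP[].
  rewrite leqNgt; apply/negP => lt.
  set U := [set u in good | be u == B] in lt.
  have UB u s : u \in U -> s \in B -> L s u.
    rewrite inE => /andP[_ /eqP<-]; rewrite inE => /mem_take.
    by rewrite mem_enum inE => /andP[].
  have [f [fi fU]] := inj_into (ltnW lt).
  have /card_gt0P[u0 u0U] : 0 < #|U| by apply: leq_ltn_trans lt.
  have cB : h <= #|B|.
    move: u0U; rewrite !inE => /andP[hN /eqP<-].
    rewrite cardsE (card_uniqP _) ?take_uniq ?enum_uniq // size_take -cardE.
    by case: ifP.
  have [g [gi gB]] := inj_into cB.
  (* One class of H goes to [U], the other to [B]. The images do not meet, since every vertex of [U]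
     is joined to every vertex of [B] and [L] has no loops. *)
  apply: (fr (fun a => if cl a then f a else g a)).
    move=> a b; case: (cl a); case: (cl b); try exact: fi; try exact: gi.
      by move=> e; have := UB _ (g b) (fU a) (gB b); rewrite e Lirr.
    by move=> e; have := UB _ (g a) (fU b) (gB a); rewrite e Lirr.
  move=> a b /adj_cl; case: (cl a); case: (cl b) => // _; last exact: UB.
  by rewrite LC; apply: UB.
have -> : #|D| * h + #|S| * (2 ^ #|S| * h) = \sum_(u : D) h + #|S| * (2 ^ #|S| * h).
  by rewrite sum_nat_const.
rewrite -sum_nat_const; apply: (@leq_trans (\sum_(s in S) \sum_u L s u)).
  by apply: leq_sum => s sS; rewrite sum_adj; apply: hS.
rewrite exchange_big /=; apply: (@leq_trans (\sum_u (h + (if u \in good then #|S| else 0)))).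
  apply: leq_sum => u _.
  have -> : \sum_(s in S) L s u = #|N u|.
    by rewrite -sum1_card big_mkcond [RHS]big_mkcond; apply: eq_bigr => s _;
       rewrite inE; case: (s \in S); case: (L s u).
  rewrite inE; case: ifP => [_|/negbT]; last by rewrite -ltnNge addn0 => /ltnW.
  apply: leq_trans (leq_addl _ _); apply/subset_leq_card/subsetP => s; rewrite inE.
  by case/andP.
rewrite big_split /= leq_add2l -big_mkcond sum_nat_const mulnC leq_mul2l gl orbT.
by [].
Qed.

Variables (a0 b0 : X).
Hypothesis adj0 : adj a0 b0.

Lemma remove_copies (D : finType) (L : rel D) : symmetric L -> irreflexive L ->
  exists (m : D -> D -> nat) (L' : rel D), [/\ decomposable adj m, copy_free L',
    symmetric L', irreflexive L' & forall x y, L x y = m x y + L' x y :> nat].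
Proof.
have [n] := ubnP #|[set p : D * D | L p.1 p.2]|.
elim: n L => // n IH L Ln LC Lirr.
have [fr|] := EM (copy_free L); first by exists (fun _ _ => 0), L; split=> //; apply: dec0.
move=> /existsNP[f] /not_implyP[fi] /contrapT fL.
pose L1 x y := L x y && (wt adj f x y == 0).
have LE x y : L x y = wt adj f x y + L1 x y :> nat.
  have := wt_le1 adj x y fi; rewrite /L1.
  have [e|/wt_gt0P[a [b [ab <- <-]]]] := posnP (wt adj f x y).
    by rewrite e andbT add0n.
  by rewrite wt_inj // ab fL //= andbF.
have [|||m [L' [dm frL' L'C L'i LL']]] := IH L1.
- apply: leq_trans (_ : _ < #|[set p : D * D | L p.1 p.2]|) _; last by rewrite -ltnS.
  apply/proper_card/properP; split.
    by apply/subsetP => p; rewrite !inE => /andP[].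
  exists (f a0, f b0); rewrite inE /= ?fL // /L1 wt_inj // adj0.
  by rewrite andbF.
- by move=> x y; rewrite /L1 LC (wtC adj_sym).
- by move=> x; rewrite /L1 Lirr.
exists (fun x y => wt adj f x y + m x y), L'; split=> //.
  exact: decD (dec_wt _ fi) dm.
by move=> x y; rewrite LE LL' addnA.
Qed.
End Free.

Lemma card_bigcup_le (I T : finType) (P : pred I) (A : I -> {set T}) :
  #|\bigcup_(i | P i) A i| <= \sum_(i | P i) #|A i|.
Proof.
apply: (big_ind2 (fun (B : {set T}) m => #|B| <= m)) => [|B m B' m' hB hB'|//].
  by rewrite cards0.
by apply: leq_trans (leq_card_setU _ _) _; apply: leq_add.
Qed.

(* The vertices not placed by [pre] go to the grid [X * 'I_yq], vertex [b] at
   height [tau.1 + rank b * tau.2]; two heights determine [tau]. *)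
Section Placement.
Variables (X : finType) (adj : rel X).
Hypothesis adj_sym : symmetric adj.
Hypothesis adj_irr : irreflexive adj.
Variables (I B : finType) (sp : pred B) (pre : I -> X -> option B).
Variables (Delta q yq : nat).
Local Notation h := #|X|.
Hypothesis pre_inj : forall i a b p, pre i a = Some p -> pre i b = Some p -> a = b.
Hypothesis pre_sp : forall i a b p, adj a b -> pre i a = Some p -> pre i b = None -> sp p.
Hypothesis pre_few : forall p, sp p -> #|[set i | [exists a, pre i a == Some p]]| <= Delta.
Hypothesis few : #|I| + (h * Delta) * (h * q) < q * q.
Hypothesis qyq : h * q <= yq.

Let q0 : 0 < q.
Proof. by case: q few. Qed.

Let height (b : X) (tau : 'I_q * 'I_q) : nat := tau.1 + enum_rank b * tau.2.

Let height_lt b tau : height b tau < yq.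
Proof.
apply: leq_trans qyq; rewrite /height.
have := ltn_ord tau.1; have := ltn_ord tau.2; have := ltn_ord (enum_rank b).
move: (nat_of_ord tau.1) (nat_of_ord tau.2) (nat_of_ord (enum_rank b)) => t1 t2 r hr h2 h1.
have : (r.+1 * q <= h * q)%N by rewrite leq_mul2r hr orbT.
have : (r * t2 <= r * q)%N by rewrite leq_mul2l ltnW ?orbT.
rewrite mulSn; lia.
Qed.

Let height_inj a b tau tau' : a != b ->
  height a tau = height a tau' -> height b tau = height b tau' -> tau = tau'.
Proof.
move=> nab; rewrite /height.
have : enum_rank a != enum_rank b :> nat.
  by apply: contra nab => /eqP/val_inj/enum_rank_inj->.
case: tau tau' => [t1 t2] [u1 u2] /= nr ea eb.
have e2 : t2 = u2 :> nat.
  move: (nat_of_ord (enum_rank a)) (nat_of_ord (enum_rank b)) nr ea eb => r r' nr ea eb.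
  nia.
have e1 : t1 = u1 :> nat by move: ea; rewrite e2 => /addIn.
by congr (_, _); apply: val_inj.
Qed.

Let share i j := [exists a, exists b, exists p, [&& sp p, pre i a == Some p & pre j b == Some p]].

(** Distinct [tau] keep two copies from sharing a pair of grid points. Copies that share a special
    preplaced point must moreover differ in the height of every vertex, or a pair from this point to
    the grid could repeat. Each copy excludes one value, and each of the at most h Delta sharing
    copies excludes h q more: equal height at b fixes the first coordinate once the second is
    known. *)
Lemma tau_exists : exists tau : I -> 'I_q * 'I_q, injective tau /\
  forall i j, i != j -> share i j -> forall b, height b (tau i) != height b (tau j).
Proof.
pose bad i j (k k' : 'I_q * 'I_q) := (k == k') || share i j && [exists b, height b k == height b k'].
pose w i j := 1 + (if share i j then h * q else 0).
have shC i j : share i j = share j i.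
  by apply/'exists_'exists_existsP/'exists_'exists_existsP => -[a [b [p /and3P[sp1 h1 h2]]]];
     exists b, a, p; apply/and3P.
have [|||tau htau] := @greedy_choice I _ bad w.
- move=> i j k k'; rewrite /bad eq_sym shC; congr (_ || _ && _).
  by apply: eq_existsb => b; rewrite eq_sym.
- move=> i j k; rewrite /bad /w.
  apply: (@leq_trans #|[set k] :|: [set k' | share i j && [exists b, height b k == height b k']]|).
    by apply/subset_leq_card/subsetP => k'; rewrite !inE [k' == k]eq_sym [share i j]shC.
  apply: leq_trans (leq_card_setU _ _) _; rewrite cards1 leq_add2l.
  case: ifP => _ /=; last by rewrite (_ : [set _ | _] = set0) ?cards0 //; apply/setP => x; rewrite !inE.
  apply: (@leq_trans #|\bigcup_(b : X) [set k' | height b k == height b k']|).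
    apply/subset_leq_card/subsetP => k'; rewrite inE => /existsP[b hb].
    by apply/bigcupP; exists b; rewrite ?inE.
  apply: leq_trans (card_bigcup_le _ _) _; rewrite -sum_nat_const; apply: leq_sum => b _.
  rewrite -[X in _ <= X]card_ord -(card_in_imset (f := snd)); first exact: max_card.
  move=> [t1 t2] [u1 u2]; rewrite !inE => /eqP -> /eqP h2 /= e2.
  by move: h2; rewrite /height /= e2 => /addIn/val_inj->.
- move=> i; rewrite card_prod card_ord; apply: leq_ltn_trans few.
  rewrite big_split /= sum1_card leq_add2l -big_mkcond sum_nat_const leq_mul2r; apply/orP; right.
  rewrite -cardsE.
  apply: (@leq_trans #|\bigcup_(a : X) [set j | [exists p, [&& sp p, pre i a == Some p & [exists b, pre j b == Some p]]]]|).
    apply/subset_leq_card/subsetP => j; rewrite inE => /existsP[a /existsP[b /existsP[p /and3P[sp1 h1 h2]]]].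
    apply/bigcupP; exists a; rewrite ?inE //; apply/existsP; exists p; rewrite sp1 h1 /=.
    by apply/existsP; exists b.
  apply: leq_trans (card_bigcup_le _ _) _; rewrite -sum_nat_const; apply: leq_sum => a _.
  case e: (pre i a) => [p|]; last first.
    by rewrite (_ : [set _ | _] = set0) ?cards0 //; apply/setP => j; rewrite !inE; apply/existsP => -[p /and3P[]].
  have [spp|nsp] := boolP (sp p).
    apply: leq_trans (pre_few spp); apply/subset_leq_card/subsetP => j; rewrite !inE.
    by case/existsP=> p' /and3P[_ /eqP[<-]].
  rewrite (_ : [set _ | _] = set0) ?cards0 //; apply/setP => j; rewrite !inE.
  by apply/existsP => -[p' /and3P[sp' /eqP[ep]]]; rewrite -ep (negPf nsp) in sp'.
exists tau; split.
  by move=> i j e; apply/eqP; apply: contraT => /htau; rewrite /bad e eqxx.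
move=> i j nij sij b; have := htau _ _ nij; rewrite /bad sij negb_or /= negb_exists.
by case/andP=> _ /forallP/(_ b).
Qed.

Definition place (tau : I -> 'I_q * 'I_q) (i : I) (a : X) : B + X * 'I_yq :=
  if pre i a is Some p then inl p else inr (a, Ordinal (height_lt a (tau i))).

Lemma placement : exists f : I -> X -> B + X * 'I_yq, [/\
  forall i, injective (f i),
  forall p p', \sum_i wt adj (f i) (inl p) (inl p') =
    \sum_i wt adj (pre i) (Some p) (Some p'),
  forall p y, ~~ sp p -> \sum_i wt adj (f i) (inl p) (inr y) = 0,
  forall p y, \sum_i wt adj (f i) (inl p) (inr y) <= 1 &
  forall y y', \sum_i wt adj (f i) (inr y) (inr y') <= 1].
Proof.
have [tau [tau_inj htau]] := tau_exists.
exists (place tau); rewrite /place.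
have le1 (g : I -> X -> B + X * 'I_yq) x y : (forall i, injective (g i)) ->
    (forall i j a b a' b', adj a b -> adj a' b' -> g i a = x -> g i b = y ->
      g j a' = x -> g j b' = y -> i = j) -> \sum_i wt adj (g i) x y <= 1.
  move=> gi u; have [->//|] := posnP (\sum_i wt adj (g i) x y).
  rewrite lt0n sum_nat_eq0 => /forallPn[i]; rewrite -lt0n => /wt_gt0P[a [b [ab ea eb]]].
  rewrite (sum_wt1 ab ea eb) // => j a' b' ab' ea' eb'.
  have ej : j = i by apply: (u j i a' b' a b).
  by subst j; split=> //; apply: (gi i); rewrite ?ea ?eb.
have finj i : injective (fun a => if pre i a is Some p then inl p else
    inr (a, Ordinal (height_lt a (tau i))) : B + X * 'I_yq).
  move=> a b; case ea: (pre i a) => [p|]; case eb: (pre i b) => [p'|] //.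
    by case=> e; apply: pre_inj ea _; rewrite e.
  by case.
split=> //.
- move=> p p'; apply: eq_bigr => i _; apply: eq_bigr => -[a b] _ /=.
  by case: (pre i a) => [u|]; case: (pre i b).
- move=> p y nsp; rewrite sum_wt0 // => i a b ab.
  case ea: (pre i a) => [u|] //; case eb: (pre i b) => [u'|] // [eu] _.
  by move: nsp; rewrite -eu (pre_sp ab ea eb).
- move=> p [c z]; apply: le1 => // i j a b a' b' ab ab'.
  case ea: (pre i a) => [u|] //; case eb: (pre i b) => [v|] // [eu] [ec ez].
  case ea': (pre j a') => [u'|] //; case eb': (pre j b') => [v'|] // [eu'] [ec' ez'].
  subst u u' b b'; apply/eqP; apply: contraT => nij.
  have /htau : share i j.
    apply/existsP; exists a; apply/existsP; exists a'; apply/existsP; exists p.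
    by rewrite (pre_sp ab ea eb) ea ea' !eqxx.
  by move=> /(_ nij c) /eqP[]; have := congr1 val ez; have := congr1 val ez'; move=> /= -> ->.
- move=> [c z] [c' z']; apply: le1 => // i j a b a' b' ab ab'.
  case ea: (pre i a) => [u|] //; case eb: (pre i b) => [v|] // [e1 e2] [e3 e4].
  case ea': (pre j a') => [u'|] //; case eb': (pre j b') => [v'|] // [e5 e6] [e7 e8].
  apply: tau_inj; subst a b a' b'.
  have ncc : c != c' by apply: contraTneq ab => ->; rewrite adj_irr.
  apply: (height_inj ncc).
    by have := congr1 val e2; have := congr1 val e6; move=> /= -> ->.
  by have := congr1 val e4; have := congr1 val e8; move=> /= -> ->.
Qed.

End Placement.

(** * Covering an oriented graph *)

(** Padding occurs only in the last group of out-neighbours: only one group starts before the end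
    [z] of the list and reaches it or passes it. *)
Lemma last_chunk (k k' d l z : nat) : l < d -> k * d < z -> k' * d < z ->
  z <= k' * d + l -> z <= k * d + l -> k = k'.
Proof.
move=> ld h1 h2 h3 h4.
have d0 : 0 < d by apply: leq_trans ld.
have k1 : k < k'.+1 by rewrite -(ltn_pmul2r d0) mulSn; lia.
have k2 : k' < k.+1 by rewrite -(ltn_pmul2r d0) mulSn; lia.
by apply/eqP; rewrite eqn_leq -ltnS k1 -ltnS k2.
Qed.

Section Stars.
Variables (X : finType) (adj : rel X) (cl : X -> bool).
Hypothesis adj_sym : symmetric adj.
Hypothesis adj_cl : forall a b, adj a b -> cl a != cl b.
Variables (a0 : X) (d : nat).
Hypothesis cl0 : cl a0.
Hypothesis d0 : 0 < d.
Variable ell : X -> 'I_d.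
Hypothesis ell_inj : {in [set b | adj a0 b] &, injective ell}.
Hypothesis ell_surj : forall l, exists2 b, adj a0 b & ell b = l.
Variables (D : finType) (o : D) (arrow : rel D).
Hypothesis arrow_asym : forall u v, arrow u v -> ~~ arrow v u.
Variables (a kap : nat).
Hypothesis arrow_in : forall u, #|[set v | arrow v u]| <= a.
Variables (J s c0 Qw : nat) (jcls : D -> 'I_J).
Hypothesis jcls_le : forall j, #|[set v | jcls v == j]| <= kap.
Hypothesis dc0 : d <= c0.
Variable idx : X -> 'I_Qw.
Hypothesis idx_inj : injective idx.
Hypothesis many : #|D| * a < s * (s - d * maxn a kap).

(* The star [(v, k)] consists of the [k]-th group of [d] out-neighbours of [v],
   the last group being padded with vertices of the block [C_(jcls v)].  In its
   copy of H, [v] is the vertex [a0], the leaves are the neighbours of [a0], and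
   the rest of the class of [a0] goes to the block [W_(chi st)]; the other
   vertices ([None] in [preS]) are placed later and have no neighbour in [D]. *)
Definition out v := enum [set u | arrow v u].
Definition active (st : D * 'I_#|D|) : bool := st.2 * d < size (out st.1).
Definition star := {st : D * 'I_#|D| | active st}.
Local Notation C := ('I_J * 'I_c0)%type.
Local Notation W := ('I_s * 'I_Qw)%type.

Definition leaf (st : star) (l : 'I_d) : D + C :=
  let v := (val st).1 in let i := (val st).2 * d + l in
  if i < size (out v) then inl (nth o (out v) i)
  else inr (jcls v, widen_ord dc0 l).

Local Notation ctr st := (val st).1.

Lemma arrow_irr v : arrow v v = false.
Proof. by apply/negP => vv; have := arrow_asym vv; rewrite vv. Qed.

Lemma mem_out v u : (u \in out v) = arrow v u.
Proof. by rewrite mem_enum inE. Qed.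

Lemma leaf_arrow st l u : leaf st l = inl u -> arrow (ctr st) u.
Proof. by rewrite /leaf; case: ifP => // h [<-]; rewrite -mem_out mem_nth. Qed.

Lemma leaf_cls st l c : leaf st l = inr c -> c.1 = jcls (ctr st) /\ c.2 = l :> nat.
Proof. by rewrite /leaf; case: ifP => // _ [<-]. Qed.

Lemma leaf_ctr st st' l l' : ctr st = ctr st' -> leaf st l = leaf st' l' ->
  st = st' /\ l = l'.
Proof.
case: st st' => [[v k] ak] [[v' k'] ak'] /= ev; subst v'.
have hk : k * d < size (out v) := ak; have hk' : k' * d < size (out v) := ak'.
rewrite /leaf /=.
suff H : k * d + l = k' * d + l' -> exist active (v, k) ak = exist active (v, k') ak' /\ l = l'.
  case: ifP => h; case: ifP => h' // [].
    by move=> /eqP; rewrite nth_uniq ?enum_uniq // => /eqP/H.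
  move=> el; apply: H; rewrite -el; congr (_ + _).
  move/negbT: h; move/negbT: h'; rewrite -!leqNgt -el => h h'.
  by rewrite (last_chunk (ltn_ord l) hk hk' h h').
move=> e; have ek : k = k' :> nat.
  by have := congr1 (divn^~ d) e; rewrite /= !divnMDl // !divn_small // !addn0.
have el : l = l' :> nat by move: e; rewrite ek => /addnI.
by split; apply: val_inj => //=; congr (_, _); apply: val_inj.
Qed.

Lemma leaf_inj st : injective (leaf st).
Proof. by move=> l l' /(leaf_ctr (erefl _)) []. Qed.

Lemma arrow_leaf v u : arrow v u -> exists st l, ctr st = v /\ leaf st l = inl u.
Proof.
move=> vu; have uo : u \in out v by rewrite mem_out.
pose i := index u (out v); have iz : i < size (out v) by rewrite index_mem.
have kD : i %/ d < #|D|.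
  apply: leq_ltn_trans (leq_div _ _) _; apply: leq_trans iz _.
  by rewrite -cardE max_card.
have kd : i %/ d * d <= i by apply: leq_trunc_div.
have ak : active (v, Ordinal kD) by rewrite /active /=; apply: leq_ltn_trans iz.
exists (exist (fun st : D * 'I_#|D| => active st) _ ak), (Ordinal (ltn_pmod i d0)); split=> //.
by rewrite /leaf /= -divn_eq iz nth_index.
Qed.

(** Leaf 0 of a star is never padding, so stars inject into arrows, which are counted by their
    heads. *)
Lemma card_star : #|{: star}| <= #|D| * a.
Proof.
pose l0 := Ordinal d0.
have lf st : exists u, leaf st l0 = inl u.
  have := valP st; rewrite /active /leaf addn0 => ->; by eexists.
have [fu hfu] := choice lf.
have fi : injective (fun st => (ctr st, fu st)).
  by move=> st st' [ec eu]; have [] := @leaf_ctr st st' l0 l0 ec; rewrite // !hfu eu.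
rewrite -(card_imset _ fi); apply: (@leq_trans #|[set p : D * D | arrow p.1 p.2]|).
  apply/subset_leq_card/subsetP => _ /imsetP[st _ ->]; rewrite inE /=.
  exact: leaf_arrow (hfu st).
rewrite (card_fibers _ snd) -sum_nat_const; apply: leq_sum => u _.
apply: leq_trans (arrow_in u); rewrite -(card_in_imset (f := fst)).
  apply/subset_leq_card/subsetP => _ /imsetP[[v w] + ->]; rewrite !inE /=.
  by move=> /andP[vw /eqP<-].
by move=> [v w] [v' w']; rewrite !inE /= => /andP[_ /eqP->] /andP[_ /eqP->] ->.
Qed.

(** A leaf and the centre determine the star. The centres are in-neighbours of an old leaf, or
    members of the class whose block contains a padding leaf; bounding this second number is what
    the classes are for. *)
Lemma card_leaf x : #|[set st | [exists l, leaf st l == x]]| <= maxn a kap.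
Proof.
have ci : {in [set st | [exists l, leaf st l == x]] &, injective (fun st : star => ctr st)}.
  move=> st st'; rewrite !inE => /existsP[l /eqP el] /existsP[l' /eqP el'] ec.
  by have [] := @leaf_ctr st st' l l' ec; rewrite // el el'.
rewrite -(card_in_imset ci) leq_max; case: x {ci} => [u|c]; apply/orP; [left|right].
  apply: leq_trans (arrow_in u); apply/subset_leq_card/subsetP => _ /imsetP[st + ->].
  by rewrite !inE => /existsP[l /eqP/leaf_arrow].
apply: leq_trans (jcls_le c.1); apply/subset_leq_card/subsetP => _ /imsetP[st + ->].
by rewrite !inE => /existsP[l /eqP/leaf_cls[->]].
Qed.

Definition meet (st st' : star) := [exists l, exists l', leaf st l == leaf st' l'].

(** Each of the d leaves of a star lies in at most maxn a kap stars, which bounds the conflicts. The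
    capacity [s] bounds the number of old vertices touching one block of W. *)
Lemma chi_exists : exists chi : star -> 'I_s,
  (forall st st', meet st st' -> chi st = chi st' -> st = st') /\
  (forall g, #|[set st | chi st == g]| <= s).
Proof.
have [|||chi [h1 h2]] := @greedy_coloring star 'I_s meet (d * maxn a kap) s.
- by move=> st st'; apply/'exists_existsP/'exists_existsP => -[l [l' /eqP e]]; exists l', l; rewrite e.
- move=> st; apply: (@leq_trans #|\bigcup_(l : 'I_d) [set st' | [exists l', leaf st' l' == leaf st l]]|).
    apply/subset_leq_card/subsetP => st'; rewrite inE => /existsP[l /existsP[l' /eqP e]].
    by apply/bigcupP; exists l => //; rewrite inE; apply/existsP; exists l'; rewrite e.
  apply: leq_trans (card_bigcup_le _ _) _.
  rewrite -[d in d * _]card_ord -sum_nat_const; apply: leq_sum => l _.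
  exact: card_leaf.
- by rewrite card_ord; apply: leq_ltn_trans card_star many.
exists chi; split=> // st st' m e; apply/eqP; apply: contraT => n.
by have := h1 _ _ n m; rewrite e eqxx.
Qed.

Variable chi : star -> 'I_s.
Hypothesis chi_meet : forall st st', meet st st' -> chi st = chi st' -> st = st'.

Local Notation base := (D + (C + W))%type.

Definition lf (x : D + C) : base :=
  match x with inl u => inl u | inr c => inr (inl c) end.

Lemma lf_inj : injective lf.
Proof. by move=> [u|c] [u'|c'] //= [->]. Qed.

Definition preS (st : star) (b : X) : option base :=
  if b == a0 then Some (inl (ctr st))
  else if adj a0 b then Some (lf (leaf st (ell b)))
  else if cl b then Some (inr (inr (chi st, idx b))) else None.

Lemma preS_inj st b b' p : preS st b = Some p -> preS st b' = Some p -> b = b'.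
Proof.
have lc l : lf (leaf st l) = inl (ctr st) -> False.
  case e: (leaf st l) => [u|//] /= [eu]; have := leaf_arrow e.
  by rewrite eu arrow_irr.
have lw l w : lf (leaf st l) = inr (inr w) -> False by case: (leaf st l).
rewrite /preS; have [->|nb] := eqVneq b a0; have [->|nb'] := eqVneq b' a0 => //.
- move=> [ep]; subst p; case: ifP => [_ [/lc//]|_]; by case: ifP.
- move=> + [ep]; subst p; case: ifP => [_ [/lc//]|_]; by case: ifP.
case ab: (adj a0 b); case ab': (adj a0 b').
- move=> [e1] [e2]; move: e1; rewrite -e2 => /lf_inj/leaf_inj.
  by apply: ell_inj; rewrite inE.
- by move=> [e1]; case: ifP => // _ [e2]; case: (lw (ell b) (chi st, idx b')); rewrite e1 -e2.
- by case: ifP => // _ [e1] [e2]; case: (lw (ell b') (chi st, idx b)); rewrite e2 -e1.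
- case: ifP => // _ [e1]; case: ifP => // _ [e2].
  by move: e1; rewrite -e2 => -[/idx_inj].
Qed.

Lemma preS_edge st b b' x y : adj b b' -> cl b ->
  preS st b = Some x -> preS st b' = Some y ->
  adj a0 b' /\ y = lf (leaf st (ell b')) /\
  (b = a0 /\ x = inl (ctr st) \/ x = inr (inr (chi st, idx b))).
Proof.
move=> bb' cb; have cb' : cl b' = false by move: (adj_cl bb'); rewrite cb; case: (cl b').
have n0b' : b' == a0 = false by apply/eqP => e; move: cb'; rewrite e cl0.
have nb : adj a0 b = false by apply/negP => /adj_cl; rewrite cl0 cb.
rewrite /preS n0b' nb cb cb'; case ab': (adj a0 b') => // hx [<-]; split=> //; split=> //.
by move: hx; case: eqP => [-> [<-]|_ [<-]]; [left|right].
Qed.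

Lemma preS_nbr st b b' u : adj b b' -> preS st b = Some (inl u) ->
  exists y, preS st b' = Some y.
Proof.
move=> bb'; have ncl := adj_cl bb'; rewrite /preS.
have [eb|nb] := eqVneq b a0.
  subst b; move=> _; case: ifP => _; first by eexists.
  by rewrite bb'; eexists.
case: ifP => [ab _|_]; last by case: ifP.
case: ifP => _; first by eexists.
case: ifP => _; first by eexists.
have cb : cl b = false by have := adj_cl ab; rewrite cl0; case: (cl b).
by move: ncl; rewrite cb; case: (cl b') => // _; eexists.
Qed.

Definition pwS (x y : base) : nat := \sum_st wt adj (preS st) (Some x) (Some y).

(** An edge from the centre to a leaf determines the star by [leaf_ctr], an edge from a leaf to W by
    [chi_meet]. Two stars covering an old pair in opposite directions would give arrows both
    ways. *)
Lemma preS_uniq st st' b c b' c' x y : adj b c -> adj b' c' ->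
  preS st b = Some x -> preS st c = Some y ->
  preS st' b' = Some x -> preS st' c' = Some y -> st = st'.
Proof.
wlog cb : b c b' c' x y / cl b => [IH|].
  case cb: (cl b); first exact: IH.
  move=> bc bc' h1 h2 h3 h4; apply: (IH c b c' b' y x) => //; rewrite 1?adj_sym //.
  by have := adj_cl bc; rewrite cb; case: (cl c).
move=> bc bc' h1 h2; have [ac [ey ex]] := preS_edge bc cb h1 h2.
case cb': (cl b') => h3 h4.
  have [ac' [ey' ex']] := preS_edge bc' cb' h3 h4.
  have el : leaf st (ell c) = leaf st' (ell c') by apply: lf_inj; rewrite -ey -ey'.
  case: ex => [[_ ex]|ex]; case: ex' => [[_ ex']|ex']; rewrite ex in ex' => //.
    by case: ex' => e; have [] := leaf_ctr e el.
  case: ex' => ec _; apply: chi_meet ec; apply/existsP; exists (ell c).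
  by apply/existsP; exists (ell c'); rewrite el.
have cc' : cl c' by have := adj_cl bc'; rewrite cb'; case: (cl c').
rewrite adj_sym in bc'; have [ab' [ey' ex']] := preS_edge bc' cc' h4 h3.
case: ex ex' => [[_ ex]|ex]; last first.
  by move: ex; rewrite ey'; case: (leaf _ _).
case=> [[_ ex']|ex']; last by move: ex'; rewrite ey; case: (leaf _ _).
have e1 : leaf st (ell c) = inl (ctr st') by apply: lf_inj; rewrite -ey ex'.
have e2 : leaf st' (ell b') = inl (ctr st) by apply: lf_inj; rewrite -ey' ex.
by have := arrow_asym (leaf_arrow e1); rewrite (leaf_arrow e2).
Qed.

Lemma pwS_sum1 st b c x y : adj b c -> preS st b = Some x -> preS st c = Some y ->
  pwS x y = 1.
Proof.
move=> bc hb hc; apply: (sum_wt1 bc hb hc) => st' b' c' bc' hb' hc'.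
have e := preS_uniq bc' bc hb' hc' hb hc; subst st'.
by split=> //; [apply: preS_inj hb' hb|apply: preS_inj hc' hc].
Qed.

Lemma pwS_le1 x y : pwS x y <= 1.
Proof.
have [->//|] := posnP (pwS x y).
rewrite lt0n sum_nat_eq0 => /forallPn[st]; rewrite -lt0n => /wt_gt0P[b [c [bc hb hc]]].
by rewrite (pwS_sum1 bc hb hc).
Qed.

Lemma pwSP x y : 0 < pwS x y -> exists st b c,
  [/\ adj b c, preS st b = Some x & preS st c = Some y].
Proof.
rewrite lt0n sum_nat_eq0 => /forallPn[st]; rewrite -lt0n => /wt_gt0P[b [c h]].
by exists st, b, c.
Qed.

Lemma pwSC x y : pwS x y = pwS y x.
Proof. by apply: eq_bigr => st _; rewrite wtC. Qed.

Lemma pwS_DD u v : pwS (inl u) (inl v) = arrow u v || arrow v u :> nat.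
Proof.
have arr w z : arrow w z -> pwS (inl w) (inl z) = 1.
  move=> wz; have [st [l [ec el]]] := arrow_leaf wz.
  have [b ab eb] := ell_surj l.
  apply: (pwS_sum1 (st := st) ab).
    by rewrite /preS eqxx ec.
  have nb : b == a0 = false by apply/eqP => e; have := adj_cl ab; rewrite e eqxx.
  by rewrite /preS nb ab eb el.
case: orP => [[/arr//|/arr]|na]; first by rewrite pwSC.
apply/eqP; rewrite -leqn0 leqNgt; apply/negP => /pwSP[st [b [c [bc hb hc]]]]; case: na.
case cb: (cl b).
  have [_ [ey [[_ [ex]]|//]]] := preS_edge bc cb hb hc; left.
  by rewrite ex; apply: (@leaf_arrow st (ell c)); apply: lf_inj; rewrite -ey.
have cc : cl c by have := adj_cl bc; rewrite cb; case: (cl c).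
rewrite adj_sym in bc.
have [_ [ey [[_ [ex]]|//]]] := preS_edge bc cc hc hb; right.
by rewrite ex; apply: (@leaf_arrow st (ell b)); apply: lf_inj; rewrite -ey.
Qed.

Lemma pwS_DP v p : 0 < pwS (inl v) (inr p) ->
  (exists st l c, [/\ p = inl c, ctr st = v & leaf st l = inr c]) \/
  (exists st l t, p = inr (chi st, t) /\ leaf st l = inl v).
Proof.
move/pwSP=> [st [b [c [bc hb hc]]]].
case cb: (cl b).
  have [_ [ey [[_ [ex]]|//]]] := preS_edge bc cb hb hc; left.
  exists st, (ell c); move: ey; case: (leaf st (ell c)) => //= c' [->].
  by exists c'.
have cc : cl c by have := adj_cl bc; rewrite cb; case: (cl c).
rewrite adj_sym in bc.
have [_ [ey [[_ //]|ex]]] := preS_edge bc cc hc hb; right.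
exists st, (ell b), (idx c); split; first by case: ex.
by apply: lf_inj; rewrite -ey.
Qed.

(** All neighbours of a vertex of H placed on [v] are preplaced too, so each copy contributes a full
    degree of H at [v]. *)
Lemma degsum_pwS v : degsum adj (\sum_x pwS (inl v) x).
Proof.
rewrite exchange_big /=; apply: degsum_sum => st _.
rewrite exchange_big /=.
rewrite (eq_bigr (fun p : X * X => adj p.1 p.2 * (preS st p.1 == Some (inl v)))); last first.
  move=> [b c] /= bc; rewrite bc mul1n; case: eqP => eb /=; last by rewrite big1.
  have [y ey] := preS_nbr bc eb; rewrite ey.
  by rewrite (sum1_nat (P := fun x => Some y == Some x) (i0 := y)) // => x /eqP[].
rewrite big_mkcond /= -(pair_bigA _ (fun b c => if adj b c then adj b c * (preS st b == Some (inl v)) else 0)) /=.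
apply: degsum_sum => b _; rewrite (eq_bigr (fun c => (preS st b == Some (inl v)) * adj b c)).
  by rewrite -big_distrr /= sum_adj; apply/degsum_muln/degsum_deg.
by move=> c _ /=; case: (adj b c); rewrite ?muln0 ?muln1 ?mul1n.
Qed.

Hypothesis chi_cap : forall g, #|[set st | chi st == g]| <= s.
Variable M : nat.
Hypothesis M0 : 0 < M.
Hypothesis Mc0 : M %| c0.
Hypothesis MQw : M %| Qw.
Hypothesis cD : M %| #|[set~ o]|.
Hypothesis arrow_o : forall v, ~~ arrow v o.
Hypothesis room : d * s + M <= #|[set~ o]|.

Definition leaves g : {set D} := [set u | [exists st, (chi st == g) && [exists l, leaf st l == inl u]]].

Lemma card_leaves g : #|leaves g| <= d * s.
Proof.
apply: (@leq_trans #|\bigcup_(st | chi st == g) [set u | [exists l, leaf st l == inl u]]|).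
  apply/subset_leq_card/subsetP => u; rewrite inE => /existsP[st /andP[e h]].
  by apply/bigcupP; exists st => //; rewrite inE.
apply: leq_trans (card_bigcup_le _ _) _.
apply: (@leq_trans (\sum_(st | chi st == g) d)).
  apply: leq_sum => st _; rewrite -(card_imset _ (@inl_inj D C)).
  apply: (@leq_trans #|leaf st @: setT|); last first.
    by apply: leq_trans (leq_imset_card _ _) _; rewrite cardsT card_ord.
  apply/subset_leq_card/subsetP => _ /imsetP[u + ->]; rewrite inE => /existsP[l /eqP<-].
  exact: imset_f.
by rewrite sum_nat_cond_const mulnC leq_mul2l chi_cap orbT.
Qed.

Lemma superset_of_size (T : finType) (A B : {set T}) k : A \subset B ->
  #|A| <= k <= #|B| -> exists S : {set T}, [/\ A \subset S, S \subset B & #|S| = k].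
Proof.
move=> AB /andP[Ak kB]; have [|S SB cS] := @subset_of_size _ (B :\: A) (k - #|A|).
  by rewrite cardsD (setIidPr AB) leq_sub2r.
exists (A :|: S); split; first exact: subsetUl.
  by rewrite subUset AB (subset_trans SB) ?subsetDl.
rewrite cardsU (_ : A :&: S = set0) ?cards0 ?subn0 ?cS ?subnKC //.
apply/setP => x; rewrite !inE; apply/negP => /andP[xA /(subsetP SB)].
by rewrite inE xA.
Qed.

(** The leaves are padded to a multiple of M, so that the rest of [set~ o] also has size divisible
    by M and can form a complete bipartite graph with the block W_g. *)
Lemma U_exists : exists U : 'I_s -> {set D}, forall g,
  [/\ leaves g \subset U g, U g \subset [set~ o], M %| #|U g| & #|U g| <= d * s + M].
Proof.
suff h g : exists S : {set D},
  [/\ leaves g \subset S, S \subset [set~ o], M %| #|S| & #|S| <= d * s + M].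
  by have [U hU] := choice h; exists U.
pose t := #|leaves g| + (M - #|leaves g| %% M).
have tM : M %| t.
  rewrite /t {1}(divn_eq #|leaves g| M) -addnA subnKC ?dvdn_add ?dvdn_mull //.
  by rewrite ltnW // ltn_mod.
have tle : t <= d * s + M by rewrite leq_add ?card_leaves // leq_subr.
have [||S [S1 S2 cS]] := @superset_of_size _ (leaves g) [set~ o] t.
- apply/subsetP => u; rewrite !inE => /existsP[st /andP[_ /existsP[l /eqP/leaf_arrow]]].
  by apply: contraTneq => ->.
- by rewrite leq_addr (leq_trans tle).
by exists S; rewrite cS.
Qed.

Variable U : 'I_s -> {set D}.
Hypothesis U_leaves : forall g, leaves g \subset U g.
Hypothesis U_o : forall g, U g \subset [set~ o].
Hypothesis UM : forall g, M %| #|U g|.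
Hypothesis U_le : forall g, #|U g| <= d * s + M.

(* The pairs outside the complete bipartite graphs between the complement of
   [U g] and [W_g], and between the complement of the class [j] and [C_j]. *)
Definition irr v (p : C + W) : bool :=
  match p with inl c => jcls v == c.1 | inr w => v \in U w.1 end.
Definition used v (p : C + W) : bool := 0 < pwS (inl v) (inr p).

Lemma used_irr v p : used v p -> irr v p.
Proof.
case/pwS_DP => [[st [l [c [-> <- /leaf_cls[e _]]]]]|[st [l [t [-> e]]]]] /=.
  by rewrite e.
by apply: (subsetP (U_leaves _)); rewrite inE; apply/existsP; exists st;
   rewrite eqxx; apply/existsP; exists l; rewrite e.
Qed.

Lemma pwS_used v p : pwS (inl v) (inr p) = used v p.
Proof. by rewrite /used; have := pwS_le1 (inl v) (inr p); case: pwS => [|[]]. Qed.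

(** The pairs at [v] that fillers must cover; none at [o], whose remaining pairs to the new vertices
    are left for the next round. *)
Definition lft v : {set C + W} :=
  if v == o then set0 else [set p | irr v p && ~~ used v p].

Variable K0 : nat.
Hypothesis K0c0 : K0 + d <= c0.
Hypothesis degsum_lg : forall r t, K0 <= r -> degsum adj t -> M %| r + t -> degsum adj r.
Hypothesis degL : forall v, exists2 t, degsum adj t &
  M %| #|[set u | arrow v u || arrow u v]| + t.

Lemma irrM v : M %| #|[set p | irr v p]|.
Proof.
rewrite -sum1dep_card big_mkcond big_sumType /=; apply: dvdn_add.
  rewrite -(pair_bigA _ (fun j l => if jcls v == j then 1 else 0)) /=.
  by apply: dvdn_sum => j _; rewrite sum_nat_const card_ord dvdn_mulr.
rewrite -(pair_bigA _ (fun g l => if v \in U g then 1 else 0)) /=.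
by apply: dvdn_sum => j _; rewrite sum_nat_const card_ord dvdn_mulr.
Qed.

(** The residue is right by [degL], since the irregular pairs at [v] number a multiple of M and the
    stars contribute a sum of degrees. The size is at least [K0], since padding at [v] uses only the
    first d places of its block, which has c0 >= K0 + d. *)
Lemma degsum_lft v : degsum adj #|lft v|.
Proof.
rewrite /lft; have [_|vo] := eqVneq v o; first by rewrite cards0; apply: degsum0.
set R := [set p | _]; have [t dt tM] := degL v.
have eR : #|R| + #|[set p | used v p]| = #|[set p | irr v p]|.
  rewrite addnC -(cardsID [set p | used v p] [set p | irr v p]); congr (_ + _).
    by apply: eq_card => p; rewrite !inE; have := @used_irr v p; case: (used v p) => [->|_]; rewrite ?andbF.
  by apply: eq_card => p; rewrite !inE andbC.
have eS : \sum_x pwS (inl v) x = #|[set u | arrow v u || arrow u v]| + #|[set p | used v p]|.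
  rewrite big_sumType; congr (_ + _).
    rewrite -sum1dep_card [RHS]big_mkcond; apply: eq_bigr => u _.
    by rewrite pwS_DD; case: ifP.
  rewrite -sum1dep_card [RHS]big_mkcond; apply: eq_bigr => p _.
  by rewrite pwS_used; case: ifP.
apply: (degsum_lg (t := \sum_x pwS (inl v) x + t)).
- apply: (@leq_trans #|[set (inl (jcls v, l) : C + W) | l in [set l : 'I_c0 | d <= l]]|).
    rewrite card_imset; last by move=> l l' [].
    have := cardsC [set l : 'I_c0 | d <= l]; rewrite card_ord.
    have : #|~: [set l : 'I_c0 | d <= l]| <= d; last by lia.
    rewrite -[X in _ <= X](card_ord d) -[X in _ <= X](card_image (f := widen_ord dc0)).
      apply/subset_leq_card/subsetP => l; rewrite !inE -ltnNge => ld.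
      by apply/imageP; exists (Ordinal ld) => //; apply: val_inj.
    by move=> l l' /(congr1 val) /= /val_inj.
  apply/subset_leq_card/subsetP => _ /imsetP[l + ->]; rewrite !inE /= eqxx /= => dl.
  apply/negP => /pwS_DP[[st [l' [c [[<-] _ /leaf_cls[_ /= el]]]]]|[st [l' [t' [//]]]]].
  by have := ltn_ord l'; rewrite -el ltnNge dl.
- by apply: degsumD => //; apply: degsum_pwS.
- rewrite eS; have -> : #|R| + (#|[set u | arrow v u || arrow u v]| + #|[set p | used v p]| + t) =
    #|[set p | irr v p]| + (#|[set u | arrow v u || arrow u v]| + t) by rewrite -eR; lia.
  by rewrite dvdn_add ?irrM.
Qed.

Lemma gadgets_exist : exists (act : D -> {set C + W}) (xs : D -> C + W -> X)
    (nu : D -> C + W -> X -> C + W), forall v,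
  [/\ act v \subset lft v,
    forall p b, p \in act v -> adj (xs v p) b -> nu v p b \in lft v,
    forall r, r \in lft v -> exists p b, [/\ p \in act v, adj (xs v p) b & nu v p b = r] &
    forall p b p' b', p \in act v -> p' \in act v -> adj (xs v p) b -> adj (xs v p') b' ->
      nu v p b = nu v p' b' -> p = p' /\ b = b'].
Proof.
have hv v : exists F : {set C + W} * (C + W -> X) * (C + W -> X -> C + W),
  let: (act, xs, nu) := F in
  [/\ act \subset lft v,
    forall p b, p \in act -> adj (xs p) b -> nu p b \in lft v,
    forall r, r \in lft v -> exists p b, [/\ p \in act, adj (xs p) b & nu p b = r] &
    forall p b p' b', p \in act -> p' \in act -> adj (xs p) b -> adj (xs p') b' ->
      nu p b = nu p' b' -> p = p' /\ b = b'].
  by have [act [xs [nu h]]] := degsum_partition a0 (degsum_lft v); exists (act, xs, nu).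
have [F hF] := choice hv.
exists (fun v => (F v).1.1), (fun v => (F v).1.2), (fun v => (F v).2) => v.
by have := hF v; case: (F v) => [[act xs] nu].
Qed.

Variables (act : D -> {set C + W}) (xs : D -> C + W -> X) (nu : D -> C + W -> X -> C + W).
Hypothesis act_lft : forall v, act v \subset lft v.
Hypothesis nu_lft : forall v p b, p \in act v -> adj (xs v p) b -> nu v p b \in lft v.
Hypothesis nu_surj : forall v r, r \in lft v ->
  exists p b, [/\ p \in act v, adj (xs v p) b & nu v p b = r].
Hypothesis nu_inj : forall v p b p' b', p \in act v -> p' \in act v ->
  adj (xs v p) b -> adj (xs v p') b' -> nu v p b = nu v p' b' -> p = p' /\ b = b'.

(* A filler covers [deg] edges of [lft v] with [v] in the role of [xs v p]; it
   is indexed by one of them. *)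
Definition filler := {vp : D * (C + W) | vp.2 \in act vp.1}.

Definition pre2 (t : filler) (b : X) : option base :=
  let: (v, p) := val t in
  if b == xs v p then Some (inl v)
  else if adj (xs v p) b then Some (inr (nu v p b)) else None.

Lemma pre2_inj t b b' x : pre2 t b = Some x -> pre2 t b' = Some x -> b = b'.
Proof.
case: t => [[v p] /= ap]; rewrite /pre2 /=.
case: eqP => [->|_]; case: eqP => [->|_] //.
- by move=> [<-]; case: ifP.
- by case: ifP => // _ [<-].
case ab: (adj _ b) => //; case ab': (adj _ b') => // -[<-] [e].
by have [] := nu_inj ap ap ab ab' (esym e).
Qed.

Lemma pre2_edge t b c x y : adj b c -> pre2 t b = Some x -> pre2 t c = Some y ->
  [/\ b = xs (val t).1 (val t).2, x = inl (val t).1 & y = inr (nu (val t).1 (val t).2 c)] \/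
  [/\ c = xs (val t).1 (val t).2, y = inl (val t).1 & x = inr (nu (val t).1 (val t).2 b)].
Proof.
case: t => [[v p] /= ap] bc; rewrite /pre2 /=.
have [eb|_] := eqVneq b (xs v p).
  have [ec|_] := eqVneq c (xs v p).
    by move: (adj_cl bc); rewrite eb ec eqxx.
  by rewrite -eb bc => -[<-] [<-]; left.
case ab: (adj _ b) => // -[<-].
have [ec|_] := eqVneq c (xs v p); first by move=> [<-]; right.
case ac: (adj _ c) => //.
have := adj_cl bc; have := adj_cl ab; have := adj_cl ac.
by case: (cl b); case: (cl c); case: (cl _).
Qed.

Lemma pre2_nbr t b b' u : adj b b' -> pre2 t b = Some (inl u) -> pre2 t b' <> None.
Proof.
case: t => [[v p] /= ap] bb'; rewrite /pre2 /=.
have [eb _|_] := eqVneq b (xs v p); last by case: ifP.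
by case: eqP => // _; rewrite -eb bb'.
Qed.

Definition pw2 (x y : base) : nat := \sum_t wt adj (pre2 t) (Some x) (Some y).

Lemma pw2_DD u v : pw2 (inl u) (inl v) = 0.
Proof. by apply: sum_wt0 => t b c bc h1 h2; have [[]|[]] := pre2_edge bc h1 h2. Qed.

Lemma pw2_PP p p' : pw2 (inr p) (inr p') = 0.
Proof. by apply: sum_wt0 => t b c bc h1 h2; have [[]|[]] := pre2_edge bc h1 h2. Qed.

Lemma pre2_DP t b c v p : adj b c -> pre2 t b = Some (inl v) -> pre2 t c = Some (inr p) ->
  [/\ (val t).1 = v, adj (xs v (val t).2) c & nu v (val t).2 c = p].
Proof.
move=> bc h1 h2; have [[eb [ev] [ep]]|[_ //]] := pre2_edge bc h1 h2.
by rewrite ev ep -eb.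
Qed.

Lemma pw2_DP v p : pw2 (inl v) (inr p) = (p \in lft v).
Proof.
case pl: (p \in lft v); last first.
  apply: sum_wt0 => t b c bc h1 h2; have [ev ac ep] := pre2_DP bc h1 h2.
  by move: pl; rewrite -ep nu_lft // -ev (valP t).
have [q [c [qa ac ec]]] := nu_surj pl.
pose t : filler := exist (fun vp : D * (C + W) => vp.2 \in act vp.1) (v, q) qa.
have h1 : pre2 t (xs v q) = Some (inl v) by rewrite /pre2 /= eqxx.
have h2 : pre2 t c = Some (inr p).
  rewrite /pre2 /= ac ec; case: eqP => // e.
  by move: (adj_cl ac); rewrite e eqxx.
apply: (sum_wt1 ac h1 h2) => t' b' c' bc' h1' h2'.
have [ev ac' ep] := pre2_DP bc' h1' h2'.
have qa' : (val t').2 \in act v by rewrite -ev (valP t').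
have [eq ecc] := nu_inj qa' qa ac' ac (etrans ep (esym ec)).
have et : t' = t by apply: val_inj; rewrite /= [val t']surjective_pairing ev eq.
by subst t'; split=> //; apply: pre2_inj h1' h1.
Qed.

Definition kap2 := kap + d * s + M.

Lemma card_lft p : #|[set v | p \in lft v]| <= kap2.
Proof.
apply: (@leq_trans #|[set v | irr v p]|).
  apply/subset_leq_card/subsetP => v; rewrite !inE /lft.
  by case: eqP => _; rewrite inE // => /andP[].
rewrite /kap2; case: p => [c|w] /=.
  by apply: leq_trans (jcls_le c.1) _; rewrite -addnA leq_addr.
rewrite -addnA; apply: leq_trans (leq_addl _ _); apply: leq_trans (U_le w.1).
by apply/subset_leq_card/subsetP => v; rewrite inE.
Qed.

Lemma card_filler : #|{: filler}| <= (J * c0 + s * Qw) * kap2.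
Proof.
rewrite card_sig; apply: (@leq_trans #|[set vp : D * (C + W) | vp.2 \in lft vp.1]|).
  by apply/subset_leq_card/subsetP => vp; rewrite !inE; apply: subsetP.
rewrite (card_fibers _ snd).
have -> : J * c0 + s * Qw = #|{: C + W}| by rewrite card_sum !card_prod !card_ord.
rewrite -sum_nat_const; apply: leq_sum => p _; apply: leq_trans (card_lft p).
rewrite -(card_in_imset (f := fst)).
  apply/subset_leq_card/subsetP => _ /imsetP[[v r] + ->]; rewrite !inE /=.
  by move=> /andP[vr /eqP<-].
by move=> [v w] [v' w']; rewrite !inE /= => /andP[_ /eqP->] /andP[_ /eqP->] ->.
Qed.

Definition pre (i : star + filler) : X -> option base :=
  match i with inl st => preS st | inr t => pre2 t end.
Definition ext (x : base) : bool := if x is inr _ then true else false.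

Lemma pre_few p : ext p ->
  #|[set i | [exists b, pre i b == Some p]]| <= s + maxn a kap + kap2.
Proof.
case: p => // p _.
rewrite -sum1dep_card big_mkcond big_sumType /= -2!big_mkcond /= !sum1dep_card.
apply: leq_add.
  case: p => [c|w].
    apply: leq_trans (leq_addl _ _); apply: leq_trans (card_leaf (inr c)).
    apply/subset_leq_card/subsetP => st; rewrite !inE => /existsP[b].
    rewrite /preS; case: ifP => // _; case: ifP => [_|_]; last by case: ifP.
    case e: (leaf st (ell b)) => [//|c'] /= /eqP[<-].
    by apply/existsP; exists (ell b); rewrite e.
  apply: leq_trans (leq_addr _ _); apply: leq_trans (chi_cap w.1).
  apply/subset_leq_card/subsetP => st; rewrite !inE => /existsP[b].
  rewrite /preS; case: ifP => // _; case: ifP => [_|_]; first by case: (leaf _ _).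
  by case: ifP => // _ /eqP[<-].
apply: leq_trans (card_lft p).
have hp (t : filler) b : pre2 t b == Some (inr p) ->
    adj (xs (val t).1 (val t).2) b /\ nu (val t).1 (val t).2 b = p.
  case: t => [[v r] /= ra]; rewrite /pre2 /=; case: ifP => // _.
  by case ab: (adj _ b) => // /eqP[].
rewrite -(card_in_imset (f := fun t : filler => (val t).1)).
  apply/subset_leq_card/subsetP => _ /imsetP[t + ->]; rewrite !inE => /existsP[b /hp[ab <-]].
  exact: nu_lft (valP t) ab.
move=> t t'; rewrite !inE => /existsP[b /hp[ab eb]] /existsP[b' /hp[ab' eb']] ev.
apply: val_inj; rewrite [val t]surjective_pairing [RHS]surjective_pairing -ev; congr (_, _).
have ta := valP t; have ta' := valP t'; rewrite -ev in ta' ab' eb'.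
by have [] := nu_inj ta ta' ab ab' (etrans eb (esym eb')).
Qed.

Variables (q yq : nat).
Hypothesis qyq : #|X| * q <= yq.
Hypothesis Myq : M %| yq.
Hypothesis few : #|D| * a + (J * c0 + s * Qw) * kap2 +
  (#|X| * (s + maxn a kap + kap2)) * (#|X| * q) < q * q.
Hypothesis jclsM : forall j, M %| #|[set v | (v != o) && (jcls v == j)]|.
Hypothesis bipM : forall (T : finType) (A B : {set T}), [disjoint A & B] ->
  M %| #|A| -> M %| #|B| -> decomposable adj (biclique A B).

Local Notation Y := (X * 'I_yq)%type.
Local Notation T0 := (base + Y)%type.

Lemma pw_pre x y : \sum_i wt adj (pre i) (Some x) (Some y) = pwS x y + pw2 x y.
Proof. by rewrite big_sumType. Qed.

Lemma gadgets_placed : exists m : T0 -> T0 -> nat, [/\ decomposable adj m,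
  forall x y, m (inl x) (inl y) = pwS x y + pw2 x y,
  forall v y, m (inl (inl v)) (inr y) = 0,
  forall x y, m (inl x) (inr y) <= 1 &
  forall y y', m (inr y) (inr y') <= 1].
Proof.
have adj_irr : irreflexive adj by move=> b; apply/negP => /adj_cl; rewrite eqxx.
have pi i b b' p : pre i b = Some p -> pre i b' = Some p -> b = b'.
  by case: i => [st|t]; [apply: preS_inj|apply: pre2_inj].
have ps i b b' p : adj b b' -> pre i b = Some p -> pre i b' = None -> ext p.
  move=> bb'; case: p => // v; case: i => [st|t] /=.
    by move=> /(preS_nbr bb')[y ->].
  by move=> /(pre2_nbr bb').
have fw : #|{: star + filler}| + #|X| * (s + maxn a kap + kap2) * (#|X| * q) < q * q.
  apply: leq_ltn_trans few; rewrite leq_add2r card_sum leq_add //.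
    exact: card_star.
  exact: card_filler.
have [f [fi f1 f2 f3 f4]] := placement adj_irr pi ps pre_few fw qyq.
exists (fun x y => \sum_i wt adj (f i) x y); split=> //.
- by exists _, f; split.
- by move=> x y; rewrite f1 pw_pre.
- by move=> v y; rewrite f2.
Qed.

Let VV (A : {set D}) : {set T0} := [set x : T0 | if x is inl (inl v) then v \in A else false].
Let PP (A : {set C + W}) : {set T0} := [set x : T0 | if x is inl (inr p) then p \in A else false].
Let YY : {set T0} := [set x : T0 | if x is inr _ then true else false].

Let cVV A : #|VV A| = #|A|.
Proof.
rewrite -[RHS](card_imset (f := fun v => inl (inl v) : T0)); last by move=> u v [].
apply: eq_card => -[[v|p]|y]; rewrite inE; apply/idP/imsetP => [vA|[u uA]] //.
- by exists v.
- by case=> ->.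
Qed.

Let cPP A : #|PP A| = #|A|.
Proof.
rewrite -[RHS](card_imset (f := fun v => inl (inr v) : T0)); last by move=> u v [].
apply: eq_card => -[[v|p]|y]; rewrite inE; apply/idP/imsetP => [vA|[u uA]] //.
- by exists p.
- by case=> ->.
Qed.

Let cYY : #|YY| = #|X| * yq.
Proof.
transitivity #|{: Y}|; last by rewrite card_prod card_ord.
rewrite -[RHS]cardsT -[RHS](card_imset (f := inr : Y -> T0)); last by move=> u v [].
apply: eq_card => -[b|y]; rewrite inE; apply/idP/imsetP => [h|[u uA e]] //.
by exists y.
Qed.

Let disjVP A B : [disjoint VV A & PP B].
Proof. by rewrite -setI_eq0; apply/eqP/setP => -[[v|p]|y]; rewrite !inE ?andbF. Qed.

Let disjVY A : [disjoint VV A & YY].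
Proof. by rewrite -setI_eq0; apply/eqP/setP => -[[v|p]|y]; rewrite !inE ?andbF. Qed.

Let Cj (j : 'I_J) : {set C + W} := [set p | if p is inl c then c.1 == j else false].
Let Wg (g : 'I_s) : {set C + W} := [set p | if p is inr w then w.1 == g else false].

Let cCj j : #|Cj j| = c0.
Proof.
rewrite -[RHS]card_ord -[RHS]cardsT -[RHS](card_imset (f := fun l => inl (j, l) : C + W)).
  apply: eq_card => -[[j' l]|w]; rewrite inE; apply/idP/imsetP => [h|[l' _ e]] //.
    by exists l; rewrite // -(eqP h).
  by case: e => ->.
by move=> l l' [].
Qed.

Let cWg g : #|Wg g| = Qw.
Proof.
rewrite -[RHS]card_ord -[RHS]cardsT -[RHS](card_imset (f := fun l => inr (g, l) : C + W)).
  apply: eq_card => -[c|[j' l]]; rewrite inE; apply/idP/imsetP => [h|[l' _ e]] //.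
    by exists l; rewrite // -(eqP h).
  by case: e => ->.
by move=> l l' [].
Qed.

Let VU g := [set~ o] :\: U g.
Let VJ j := [set v | (v != o) && (jcls v != j)].

Let MVU g : M %| #|VU g|.
Proof. by rewrite cardsD (setIidPr (U_o g)) dvdn_sub. Qed.

Let MVJ j : M %| #|VJ j|.
Proof.
have e : #|[set~ o]| = #|[set v | (v != o) && (jcls v == j)]| + #|VJ j|.
  rewrite -(cardsID [set v | jcls v == j] [set~ o]); congr (_ + _);
  by apply: eq_card => v; rewrite !inE // andbC.
by move: cD; rewrite e dvdn_addr.
Qed.

(** No gadget joins an old vertex to the grid, so [set~ o] and the whole grid form one further
    complete bipartite graph. *)
Lemma regular_dec : exists m : T0 -> T0 -> nat, [/\ decomposable adj m,
  forall x y, m (inl (inl x)) (inl (inl y)) = 0,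
  forall v p, m (inl (inl v)) (inl (inr p)) = (v != o) && ~~ irr v p,
  forall v y, m (inl (inl v)) (inr y) = (v != o) &
  [/\ forall p p', m (inl (inr p)) (inl (inr p')) = 0,
  forall p y, m (inl (inr p)) (inr y) = 0 & forall y y', m (inr y) (inr y') = 0]].
Proof.
exists (fun x y => \sum_g biclique (VV (VU g)) (PP (Wg g)) x y +
  \sum_j biclique (VV (VJ j)) (PP (Cj j)) x y + biclique (VV [set~ o]) YY x y).
split.
- apply: decD; first apply: decD.
  + apply: dec_sum => g _; apply: bipM => //; first by rewrite cVV MVU.
    by rewrite cPP cWg.
  + apply: dec_sum => j _; apply: bipM => //; first by rewrite cVV MVJ.
    by rewrite cPP cCj.
  + by apply: bipM; rewrite ?cVV ?cYY // dvdn_mull.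
- move=> x y; rewrite big1 => [|g _]; last by rewrite /biclique !inE !andbF.
  by rewrite big1 => [|g _]; rewrite /biclique !inE ?andbF.
- move=> v p; case: p => [c|w].
    rewrite big1 => [|g _]; last by rewrite /biclique !inE !andbF.
    rewrite (bigD1 c.1) //= big1 => [|j nj]; last by rewrite /biclique !inE /= [c.1 == j]eq_sym (negPf nj) !andbF.
    by rewrite /biclique !inE /= eqxx !andbF !addn0 andbT.
  rewrite (bigD1 w.1) //= big1 => [|j nj]; last by rewrite /biclique !inE /= [w.1 == j]eq_sym (negPf nj) !andbF.
  rewrite big1 => [|g _]; last by rewrite /biclique !inE !andbF.
  by rewrite /biclique !inE /= eqxx !andbF !addn0 andbT andbC.
- move=> v y; rewrite big1 => [|g _]; last by rewrite /biclique !inE !andbF.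
  rewrite big1 => [|g _]; last by rewrite /biclique !inE !andbF.
  by rewrite /biclique !inE /= ?inE andbT ?addn0.
- split=> [p p'|p y|y y']; (rewrite big1 => [|g _]; last by rewrite /biclique !inE ?andbF);
    (rewrite big1 => [|g _]; last by rewrite /biclique !inE ?andbF);
    by rewrite /biclique !inE ?andbF.
Qed.

Lemma stars_stage : exists m : (D + (C + W + Y)) -> (D + (C + W + Y)) -> nat, [/\ decomposable adj m,
  forall u v, m (inl u) (inl v) = (arrow u v || arrow v u),
  forall v e, v != o -> m (inl v) (inr e) = 1,
  forall e, m (inl o) (inr e) <= 1 &
  forall e e', m (inr e) (inr e') <= 1].
Proof.
have [m1 [d1 g1 g2 g3 g4]] := gadgets_placed.
have [m2 [d2 r1 r2 r3 [r4 r5 r6]]] := regular_dec.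
pose al (x : T0) : D + (C + W + Y) :=
  match x with inl (inl v) => inl v | inl (inr p) => inr (inl p) | inr y => inr (inr y) end.
pose be (x : D + (C + W + Y)) : T0 :=
  match x with inl v => inl (inl v) | inr (inl p) => inl (inr p) | inr (inr y) => inr y end.
have alK : cancel al be by case=> [[v|p]|y].
have beK : cancel be al by case=> [v|[p|y]].
have cal x : x \in codom al by apply/codomP; exists (be x).
exists (fun x y => m1 (be x) (be y) + m2 (be x) (be y)); split.
- apply: (dec_pull (can_inj alK)) => [x y|x y|]; rewrite ?cal //.
  by apply: dec_ext (decD d1 d2) => x y; rewrite !alK.
- by move=> u v /=; rewrite g1 r1 pw2_DD pwS_DD !addn0.
- move=> v [p|y] vo /=; last by rewrite g2 r3 vo.
  rewrite g1 r2 vo /= pw2_DP pwS_used /lft (negPf vo) inE.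
  by have := @used_irr v p; case: (used v p) => [->|_] //; case: (irr v p).
- move=> [p|y] /=; last by rewrite g2 r3 eqxx.
  by rewrite g1 r2 eqxx addn0 pw2_DP /lft eqxx inE addn0 pwS_le1.
- move=> [p|y] [p'|y'] /=.
  + by rewrite g1 r4 pw2_PP !addn0 pwS_le1.
  + by rewrite r5 addn0 g3.
  + by rewrite (decC adj_sym _ _ d1) (decC adj_sym _ _ d2) r5 addn0 g3.
  + by rewrite r6 addn0 g4.
Qed.

End Stars.

(** Arrows go up in an order with [o] first, then the vertices of large degree, then the others. A
    vertex of large degree is entered only from [o] and its like; any other vertex has in-degree at
    most its degree, which is below [k]. *)
Lemma orientation (D : finType) (L : rel D) (o : D) m0 k :
  symmetric L -> irreflexive L ->
  #|[set v | k <= #|[set u | L v u]|]| <= m0 ->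
  exists arrow : rel D, [/\ forall u v, arrow u v -> ~~ arrow v u,
    forall v, ~~ arrow v o, forall u v, L u v = arrow u v || arrow v u &
    forall u, #|[set v | arrow v u]| <= m0 + 1 + k].
Proof.
move=> LC Lirr; set Hi := [set v | _] => hHi.
have [rk [n [rkn rk_inj]]] : exists (rk : D -> nat) n, (forall v, rk v < n) /\ injective rk.
  exists (fun v => enum_rank v : nat), #|D|; split=> [v|u v /val_inj/enum_rank_inj//].
  exact: ltn_ord.
pose rho v := if v == o then 0 else if v \in Hi then (rk v).+1 else (rk v).+1 + n.
have rho_inj : injective rho.
  move=> u v; rewrite /rho; have lu := rkn u; have lv := rkn v.
  have [->|nu] := eqVneq u o; have [->|nv] := eqVneq v o => //.
  - by case: ifP.
  - by case: ifP.
  - by case: ifP => _; case: ifP => _ e; apply: rk_inj; lia.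
exists (fun v u => L v u && (rho v < rho u)); split.
- by move=> u v /andP[_ lt]; rewrite negb_and -leqNgt (ltnW lt) orbT.
- by move=> v; rewrite /rho eqxx ltn0 andbF.
- move=> u v; rewrite (LC v u) -andb_orr; case Luv: (L u v) => //=.
  have : rho u != rho v by apply: contraTneq Luv => /rho_inj->; rewrite Lirr.
  by rewrite neq_ltn => ->.
- move=> u; have [uHi|nHi] := boolP (u \in Hi).
    apply: leq_trans (leq_addr _ _); apply: (@leq_trans #|o |: Hi|); last first.
      by rewrite cardsU1 addnC leq_add // leq_b1.
    apply/subset_leq_card/subsetP => v; rewrite inE => /andP[_]; rewrite in_setU1 /rho uHi.
    have [//|_] := eqVneq v o; have := rkn u; case: (u == o) => _; first by rewrite ltn0.
    by case: (v \in Hi) => //=; have := rkn u; lia.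
  apply: leq_trans (leq_addl _ _); move: nHi; rewrite inE -ltnNge => /ltnW; apply: leq_trans.
  by apply/subset_leq_card/subsetP => v; rewrite !inE LC => /andP[].
Qed.

Section Stage.
Variables (X : finType) (adj : rel X) (cl : X -> bool).
Hypothesis adj_sym : symmetric adj.
Hypothesis adj_cl : forall a b, adj a b -> cl a != cl b.
Variables (a0 b0 : X).
Hypothesis adj0 : adj a0 b0.
Hypothesis cl0 : cl a0.
Variable M : nat.
Hypothesis M1 : 1 < M.
Hypothesis dM : deg adj a0 %| M.
Hypothesis bipM : forall (T : finType) (A B : {set T}), [disjoint A & B] ->
  M %| #|A| -> M %| #|B| -> decomposable adj (biclique A B).

Local Notation d := (deg adj a0).
Local Notation h := #|X|.

Let d0 : 0 < d.
Proof. by apply/card_gt0P; exists b0; rewrite inE. Qed.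

Lemma stage_of_arrows K0 (D : finType) (o : D) (arrow : rel D) (a kap J s q : nat)
    (jcls : D -> 'I_J) :
  (forall r t, K0 <= r -> degsum adj t -> M %| r + t -> degsum adj r) ->
  (forall u v, arrow u v -> ~~ arrow v u) -> (forall v, ~~ arrow v o) ->
  (forall u, #|[set v | arrow v u]| <= a) ->
  (forall j, #|[set v | jcls v == j]| <= kap) ->
  (forall j, M %| #|[set v | (v != o) && (jcls v == j)]|) ->
  M %| #|[set~ o]| ->
  (forall v, exists2 t, degsum adj t & M %| #|[set u | arrow v u || arrow u v]| + t) ->
  #|D| * a < s * (s - d * maxn a kap) ->
  d * s + M <= #|[set~ o]| ->
  #|D| * a + (J * (M * (K0 + d)) + s * (M * h)) * (kap + d * s + M) +
    (h * (s + maxn a kap + (kap + d * s + M))) * (h * q) < q * q ->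
  exists (E : finType) (m : D + E -> D + E -> nat), [/\
    #|E| = J * (M * (K0 + d)) + s * (M * h) + h * (M * (h * q)), decomposable adj m,
    forall u v, m (inl u) (inl v) = (arrow u v || arrow v u),
    forall v e, v != o -> m (inl v) (inr e) = 1 &
    (forall e, m (inl o) (inr e) <= 1) /\ forall e e', m (inr e) (inr e') <= 1].
Proof.
move=> degsum_lg arrow_asym arrow_o arrow_in jcls_le jclsM cD degL many room few.
have M0 : 0 < M by apply: ltn_trans M1.
(* Each block size is the size required, times M for divisibility: K0 + d for C_j (d places for
   padding, K0 to spare), h for W_g, and h q for the heights of the grid. *)
have Kc : K0 + d <= M * (K0 + d) by rewrite leq_pmull.
have dc0 : d <= M * (K0 + d) by apply: leq_trans Kc; rewrite leq_addl.
have hQ : h <= M * h by rewrite leq_pmull.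
have [ell [ell_inj ell_surj]] : exists ell : X -> 'I_d,
    {in [set b | adj a0 b] &, injective ell} /\ forall l, exists2 b, adj a0 b & ell b = l.
  have cE : #|[set b | adj a0 b]| = #|[set: 'I_d]| by rewrite cardsT card_ord.
  have [_ h1 h2] := relabel (Ordinal d0) cE; eexists; split; first exact: h1.
  by move=> l; have [|b] := h2 l; rewrite inE // => ab eb; exists b.
pose idx (b : X) := widen_ord hQ (enum_rank b).
have idx_inj : injective idx by move=> b c /(congr1 val) /= /val_inj/enum_rank_inj.
have [chi [chi_meet chi_cap]] := chi_exists d0 o arrow_in jcls_le dc0 many.
have [U hU] := U_exists jcls dc0 chi_cap M0 arrow_o room.
have U1 g : leaves o jcls dc0 chi g \subset U g by case: (hU g).
have U2 g : U g \subset [set~ o] by case: (hU g).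
have U3 g : M %| #|U g| by case: (hU g).
have U4 g : #|U g| <= d * s + M by case: (hU g).
have Mc : M %| M * (K0 + d) by rewrite dvdn_mulr.
have MQ : M %| M * h by rewrite dvdn_mulr.
have [act [xs [nu hn]]] := gadgets_exist adj_sym adj_cl cl0 d0 ell_inj ell_surj
  arrow_asym idx_inj many chi_meet M0 Mc MQ cD room U1 Kc degsum_lg degL.
have qyq : h * q <= M * (h * q) by rewrite leq_pmull.
have Mq : M %| M * (h * q) by rewrite dvdn_mulr.
have [m [dm m1 m2 m3 m4]] := stars_stage adj_sym adj_cl cl0 d0 ell_inj ell_surj
  arrow_asym arrow_in jcls_le idx_inj chi_meet chi_cap Mc MQ cD U1 U2 U3 U4
  (fun v => let: And4 p _ _ _ := hn v in p)
  (fun v => let: And4 _ p _ _ := hn v in p)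
  (fun v => let: And4 _ _ p _ := hn v in p)
  (fun v => let: And4 _ _ _ p := hn v in p) qyq Mq few jclsM bipM.
exists _, m; split=> //.
by rewrite !card_sum !card_prod !card_ord.
Qed.

End Stage.

(** * Sublinear extension *)

(** Everything scales with s, which is about n / N: q = A s, kap is about s / (8 d), and a is at
    most s / (8 N), while R, m0 and J do not depend on n. The last bound is what makes n a small
    against s^2, and it forces R to be of order N^2. The threshold [s0] absorbs all constant
    terms. *)
Lemma stage_parameters (h d M c N0 : nat) : 0 < h -> 0 < d -> 0 < M -> 0 < N0 ->
  exists n0 m0 R J, forall n k, n0 <= n -> n.-1 = k * M ->
  exists s cap q, let a := m0 + 1 + n %/ R in let kap := cap * M + 1 in
  [/\ n * h + m0.+1 * (2 ^ m0.+1 * h) < m0.+1 * (n %/ R),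
     k < cap * J, n * a < s * (s - d * maxn a kap), d * s + M <= n.-1 &
     n * a + (J * c + s * (M * h)) * (kap + d * s + M) +
      (h * (s + maxn a kap + (kap + d * s + M))) * (h * q) < q * q /\
     (J * c + s * (M * h) + h * (M * (h * q))) * N0 <= n].
Proof.
move=> h0 d0 M0 N00.
(* q^2 = A^2 s^2 has to exceed three terms, the last of which contains q and so grows linearly with
   A; adding up all coefficients is enough. *)
pose A := 2 + (1 + M * h) * (d + 2) + h * h * (d + 4).
(* There are at most B s new vertices; N >= N0 B and N s <= n turn this into the required n / N0. *)
pose B := 1 + M * h + h * (M * (h * A)).
pose N := N0 * B + 4 * d + 4.
pose R := 32 * N * N.
(* m1 vertices of degree n / R would have about 4 n h incidences, more than [few_high] allows for
   large n. *)
pose m1 := 4 * R * h.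
pose J := 64 * d * N.
pose s0 := J * c + 16 * d * M + 16 * N * m1.+1 + 4 * R + m1 * 2 ^ m1 + 4 * M + 8 * d + 1.
have N4 : 4 * d + 4 <= N by rewrite /N -addnA leq_addl.
have NB : N0 * B <= N by rewrite /N -addnA leq_addr.
have R0 : 0 < R by rewrite /R !muln_gt0 /=; lia.
have m10 : 0 < m1 by rewrite /m1 -mulnA muln_gt0 /= lt0n muln_eq0 negb_or -!lt0n R0.
have em1 : m1.-1.+1 = m1 by rewrite prednK.
have RE : R = 32 * N * N by [].
have m1E : m1 = 4 * R * h by [].
have JE : J = 64 * d * N by [].
have i7 : 1 + (1 + M * h) * (d + 2) + h * h * (d + 4) * A < A * A.
  have : A = 2 + (1 + M * h) * (d + 2) + h * h * (d + 4) by [].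
  clearbody A; move: ((1 + M * h) * (d + 2)) (h * h * (d + 4)) => x y AE.
  have : x <= x * A by rewrite leq_pmulr // AE.
  by rewrite [X in _ < X * _]AE !mulnDl; lia.
have BE s : B * s = s + s * (M * h) + h * (M * (h * (A * s))).
  have gen z : (1 + M * h + h * (M * (h * z))) * s = s + s * (M * h) + h * (M * (h * (z * s))).
    by clear; lia.
  exact: gen.
have s0E : s0 = J * c + 16 * d * M + 16 * N * m1.+1 + 4 * R + m1 * 2 ^ m1 + 4 * M + 8 * d + 1 by [].
clearbody A B N R m1 J s0.
exists (N * s0), m1.-1, R, J => n k nn0 ek.
pose s := n %/ N; have N0' : 0 < N by lia.
have s_s0 : s0 <= s by rewrite /s leq_divRL // mulnC.
have sn : N * s <= n by rewrite /s mulnC leq_trunc_div.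
have ns : n < N * s + N by rewrite /s mulnC -mulSnr ltn_ceil.
pose w := 8 * d * M; have w0 : 0 < w by rewrite /w !muln_gt0 d0 M0.
pose cap := s %/ w.
have capl : cap * w <= s by apply: leq_trunc_div.
have capu : s < cap * w + w by rewrite -mulSnr ltn_ceil.
have kdl : n %/ R * R <= n by apply: leq_trunc_div.
have kdu : n < n %/ R * R + R by rewrite -mulSnr ltn_ceil.
exists s, cap, (A * s); rewrite em1.
have -> : m1.-1 + 1 = m1 by rewrite addn1.
clearbody s cap; move: (n %/ R) kdl kdu => kd kdl kdu.
set a := m1 + kd; set kap := cap * M + 1.
have s1 : 0 < s by lia.
have NNs : N <= N * s by rewrite leq_pmulr.
have n2 : n < 2 * (N * s) by lia.
have hJ : J * c <= s by lia.
have hM : 16 * d * M <= s by lia.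
have hm1 : 16 * N * m1.+1 <= s by lia.
have h2 : 4 * R + m1 * 2 ^ m1 <= s by lia.
have hM4 : 4 * M <= s by lia.
have hd8 : 8 * d <= s by lia.
clear s0E s_s0 nn0.
have ha : 8 * N * a <= s.
  have : N * (16 * N * kd) < N * s.
    have : kd * R = 2 * (N * (16 * N * kd)) by rewrite RE; lia.
    by lia.
  by rewrite ltn_pmul2l // /a; lia.
have hkap : 4 * (d * kap) <= s by rewrite /kap; rewrite /w in capl; lia.
have hda : 4 * (d * a) <= s.
  have : d * a <= N * a by rewrite leq_mul2r; apply/orP; right; lia.
  by lia.
have hmax : 4 * (d * maxn a kap) <= s by case: (leqP a kap).
have na : 4 * (n * a) <= s * s.
  have q1 : n * a <= 2 * (N * s) * a by rewrite leq_mul2r ltnW ?orbT.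
  have q2 : 8 * N * a * s <= s * s by rewrite leq_mul2r ha orbT.
  by lia.
have has : a <= s by apply: leq_trans ha; rewrite leq_pmull // muln_gt0.
have hks : kap <= s.
  have : kap <= d * kap by rewrite leq_pmull.
  by lia.
have hms : maxn a kap <= s by rewrite geq_max has hks.
clear hm1.
split.
- have hm : m1 * (2 ^ m1 * h) = (m1 * 2 ^ m1) * h by rewrite mulnA.
  rewrite hm; have -> : m1 * kd = (4 * (R * kd)) * h by rewrite m1E; clear; lia.
  rewrite -mulnDl ltn_pmul2r // [R * kd]mulnC.
  have sn' : s <= n by apply: leq_trans sn; rewrite leq_pmull.
  move: (m1 * 2 ^ m1) (kd * R) h2 kdu kdl => z y h2 kdu kdl; clear -h2 kdu kdl sn' s1; lia.
- have q1 : k * M < 2 * (N * s) by clear -ek n2; lia.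
  have q2 : s < 2 * (cap * w) by clear -capu hM; rewrite /w in capu *; lia.
  have e : k * M < (cap * J) * M.
    rewrite JE; have -> : cap * (64 * d * N) * M = (4 * N) * (2 * (cap * w)) by rewrite /w; clear; lia.
    apply: (@ltn_trans (4 * N * s)); last by rewrite ltn_pmul2l // muln_gt0.
    by move: NNs N0' q1; clear; lia.
  by move: e; rewrite ltn_mul2r => /andP[].
- have q1 : 3 * s <= 4 * (s - d * maxn a kap) by move: hmax; clear; lia.
  have q2 : s * (3 * s) <= s * (4 * (s - d * maxn a kap)) by rewrite leq_mul2l q1 orbT.
  have : 0 < s * s by rewrite muln_gt0 s1.
  by move: na q2; move: (s - _) => y; clear; lia.
- have q1 : (4 * d + 4) * s <= N * s by rewrite leq_mul2r N4 orbT.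
  by move: q1 sn hM4 s1; clear; lia.
- split.
    have i1 : n * a <= s * s by apply: leq_trans na; rewrite leq_pmull.
    have i2 : kap + d * s + M <= (d + 2) * s by move: hks hM4; clear; lia.
    have i3 : J * c + s * (M * h) <= (1 + M * h) * s by move: hJ; clear; lia.
    have i4 : (J * c + s * (M * h)) * (kap + d * s + M) <= ((1 + M * h) * (d + 2)) * (s * s).
      by apply: leq_trans (leq_mul i3 i2) _; clear; lia.
    have i5 : h * (s + maxn a kap + (kap + d * s + M)) <= h * ((d + 4) * s).
      by rewrite leq_mul2l; apply/orP; right; move: hms i2; clear; lia.
    have i6 : h * (s + maxn a kap + (kap + d * s + M)) * (h * (A * s)) <= (h * h * (d + 4) * A) * (s * s).
      by apply: leq_trans (leq_mul i5 (leqnn _)) _; clear; lia.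
    have i8 : 0 < s * s by rewrite muln_gt0 s1.
    have -> : A * s * (A * s) = A * A * (s * s) by clear; lia.
    apply: leq_ltn_trans (leq_add (leq_add i1 i4) i6) _.
    by rewrite -{1}[s * s]mul1n -!mulnDl ltn_pmul2r.
  have i9 : J * c + s * (M * h) + h * (M * (h * (A * s))) <= B * s by rewrite BE !leq_add2r.
  apply: leq_trans (leq_mul i9 (leqnn N0)) _; apply: leq_trans sn.
  by rewrite mulnAC [B * N0]mulnC leq_mul2r NB orbT.
Qed.

Section Stage1.
Variables (X : finType) (adj : rel X) (cl : X -> bool).
Hypothesis adj_sym : symmetric adj.
Hypothesis adj_cl : forall a b, adj a b -> cl a != cl b.
Variables (a0 b0 : X).
Hypothesis adj0 : adj a0 b0.
Hypothesis cl0 : cl a0.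
Variable M : nat.
Hypothesis M1 : 1 < M.
Hypothesis dM : deg adj a0 %| M.
Hypothesis bipM : forall (T : finType) (A B : {set T}), [disjoint A & B] ->
  M %| #|A| -> M %| #|B| -> decomposable adj (biclique A B).

Local Notation d := (deg adj a0).

Let M0 : 0 < M. Proof. by apply: ltn_trans M1. Qed.
Let d0 : 0 < d.
Proof. by apply/card_gt0P; exists b0; rewrite inE. Qed.

(** In a completion of the complement of [F], the pairs covered at [v] are its edges in [F] and all
    pairs from [v] to the vertices outside D, whose number is a multiple of M. *)
Lemma completable_deg (D : finType) (F : rel D) v : symmetric F -> irreflexive F ->
  #|D| = 1 %[mod M] -> completable adj M (fun x y => (x != y) && ~~ F x y) ->
  exists2 t, degsum adj t & exists2 z, M %| z & t = #|[set u | F v u]| + z.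
Proof.
move=> FC Fi cD [T [g [gi cT dT]]].
exists (\sum_y cmpl g (fun x y => (x != y) && ~~ F x y) (g v) y).
  exact: (degsum_dec (g v) dT).
have cG : #|g @: [set: D]| = #|D| by rewrite card_imset // cardsT.
exists #|~: (g @: [set: D])|.
  by apply: (@modn1_dvd _ _ #|D|) => //; rewrite -cG addnC cardsC.
rewrite (bigID (mem (g @: [set: D]))) /= big_imset /=; last by move=> u w _ _; apply: gi.
congr (_ + _).
  rewrite -sum1dep_card [RHS]big_mkcond; apply: eq_big => u; first by rewrite inE.
  move=> _; rewrite /cmpl img_in // (inj_eq gi) /= negb_and !negbK.
  by have [->|nvu] /= := eqVneq v u; [rewrite Fi|case: (F v u)].
rewrite -sum1_card; apply: eq_big => [y|y ny]; first by rewrite !inE.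
rewrite /cmpl img_outr; last by apply: contra ny => /codomP[u ->]; apply: imset_f.
by rewrite andbT; case: eqP ny => // <-; rewrite imset_f.
Qed.

Lemma stage1 N0 : 0 < N0 -> exists n0, forall (D : finType) (F : rel D),
  symmetric F -> irreflexive F -> #|D| = 1 %[mod M] -> n0 <= #|D| ->
  completable adj M (fun x y => (x != y) && ~~ F x y) ->
  exists (E : finType) (o : D) (m : D + E -> D + E -> nat),
  [/\ M %| #|E|, #|E| * N0 <= #|D|, decomposable adj m,
    forall u v, m (inl u) (inl v) = (u != v) && ~~ F u v &
    [/\ forall v e, v != o -> m (inl v) (inr e) = 1,
      forall e, m (inl o) (inr e) <= 1 & forall e e', m (inr e) (inr e') <= 1]].
Proof.
move=> N00; have [K0 degsum_lg] : exists K, forall r s, K <= r -> degsum adj s -> M %| r + s -> degsum adj r.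
  apply: degsum_large => //; case/dvdnP: dM => k ->.
  exact/degsum_muln/degsum_deg.
have h0 : 0 < #|X| by apply/card_gt0P; exists a0.
have c0 : 0 < M by [].
have [n0 [m0 [R [J hpar]]]] := @stage_parameters #|X| d M (M * (K0 + d)) N0 h0 d0 M0 N00.
exists n0 => D F FC Fi cD nD cmp.
have D0 : 0 < #|D| by case: #|D| cD => //; rewrite mod0n modn_small.
have /card_gt0P[o _] := D0.
have co : #|[set~ o]| = #|D|.-1 by rewrite cardsC1.
have Mco : M %| #|[set~ o]|.
  by rewrite co; apply: (@modn1_dvd _ _ 1); rewrite // addn1 prednK.
have ek : #|D|.-1 = (#|D|.-1 %/ M) * M by rewrite divnK // -co.
have [s [cap [q]]] := hpar _ _ nD ek; set a := m0 + 1 + _; set kap := cap * M + 1.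
move=> [few_h kJ many room [few bound]].
pose L x y := (x != y) && ~~ F x y.
have LC : symmetric L by move=> x y; rewrite /L eq_sym FC.
have Li : irreflexive L by move=> x; rewrite /L eqxx.
have [m' [L' [dm' frL' L'C L'i LL']]] := remove_copies adj_sym adj0 LC Li.
have [|arrow [ar1 ar2 ar3 ar4]] := @orientation D L' o m0 (#|D| %/ R) L'C L'i.
  rewrite leqNgt; apply/negP => /subset_of_size[S SH cS].
  have hS s' : s' \in S -> #|D| %/ R <= #|[set u | L' s' u]|.
    by move/(subsetP SH); rewrite inE.
  have := few_high adj_cl L'C L'i frL' hS.
  by rewrite cS leqNgt few_h.
have cA : #|[set~ o]| = #|D|.-1 %/ M * M by rewrite co.
have [jcls hj] := balanced_classes M0 cA kJ.
have je j : [set v in [set~ o] | jcls v == j] = [set v | (v != o) && (jcls v == j)].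
  by apply/setP => v; rewrite !inE.
have jM j : M %| #|[set v | (v != o) && (jcls v == j)]| by rewrite -je; case: (hj j).
(* [o] also falls into some class, whence the extra 1 in [kap]. *)
have jle j : #|[set v | jcls v == j]| <= kap.
  apply: (@leq_trans #|o |: [set v in [set~ o] | jcls v == j]|).
    apply/subset_leq_card/subsetP => v; rewrite !inE => ->; rewrite andbT.
    by case: eqP.
  by rewrite cardsU1 addnC leq_add ?leq_b1 //; case: (hj j).
(* The degrees of [v] in [L'], in the removed copies and in [F] add up to #|D| - 1, a multiple of M;
   the last two are, modulo M, sums of degrees of H. *)
have degL v : exists2 t, degsum adj t & M %| #|[set u | arrow v u || arrow u v]| + t.
  have [t dt [z Mz et]] := completable_deg v FC Fi cD cmp.
  exists (\sum_u m' v u + t); first by apply: degsumD => //; apply: degsum_dec.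
  rewrite et; have -> : #|[set u | arrow v u || arrow u v]| = #|[set u | L' v u]|.
    by apply: eq_card => u; rewrite !inE ar3.
  have sumL : #|[set u | L v u]| = \sum_u m' v u + #|[set u | L' v u]|.
    rewrite -!sum1dep_card !big_mkcond /= [X in _ + X]big_mkcond -big_split /=.
    by apply: eq_bigr => u _; have := LL' v u; case: (L v u); case: (L' v u).
  have sumD : #|[set u | L v u]| + #|[set u | F v u]| = #|D|.-1.
    have := cardsC1 v; rewrite -(cardsID [set u | F v u]) addnC => <-.
    congr (_ + _); apply: eq_card => u; rewrite !inE /L eq_sym; first by rewrite andbC.
    by case: eqP => [->|_] //=; rewrite Fi.
  have -> : #|[set u | L' v u]| + (\sum_u m' v u + (#|[set u | F v u]| + z)) =
      #|D|.-1 + z by rewrite -sumD sumL; lia.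
  by rewrite dvdn_add // -co.
rewrite -co in room.
have [E [m [cE dm m1 m2 [m3 m4]]]] := stage_of_arrows adj_sym adj_cl adj0 cl0 M1 bipM
  degsum_lg ar1 ar2 ar4 jle jM Mco degL many room few.
have dp : decomposable adj (fun x y : D + E => match x, y with inl u, inl v => m' u v | _, _ => 0 end).
  apply: (dec_pull (@inl_inj D E)) => [[u|e] y|x [u|e]|] //.
  - by rewrite codom_f.
  - by rewrite codom_f.
  - by case: x.
exists E, o, (fun x y => m x y + match x, y with inl u, inl v => m' u v | _, _ => 0 end).
split.
- by rewrite cE; do 2?[apply: dvdn_add]; rewrite mulnCA dvdn_mulr.
- by rewrite cE.
- exact: decD.
- by move=> u v; rewrite m1 -ar3 addnC -LL' /L.
- by split=> [v e vo|e|e e']; rewrite addn0; [apply: m2|apply: m3|apply: m4].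
Qed.
End Stage1.

(** * Induction on the order *)

Section Induction.
Variables (X : finType) (adj : rel X) (cl : X -> bool).
Hypothesis adj_sym : symmetric adj.
Hypothesis adj_cl : forall a b, adj a b -> cl a != cl b.
Variables (a0 b0 : X).
Hypothesis adj0 : adj a0 b0.
Hypothesis cl0 : cl a0.
Variable M : nat.
Hypothesis M1 : 1 < M.
Hypothesis dM : deg adj a0 %| M.
Hypothesis bipM : forall (T : finType) (A B : {set T}), [disjoint A & B] ->
  M %| #|A| -> M %| #|B| -> decomposable adj (biclique A B).
Hypothesis KM : forall (T : finType) (A : {set T}), #|A| = 1 %[mod M] -> decomposable adj (clique A).

Let adj_irr : irreflexive adj.
Proof. by move=> a; apply/negP => /adj_cl; rewrite eqxx. Qed.

Definition completable_in (D : finType) (F : rel D) k : Prop :=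
  exists (T : finType) (g : D -> T), [/\ injective g, #|T| = 1 %[mod M], #|T| <= k &
    decomposable adj (fun x y => nat_of_bool (cmpl g F x y))].

Lemma completable_in_le (D : finType) (F : rel D) k k' : k <= k' ->
  completable_in F k -> completable_in F k'.
Proof.
by move=> kk' [T [g [gi cT Tk dT]]]; exists T, g; split=> //; apply: leq_trans kk'.
Qed.

Lemma dec_img (D T : finType) (g : D -> T) (F : rel D) : injective g ->
  decomposable adj (fun x y => nat_of_bool (F x y)) -> decomposable adj (fun x y => nat_of_bool (img g F x y)).
Proof.
move=> gi dF; apply: (dec_pull gi) => [x y nx|x y ny|].
- by rewrite img_outl.
- by rewrite img_outr.
- by apply: dec_ext dF => x y; rewrite img_in.
Qed.

Lemma completable_in_bij (D D' : finType) (b : D -> D') (b' : D' -> D) (F : rel D) k :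
  cancel b b' -> cancel b' b ->
  completable_in F k <-> completable_in (fun x y => F (b' x) (b' y)) k.
Proof.
move=> bK b'K; split=> -[T [g [gi cT Tk dT]]].
  exists T, (g \o b'); split=> //; first exact: inj_comp (can_inj b'K).
  apply: dec_ext dT => x y; rewrite /cmpl; congr (nat_of_bool (_ && ~~ _)).
  apply/existsP/existsP => -[[u v] /= h]; first by exists (b u, b v); rewrite /= !bK.
  by exists (b' u, b' v).
exists T, (g \o b); split=> //; first exact: inj_comp (can_inj bK).
apply: dec_ext dT => x y; rewrite /cmpl; congr (nat_of_bool (_ && ~~ _)).
apply/existsP/existsP => -[[u v] /= h]; first by exists (b' u, b' v); rewrite /= !b'K.
by exists (b u, b v); rewrite /= !bK in h *.
Qed.

Lemma completable_inE (D : finType) (F : rel D) :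
  completable adj M F <-> exists k, completable_in F k.
Proof.
split=> [[T [g [gi cT dT]]]|[k [T [g [gi cT _ dT]]]]]; last by exists T, g.
by exists #|T|, T, g; split.
Qed.

(** There are finitely many graphs on ['I_n], and completions transport along bijections. The bound
    is a maximum over these graphs, with 0 for those without a completion. *)
Lemma bounded_completion n : exists C, forall (D : finType) (F : rel D), #|D| = n ->
  completable adj M F -> completable_in F C.
Proof.
pose rl (f : {ffun 'I_n * 'I_n -> bool}) : rel 'I_n := fun x y => f (x, y).
have hk f : exists k, completable adj M (rl f) -> completable_in (rl f) k.
  have [/completable_inE[k hk]|nc] := EM (completable adj M (rl f)); first by exists k.
  by exists 0.
have [k hk'] := choice hk; exists (\max_f k f) => D F cD cF.
pose b (v : D) : 'I_n := cast_ord cD (enum_rank v).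
pose b' (i : 'I_n) : D := enum_val (cast_ord (esym cD) i).
have bK : cancel b b' by move=> v; rewrite /b' /b cast_ordK enum_rankK.
have b'K : cancel b' b by move=> i; rewrite /b' /b enum_valK cast_ordKV.
apply/(completable_in_bij _ _ bK b'K).
pose f : {ffun 'I_n * 'I_n -> bool} := [ffun p => F (b' p.1) (b' p.2)].
have ef : (fun x y => F (b' x) (b' y)) = rl f.
  by apply/funext => x; apply/funext => y; rewrite /rl ffunE.
rewrite ef; apply: completable_in_le (leq_bigmax f) _; apply: hk'.
move/completable_inE: cF => [k0 ck0]; apply/completable_inE; exists k0.
by rewrite -ef; apply/(completable_in_bij _ _ bK b'K).
Qed.

Section Step.
Variables (D E : finType) (F : rel D) (o : D) (mm : rel (D + E)).
Hypothesis FC : symmetric F.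
Hypothesis Fi : irreflexive F.
Hypothesis cD : #|D| = 1 %[mod M].
Hypothesis cE : M %| #|E|.
Hypothesis dmm : decomposable adj (fun x y => nat_of_bool (mm x y)).
Hypothesis mmDD : forall u v, mm (inl u) (inl v) = (u != v) && ~~ F u v.
Hypothesis mmDE : forall v e, v != o -> mm (inl v) (inr e).

Let mmC x y : mm x y = mm y x.
Proof. by have := decC adj_sym x y dmm; case: (mm x y); case: (mm y x). Qed.

Let mmxx x : mm x x = false.
Proof. by have := decxx adj_irr x dmm; case: (mm x x). Qed.

(** [None] stands for [o]. The relation [rest] on this core consists of the pairs already covered,
    and takes the place of [F] in the next round. *)
Definition core_vertex (x : option E) : D + E := if x is Some e then inr e else inl o.
Definition rest : rel (option E) := fun x y => mm (core_vertex x) (core_vertex y).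

Lemma rest_sym : symmetric rest.
Proof. by move=> x y; rewrite /rest mmC. Qed.

Lemma rest_irr : irreflexive rest.
Proof. by move=> x; rewrite /rest mmxx. Qed.

(** Writing K_oE for the complete graph on the core, K_(T+E) - (K_oE - rest) is the disjoint union
    of K_T - (K_D - F), the graph [mm], and the complete bipartite graph between T - D and E. *)
Lemma rest_completable : completable adj M (fun x y => (x != y) && ~~ F x y) ->
  completable adj M (fun x y => (x != y) && ~~ rest x y).
Proof.
move=> [T [g [gi cT dT]]].
pose g2 (x : option E) : T + E := if x is Some e then inr e else inl (g o).
have g2i : injective g2 by move=> [e|] [e'|] // [->].
pose ga (x : D + E) : T + E := match x with inl v => inl (g v) | inr e => inr e end.
have gai : injective ga by move=> [v|e] [v'|e'] //= [] => [/gi->|->].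
exists (T + E)%type, g2; split=> //.
  by rewrite card_sum -modnDmr (eqP cE) addn0.
pose S : {set T + E} := [set x | if x is inl t then t \notin codom g else false].
pose EE : {set T + E} := [set x | if x is inr _ then true else false].
have dS : decomposable adj (biclique S EE).
  apply: bipM.
  - by rewrite -setI_eq0; apply/eqP/setP => -[t|e]; rewrite !inE ?andbF.
  - have -> : #|S| = #|~: (g @: [set: D])|.
      rewrite -(card_imset _ (@inl_inj T E)); apply: eq_card => -[t|e]; rewrite !inE.
        apply/idP/imsetP => [nt|[t' + [->]]].
          exists t => //; rewrite inE; apply: contra nt => /imsetP[v _ ->]; exact: codom_f.
        by rewrite inE; apply: contra => /codomP[v ->]; apply: imset_f.
      by apply/esym/negP => /imsetP[].
    apply: (@modn1_dvd _ _ #|D|) => //.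
    by rewrite addnC -[#|D|]cardsT -(card_imset _ gi) cardsC.
  - suff -> : #|EE| = #|E| by [].
    rewrite -[RHS]cardsT -(card_imset _ (@inr_inj T E)); apply: eq_card => -[t|e]; rewrite !inE.
      by apply/esym/negP => /imsetP[].
    by rewrite imset_f.
have d1 := dec_img (@inl_inj T E) dT.
have d2 := dec_img gai dmm.
apply: dec_ext (decD (decD d1 d2) dS) => x y.
have nl t : t \notin codom g -> inl t \notin codom ga.
  by apply: contra => /codomP[[v|e] //= [->]]; apply: codom_f.
have nr e : inr e \notin codom (@inl T E) by apply/codomP => -[].
have nT t : t != g o -> inl t \notin codom g2.
  by move=> nt; apply/codomP => -[[e|] //= [e]]; rewrite e eqxx in nt.
have eT t e : (cmpl g2 (fun x y => (x != y) && ~~ rest x y) (inl t) (inr e) : nat) =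
    img (@inl T E) (cmpl g (fun x y => (x != y) && ~~ F x y)) (inl t) (inr e) +
    img ga mm (inl t) (inr e) + biclique S EE (inl t) (inr e).
  rewrite (img_outr _ _ (nr e)) add0n /cmpl /biclique !inE andbT /= addn0.
  have [/codomP[v ->]|nt] := boolP (t \in codom g); last first.
    rewrite (img_outl _ _ (nl _ nt)) (img_outl _ _ (nT _ _)) //.
    by apply: contraNneq nt => ->; apply: codom_f.
  rewrite (_ : inl (g v) = ga (inl v)) // (_ : inr e = ga (inr e)) // (img_in _ gai) addn0.
  have [->|nv] := eqVneq v o.
    rewrite (_ : ga (inl o) = g2 None) // (_ : ga (inr e) = g2 (Some e)) // (img_in _ g2i) /=.
    by rewrite negbK.
  by rewrite img_outl ?mmDE //= nT // (inj_eq gi).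
case: x y => [t|e] [t'|e'].
- rewrite (img_in _ (@inl_inj T E)) /biclique !inE andbF addn0 /cmpl (inj_eq inl_inj).
  have -> : img g2 (fun x y => (x != y) && ~~ rest x y) (inl t) (inl t') = false.
    by rewrite /img; apply/existsP => -[[u v] /= /and3P[]]; case: u v => [e|] [e'|].
  rewrite andbT; have -> : img ga mm (inl t) (inl t') = img g (fun x y => (x != y) && ~~ F x y) t t'.
    have [/codomP[v ->]|nt] := boolP (t \in codom g); last first.
      by rewrite !img_outl // nl.
    have [/codomP[v' ->]|nt'] := boolP (t' \in codom g); last first.
      by rewrite !img_outr // nl.
    rewrite (_ : inl (g v) = ga (inl v)) // (_ : inl (g v') = ga (inl v')) //.
    by rewrite !img_in // mmDD.
  have [<-|ntt] /= := eqVneq t t'; last by case: (img _ _ _ _).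
  have -> // : img g (fun x y => (x != y) && ~~ F x y) t t = false.
  rewrite /img; apply/existsP => -[[u v] /= /and3P[/eqP eu /eqP ev]].
  have euv : u = v by apply: gi; rewrite eu ev.
  by rewrite euv eqxx.
- by rewrite -eT.
- rewrite (decC adj_sym _ _ (decD (decD d1 d2) dS)) -eT /cmpl eq_sym; congr (nat_of_bool (_ && ~~ _)).
  rewrite /img; apply/existsP/existsP => -[[u v] /= /and3P[h1 h2 h3]]; exists (v, u) => /=;
    by rewrite h1 h2 eq_sym rest_sym.
- rewrite (img_outl _ _ (nr e)) add0n /biclique !inE /= addn0.
  rewrite (_ : inr e = g2 (Some e)) // (_ : inr e' = g2 (Some e')) // /cmpl (img_in _ g2i) (inj_eq g2i).
  rewrite (_ : g2 (Some e) = ga (inr e)) // (_ : g2 (Some e') = ga (inr e')) // (img_in _ gai).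
  have [[->]|nee] := eqVneq (Some e) (Some e'); first by rewrite mmxx.
  by rewrite addn0 /rest /= negbK.
Qed.

(** With T now completing the core and D0 = D - o, the graph K_(D0+T) - F is the disjoint union of
    K_T - rest, the graph [mm], and the complete bipartite graph between D0 and the vertices of T
    outside the core. *)
Lemma step_completable k : completable_in rest k -> completable_in F (#|D|.-1 + k).
Proof.
move=> [T [g [gi cT Tk dT]]].
pose D0 := {v : D | v != o}.
pose g3 (v : D) : D0 + T := if insub v is Some w then inl w else inr (g None).
have g3o : g3 o = inr (g None) by rewrite /g3 insubF ?eqxx.
have g3w (w : D0) : g3 (val w) = inl w by rewrite /g3 valK.
have g3v v : v != o -> exists w : D0, val w = v by move=> nv; exists (Sub v nv); rewrite SubK.
have g3i : injective g3.
  move=> u v; have [->|/g3v[w <-]] := eqVneq u o; have [->|/g3v[w' <-]] := eqVneq v o => //.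
  - by rewrite g3o g3w.
  - by rewrite g3o g3w.
  - by rewrite !g3w => -[->].
pose ga (x : D + E) : D0 + T := match x with inl v => g3 v | inr e => inr (g (Some e)) end.
have gai : injective ga.
  move=> [v|e] [v'|e'] //=; first by move/g3i->.
  - have [->|/g3v[w <-]] := eqVneq v o; last by rewrite g3w.
    by rewrite g3o => -[/gi].
  - have [->|/g3v[w <-]] := eqVneq v' o; last by rewrite g3w.
    by rewrite g3o => -[/gi].
  - by move=> [/gi[->]].
have cD0 : #|{: D0}| = #|D|.-1 by rewrite card_sig cardC1.
have Dgt0 : 0 < #|D| by apply/card_gt0P; exists o.
have MD0 : M %| #|D|.-1 by apply: (@modn1_dvd _ _ 1); rewrite // addn1 prednK.
exists (D0 + T)%type, g3; split=> //.
- by rewrite card_sum cD0 -modnDml (eqP MD0) add0n.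
- by rewrite card_sum cD0 leq_add2l.
pose S : {set D0 + T} := [set x | if x is inl _ then true else false].
pose R : {set D0 + T} := [set x | if x is inr t then t \notin codom g else false].
have dS : decomposable adj (biclique S R).
  apply: bipM.
  - by rewrite -setI_eq0; apply/eqP/setP => -[t|e]; rewrite !inE ?andbF.
  - suff -> : #|S| = #|D|.-1 by [].
    rewrite -cD0 -[RHS]cardsT -(card_imset _ (@inl_inj D0 T)); apply: eq_card => -[t|e]; rewrite !inE.
      by rewrite imset_f.
    by apply/esym/negP => /imsetP[].
  - have -> : #|R| = #|~: (g @: [set: option E])|.
      rewrite -(card_imset _ (@inr_inj D0 T)); apply: eq_card => -[e|t]; rewrite !inE.
        by apply/esym/negP => /imsetP[].
      apply/idP/imsetP => [nt|[t' + [->]]].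
        exists t => //; rewrite inE; apply: contra nt => /imsetP[v _ ->]; exact: codom_f.
      by rewrite inE; apply: contra => /codomP[v ->]; apply: imset_f.
    apply: (@modn1_dvd _ _ #|{: option E}|).
      by rewrite card_option modn_succ1.
    by rewrite addnC -[#|{: option E}|]cardsT -(card_imset _ gi) cardsC.
have d1 := dec_img (@inr_inj D0 T) dT.
have d2 := dec_img gai dmm.
apply: dec_ext (decD (decD d1 d2) dS) => x y.
have nl w : inl w \notin codom (@inr D0 T) by apply/codomP => -[].
have nr t : t != g None -> inr t \notin codom g3.
  move=> nt; apply/codomP => -[v]; have [->|/g3v[w <-]] := eqVneq v o.
    by rewrite g3o => -[e]; rewrite e eqxx in nt.
  by rewrite g3w.
have nga t : t \notin codom g -> inr t \notin codom ga.
  move=> nt; apply/codomP => -[[v|e] /=]; last by move=> [e']; rewrite e' codom_f in nt.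
  have [->|/g3v[w <-]] := eqVneq v o; last by rewrite g3w.
  by rewrite g3o => -[e']; rewrite e' codom_f in nt.
have gw (w : D0) : inl w = ga (inl (val w)) by rewrite /= g3w.
have gN : inr (g None) = ga (inl o) by rewrite /= g3o.
have eT w t : (cmpl g3 F (inl w) (inr t) : nat) =
    img (@inr D0 T) (cmpl g rest) (inl w) (inr t) + img ga mm (inl w) (inr t) + biclique S R (inl w) (inr t).
  rewrite (img_outl _ _ (nl w)) add0n /cmpl /biclique !inE /= addn0.
  have [/codomP[[e|] ->]|nt] := boolP (t \in codom g).
  - rewrite {2}gw (_ : inr (g (Some e)) = ga (inr e)) // (img_in _ gai) mmDE ?(valP w) // addn0.
    by rewrite img_outr // nr // (inj_eq gi).
  - rewrite gN gw !(img_in _ gai) mmDD (valP w) addn0 /= -[g3 o]/(ga (inl o)).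
    by rewrite -[g3 (val w)]/(g3 (val w)) (img_in _ g3i).
  - rewrite (img_outr _ _ (nga _ nt)) img_outr // nr //.
    by apply: contraNneq nt => ->; apply: codom_f.
case: x y => [w|t] [w'|t'].
- rewrite (img_outl _ _ (nl w)) add0n /biclique !inE /= addn0 !gw (img_in _ gai) mmDD /cmpl /= (inj_eq g3i) (img_in _ g3i).
  by rewrite addn0.
- by rewrite -eT.
- rewrite (decC adj_sym _ _ (decD (decD d1 d2) dS)) -eT /cmpl eq_sym; congr (nat_of_bool (_ && ~~ _)).
  rewrite /img; apply/existsP/existsP => -[[u v] /= /and3P[h1 h2 h3]]; exists (v, u) => /=;
    by rewrite h1 h2 FC.
- rewrite (img_in _ (@inr_inj D0 T)) /biclique !inE andbF /= addn0 /cmpl (inj_eq inr_inj).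
  have -> : img g3 F (inr t) (inr t') = false.
    rewrite /img; apply/existsP => -[[u v] /= /and3P[]].
    have [->|/g3v[z <-]] := eqVneq u o; last by rewrite g3w.
    have [->|/g3v[z' <-]] := eqVneq v o; last by rewrite g3w.
    by rewrite Fi.
  rewrite andbT.
  have -> : img ga mm (inr t) (inr t') = img g rest t t'.
    have gE e : inr (g e) = ga (core_vertex e) by case: e.
    have [/codomP[e ->]|nt] := boolP (t \in codom g); last by rewrite !img_outl // nga.
    have [/codomP[e' ->]|nt'] := boolP (t' \in codom g); last by rewrite !img_outr // nga.
    by rewrite !gE !img_in.
  have [<-|ntt] /= := eqVneq t t'; last by case: (img _ _ _ _).
  have -> // : img g rest t t = false.
  rewrite /img; apply/existsP => -[[u v] /= /and3P[/eqP eu /eqP ev]].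
  have euv : u = v by apply: gi; rewrite eu ev.
  by rewrite euv rest_irr.
Qed.
End Step.

(** The inequality is multiplied by N0 to avoid division. In a round, N0 |E| <= |D|, and 2 (|E| + 1)
    <= |D| because N0 and |D| are at least 4; so the term 2 |D| reproduces itself. *)
Lemma completion_bound N0 : 4 <= N0 -> exists C, forall (D : finType) (F : rel D),
  symmetric F -> irreflexive F -> #|D| = 1 %[mod M] ->
  completable adj M (fun x y => (x != y) && ~~ F x y) ->
  exists2 k, completable_in F k & N0 * k <= N0 * (#|D| + C) + 2 * #|D|.
Proof.
move=> N04; have N0' : 0 < N0 by apply: leq_trans N04.
have [n0 hst] := stage1 adj_sym adj_cl adj0 cl0 M1 dM bipM N0'.
have [Cn hCn] := choice bounded_completion.
exists (\max_(n < n0 + 4) Cn n) => D F; have [z] := ubnP #|D|.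
elim: z D F => // z IH D F; rewrite ltnS => Dz FC Fi cD cF.
(* Below the threshold this turns the hypothesis on the complement into a completion of [F]
   itself. *)
have cF' := completable_compl adj_sym adj_cl adj0 M1 bipM KM FC Fi cD cF.
have [lt|ge] := ltnP #|D| (n0 + 4).
  exists (Cn #|D|); first exact: hCn.
  apply: leq_trans (leq_addr _ _); rewrite leq_mul2l; apply/orP; right.
  by apply: leq_trans (leq_addl _ _); apply: (leq_bigmax (Ordinal lt)).
have nD : n0 <= #|D| by apply: leq_trans ge; apply: leq_addr.
have D4 : 4 <= #|D| by apply: leq_trans ge; apply: leq_addl.
have [E [o [m [cE EN dm m1 [m2 m3 m4]]]]] := hst D F FC Fi cD nD cF.
pose mm : rel (D + E) := fun x y => 0 < m x y.
have mmE x y : m x y = mm x y.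
  have le1 x' y' : m x' y' <= 1 -> m x' y' = (0 < m x' y') by case: (m _ _) => [|[]].
  case: x y => [u|e] [v|e'].
  - by rewrite /mm m1; case: (_ && _).
  - by apply: le1; have [->|nu] := eqVneq u o; [exact: m3|rewrite m2].
  - by apply: le1; rewrite (decC adj_sym _ _ dm); have [->|nu] := eqVneq v o; [exact: m3|rewrite m2].
  - exact: le1.
have dmm : decomposable adj (fun x y => nat_of_bool (mm x y)) by apply: dec_ext dm => x y; rewrite mmE.
have mmDD u v : mm (inl u) (inl v) = (u != v) && ~~ F u v by rewrite /mm m1; case: (_ && _).
have mmDE v e : v != o -> mm (inl v) (inr e) by move=> vo; rewrite /mm m2.
have cr := rest_completable cD cE dmm mmDD mmDE cF.
have EN4 : #|E| * 4 <= #|D| by apply: leq_trans EN; rewrite leq_mul2l N04 orbT.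
have lt : #|{: option E}| < z by rewrite card_option; lia.
have cO : #|{: option E}| = 1 %[mod M] by rewrite card_option modn_succ1.
have [k ck Nk] := IH _ _ lt (rest_sym o dmm) (rest_irr o dmm) cO cr.
exists (#|D|.-1 + k); first exact: (step_completable FC Fi cD cE dmm mmDD mmDE).
move: Nk; rewrite card_option [N0 * (_ + k)]mulnDr; set C := \max_(_ < _) _.
have -> : N0 * (#|D| + C) = N0 * #|D|.-1 + (N0 + N0 * C).
  by rewrite -{1}(prednK (leq_trans _ D4 : 0 < #|D|)) // addSn mulnS !mulnDr; lia.
have -> : N0 * (#|E|.+1 + C) = N0 + #|E| * N0 + N0 * C by rewrite addSn mulnS mulnDr; lia.
lia.
Qed.

End Induction.

(** * Packings and designs *)

Section Translation.
Variables (U : finType) (H : sgraph U).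
Hypothesis H_bip : bipartite H.
Hypothesis H_edge : 0 < #|eset H|.

(** H may occupy only part of [U]; with its vertices as a type, embeddings are plainly injective
    maps. *)
Definition vert := {x : U | x \in vset H}.
Definition vadj : rel vert := fun x y => [set val x; val y] \in eset H.

Lemma esetP (T : finType) (G : sgraph T) e : e \in eset G -> e \subset vset G /\ #|e| = 2.
Proof.
by move=> eG; have := subsetP (sgvalP G) e eG; rewrite inE => /andP[-> /eqP].
Qed.

Lemma vadj_sym : symmetric vadj.
Proof. by move=> x y; rewrite /vadj setUC. Qed.

Lemma eset_vadj e : e \in eset H -> exists a b : vert, vadj a b /\ e = [set val a; val b].
Proof.
move=> eH; have [es /eqP/cards2P[x [y [xy eE]]]] := esetP eH.
have xv : x \in vset H by apply: (subsetP es); rewrite eE !inE eqxx.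
have yv : y \in vset H by apply: (subsetP es); rewrite eE !inE eqxx orbT.
by exists (Sub x xv), (Sub y yv); rewrite /vadj !SubK -eE.
Qed.

Lemma vadj_colouring : exists cl : vert -> bool,
  (forall a b, vadj a b -> cl a != cl b) /\ exists a b, vadj a b /\ cl a.
Proof.
have [A [B [AB AB0 h]]] := H_bip; exists (fun x => val x \in A).
have hc a b : vadj a b -> (val a \in A) != (val b \in A).
  move=> ab; have [h1 h2] := h _ ab; have [_ c2] := esetP ab.
  case aA: (val a \in A); case bA: (val b \in A) => //.
    move: h1; rewrite (_ : _ :&: A = [set val a; val b]) ?c2 //.
    by apply/setIidPl/subsetP => z; rewrite !inE => /orP[/eqP->|/eqP->].
  move: h1; rewrite (_ : _ :&: A = set0) ?cards0 //.
  by apply/setP => z; rewrite !inE; apply/negP => /andP[/orP[/eqP->|/eqP->]]; rewrite ?aA ?bA.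
split=> //; have /card_gt0P[e eH] := H_edge.
have [a [b [ab _]]] := eset_vadj eH; have := hc a b ab.
case aA: (val a \in A) => nb; first by exists a, b.
by exists b, a; rewrite vadj_sym; split=> //; move: nb; case: (_ \in A).
Qed.

Lemma copy_exists (T : finType) (f : U -> T) : {in vset H &, injective f} ->
  exists G : sgraph T, maps_onto f H G.
Proof.
move=> fi; pose v : {set T} * {set {set T}} := ((f @: vset H), [set f @: e | e : {set U} in eset H]).
have vP : v.2 \subset pairs v.1.
  apply/subsetP => _ /imsetP[e eH ->]; have [es ec] := esetP eH.
  rewrite inE imsetS //= card_in_imset ?ec // => x y xe ye; apply: fi;
  exact: (subsetP es).
by exists (SGraph vP).
Qed.

Lemma copy_edge (T : finType) (f : U -> T) (G : sgraph T) x y : maps_onto f H G ->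
  {in vset H &, injective f} -> x != y ->
  ([set x; y] \in eset G) = (0 < wt vadj (fun a : vert => f (val a)) x y).
Proof.
move=> [_ ->] fi nxy; apply/imsetP/wt_gt0P => [[e eH exy]|[a [b [ab <- <-]]]]; last first.
  by exists [set val a; val b] => //; rewrite imsetU1 imset_set1.
have [a [b [ab ee]]] := eset_vadj eH; rewrite ee imsetU1 imset_set1 in exy.
have xs : x \in [set f (val a); f (val b)] by rewrite -exy !inE eqxx.
have ys : y \in [set f (val a); f (val b)] by rewrite -exy !inE eqxx orbT.
move: xs ys; rewrite !inE => /orP[/eqP ex|/eqP ex] /orP[/eqP ey|/eqP ey].
- by rewrite ex ey eqxx in nxy.
- by exists a, b.
- by exists b, a; rewrite vadj_sym.
- by rewrite ex ey eqxx in nxy.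
Qed.

Lemma wt_val_inj (T : eqType) (f : U -> T) : {in vset H &, injective f} ->
  injective (fun a : vert => f (val a)).
Proof. by move=> fi a b e; apply/val_inj/fi; rewrite ?(valP a) ?(valP b). Qed.

Lemma design_of_family (T K : finType) (h : K -> U -> T) (G : K -> sgraph T) :
  (forall k, {in vset H &, injective (h k)}) -> (forall k, maps_onto (h k) H (G k)) ->
  (forall x y, \sum_k wt vadj (fun a : vert => h k (val a)) x y = (x != y)) ->
  design H [set G k | k : K].
Proof.
move=> hi hG hs; split; first split.
- by move=> _ /imsetP[k _ ->]; exists (h k).
- move=> _ _ /imsetP[k _ ->] /imsetP[k' _ ->] nkk.
  rewrite -setI_eq0; apply/eqP/setP => e; rewrite !inE; apply/negP => /andP[ek ek'].
  have [_ /eqP/cards2P[x [y [xy eE]]]] := esetP ek.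
  rewrite eE !(copy_edge (hG _)) // in ek ek'.
  have := hs x y; rewrite xy (bigD1 k) //= (bigD1 k') /=; last by apply: contraNneq nkk => ->.
  rewrite addnA => /eqP; rewrite eqn_leq => /andP[+ _]; apply/negP; rewrite -ltnNge.
  by apply: leq_trans (leq_addr _ _); apply: leq_add ek ek'.
- apply/setP => e; apply/bigcupP/idP => [[_ /imsetP[k _ ->] /esetP[_ ec]]|].
    by rewrite inE ec eqxx subsetT.
  rewrite inE => /andP[_ /cards2P[x [y [xy eE]]]].
  have := hs x y; rewrite xy => s1.
  have : \sum_k wt vadj (fun a : vert => h k (val a)) x y != 0 by rewrite s1.
  rewrite sum_nat_eq0 => /forallPn[k]; rewrite -lt0n -(copy_edge (hG k)) // => ek.
  by exists (G k); rewrite ?eE // imset_f.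
Qed.

Lemma maps_onto_comp (V T : finType) (f : U -> V) (i : V -> T) (A : sgraph V) (G : sgraph T) :
  maps_onto f H A -> maps_onto (i \o f) H G -> maps_onto i A G.
Proof.
move=> [vA eA] [vG eG]; split; first by rewrite vG vA imset_comp.
rewrite eG eA; apply/setP => e; apply/imsetP/imsetP => [[e' eH ->]|[_ /imsetP[e' eH ->] ->]].
  by exists (f @: e'); [apply: imset_f|rewrite imset_comp].
by exists e' => //; rewrite imset_comp.
Qed.

Lemma completion_exists : exists c1, forall N0, 4 <= N0 -> exists C, forall n (V : finType)
    (P : {set sgraph V}), #|V| = n -> packing H P ->
  exists V' : finType, N0 * #|V'| <= N0 * (n + c1 + C) + 2 * (n + c1) /\ completed V' H P.
Proof.
have [cl [adj_cl [a0 [b0 [adj0 cl0]]]]] := vadj_colouring.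
have d0 : 0 < deg vadj a0 by apply/card_gt0P; exists b0; rewrite inE.
have [M [M1 dM bipM KM]] := exists_modulus vadj_sym adj_cl adj0 cl0 d0.
exists M.+1 => N0 N04.
have [C hC] := completion_bound vadj_sym adj_cl adj0 cl0 M1 dM bipM KM N04.
exists C => n V P cV [isoP disP].
(* Isolated vertices are added to bring the order to 1 modulo M. *)
pose D := (V + 'I_(M - n %% M).+1)%type.
have M0 : 0 < M by apply: ltn_trans M1.
have cD : #|{: D}| = 1 %[mod M].
  rewrite card_sum card_ord cV -addn1 addnA {1}(divn_eq n M) -[_ + n %% M + _]addnA.
  rewrite subnKC; last by rewrite ltnW // ltn_mod.
  by rewrite -addnA modnMDl modnDl.
have Dle : #|{: D}| <= n + M.+1 by rewrite card_sum card_ord cV leq_add2l ltnS leq_subr.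
pose PI := {A : sgraph V | A \in P}.
have hf (A : PI) : exists f : U -> V, {in vset H &, injective f} /\ maps_onto f H (val A).
  by apply: isoP; apply: valP.
have [f hf'] := choice hf.
have fi A : {in vset H &, injective (f A)} by case: (hf' A).
have fm A : maps_onto (f A) H (val A) by case: (hf' A).
pose F : rel D := fun x y => match x, y with
  | inl u, inl v => (u != v) && [exists A : PI, [set u; v] \in eset (val A)]
  | _, _ => false end.
have FC : symmetric F.
  move=> [u|u] [v|v] //=; rewrite eq_sym; congr (_ && _).
  by apply: eq_existsb => A; rewrite setUC.
have Fi : irreflexive F by move=> [u|u] //=; rewrite eqxx.
pose phi (A : PI) (a : vert) : D := inl (f A (val a)).
have phii A : injective (phi A) by move=> a b [/(wt_val_inj (@fi A))].
have vneq a b : vadj a b -> a != b by move=> ab; apply: contraTneq (adj_cl _ _ ab) => ->; rewrite eqxx.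
have sumF x y : \sum_A wt vadj (phi A) x y = F x y.
  apply: sum_wt_rel => //.
  - move=> A a b ab /=; have nab : f A (val a) != f A (val b).
      by apply: contra (vneq _ _ ab) => /eqP/(wt_val_inj (@fi A))->.
    rewrite nab /=; apply/existsP; exists A.
    rewrite (copy_edge (fm A) (@fi A) nab); apply/wt_gt0P.
    by exists a, b.
  - move=> [u|//] [v|//] /= /andP[nuv /existsP[A]].
    rewrite (copy_edge (fm A) (@fi A) nuv) => /wt_gt0P[a [b [ab <- <-]]].
    by exists A, a, b.
  - move=> A a b A' a' b' ab ab' [ea] [eb].
    have nab : f A (val a) != f A (val b).
      by apply: contra (vneq _ _ ab) => /eqP/(wt_val_inj (@fi A))->.
    have e1 : [set f A (val a); f A (val b)] \in eset (val A).
      rewrite (copy_edge (fm A) (@fi A) nab); apply/wt_gt0P; by exists a, b.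
    have e2 : [set f A (val a); f A (val b)] \in eset (val A').
      rewrite (copy_edge (fm A') (@fi A') nab); apply/wt_gt0P.
      by exists a', b'; rewrite -ea -eb.
    apply/val_inj/eqP; apply: contraT => nAA.
    have := disP _ _ (valP A) (valP A') nAA.
    by move=> /disjointFr/(_ e1); rewrite e2.
have dF : decomposable vadj (fun x y => nat_of_bool (F x y)).
  by exists PI, phi; split=> // x y; rewrite sumF.
(* The induction starts for free: on D itself, what remains outside the complement of [F] is the
   packing. *)
have cF : completable vadj M (fun x y => (x != y) && ~~ F x y).
  exists D, id; split=> //; apply: dec_ext dF => x y.
  rewrite /cmpl -[X in img _ _ X _]/(id x) -[X in img _ _ _ X]/(id y) img_in //.
  by have [->|nxy] /= := eqVneq x y; rewrite ?Fi // negbK.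
have [k [T [g [gi _ Tk [J [psi [psii psiE]]]]]] kb] := hC D F FC Fi cD cF.
exists T; split.
  apply: leq_trans (leq_trans (_ : N0 * #|T| <= N0 * k) kb) _; first by rewrite leq_mul2l Tk orbT.
  by rewrite leq_add // leq_mul2l ?leq_add2r Dle orbT.
(* [isomorphic] wants a map on all of [U]; off the vertices of H the value at [a0] is taken. *)
pose h (i : PI + J) : U -> T := match i with
  | inl A => fun u => g (inl (f A u))
  | inr j => fun u => psi j (insubd a0 u) end.
have hi i : {in vset H &, injective (h i)}.
  case: i => [A|j] u v uH vH /=; first by move=> /gi[]; apply: fi.
  move=> /psii/(congr1 val); rewrite !val_insubd uH vH.
  by [].
have [G hG] := choice (fun i => copy_exists (@hi i)).
exists (fun v => g (inl v)), [set G i | i : PI + J]; split.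
- by move=> u v /gi[].
- apply: (design_of_family hi hG) => x y; rewrite big_sumType /=.
  have -> : \sum_(j : J) wt vadj (fun a : vert => psi j (insubd a0 (val a))) x y = cmpl g F x y.
    rewrite psiE; apply: eq_bigr => j _; apply: eq_bigr => p _; rewrite !valKd.
    by [].
  have -> : \sum_(A : PI) wt vadj (fun a : vert => g (inl (f A (val a)))) x y = img g F x y.
    have [/codomP[u ->]|nx] := boolP (x \in codom g); last first.
      rewrite img_outl // big1 // => A _; apply: wt_eq0 => a b _ e _.
      by rewrite -e codom_f in nx.
    have [/codomP[v ->]|ny] := boolP (y \in codom g); last first.
      rewrite img_outr // big1 // => A _; apply: wt_eq0 => a b _ _ e.
      by rewrite -e codom_f in ny.
    rewrite img_in // -sumF; apply: eq_bigr => A _.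
    exact: (wt_comp vadj (phi A) u v gi).
  rewrite /cmpl; have [->|nxy] := eqVneq x y; last by case: (img _ _ _ _).
  rewrite addn0; apply/eqP; rewrite eqb0 /img; apply/existsP => -[[u v] /= /and3P[/eqP eu /eqP ev]].
  have euv : u = v by apply: gi; rewrite eu ev.
  by rewrite euv Fi.
- move=> A AP; pose A' : PI := Sub A AP; exists (G (inl A')); first exact: imset_f.
  have := fm A'; rewrite SubK => fA.
  exact: (maps_onto_comp (i := fun v => g (inl v)) fA (hG (inl A'))).
Qed.

End Translation.

(* From a bound for every N0 to o(n) *)
From mathcomp Require Import classical_sets reals topology normedtype landau.
Import Order.TTheory GRing.Theory Num.Theory.
Import numFieldNormedType.Exports.
Local Open Scope ring_scope.
Local Open Scope classical_set_scope.

Definition completes_within (U : finType) (H : sgraph U) (n k : nat) : Prop :=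
  forall (V : finType) (P : {set sgraph V}), #|V| = n -> packing H P ->
  exists V' : finType, (#|V'| <= n + k)%N /\ completed V' H P.

(** Neither [c1] nor the property of [k] involves N0. The least [k] therefore satisfies the bounds
    for all N0 at once, which is what makes a single function sublinear. *)
Lemma completes_within_sublinear (U : finType) (H : sgraph U) :
  bipartite H -> (0 < #|eset H|)%N ->
  exists c1, forall N0, (4 <= N0)%N -> exists C, forall n,
  exists2 k, completes_within H n k & (N0 * k <= N0 * (c1 + C) + 2 * (n + c1))%N.
Proof.
move=> Hb He; have [c1 hc] := completion_exists Hb He; exists c1 => N0 N04.
have [C hC] := hc N0 N04; exists C => n.
pose B := (N0 * (n + c1 + C) + 2 * (n + c1))%N.
have N00 : (0 < N0)%N by apply: leq_trans N04.
have nB : (n <= B %/ N0)%N by rewrite leq_divRL // /B; nia.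
exists (B %/ N0 - n)%N => [V P cV pP|].
  have [V' [cV' co]] := hC n V P cV pP; exists V'; split=> //.
  by rewrite subnKC // leq_divRL // mulnC.
rewrite mulnBr leq_subLR mulnC; apply: leq_trans (leq_trunc_div _ _) _.
by rewrite /B !mulnDr; lia.
Qed.

Theorem theorem1 (R : realType) (U : finType) (H : sgraph U)
    (H_bip : bipartite H) (H_edge : (0 < #|eset H|)%N) :
  exists f : nat -> R,
    f =o_\oo (fun n : nat => n%:R : R) /\
    forall (n : nat) (V : finType) (P : {set (sgraph V)}),
      #|V| = n -> packing H P ->
      exists V' : finType,
        #|V'|%:R <= n%:R + f n /\ completed V' H P.
Proof.
have [c1 hc] := completes_within_sublinear H_bip H_edge.
have ex n : exists k, `[< completes_within H n k >].
  have [C hC] := hc 4%N isT; have [k ck _] := hC n.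
  by exists k; apply/asboolP.
pose f n := ex_minn (ex n); exists (fun n => (f n)%:R); split; last first.
  move=> n V P cV pP; have : completes_within H n (f n).
    by rewrite /f; case: ex_minnP => k /asboolP.
  by move=> /(_ V P cV pP) [V' [cV' co]]; exists V'; rewrite -natrD ler_nat.
apply/eqoP => eps eps0.
(* Half of eps n pays for the term 2 n / N0, by eps N0 >= 4, and the other half for the constant
   [c2], once n >= 2 c2 / eps. *)
have [N0 hN0] : exists N0 : nat, 4 <= eps * N0%:R /\ (4 <= N0)%N.
  exists (4 + Num.bound (4 / eps))%N; split; last exact: leq_addr.
  rewrite mulrC -ler_pdivrMr // natrD; apply: ler_wpDl => //.
  by apply/ltW/archi_boundP/divr_ge0; rewrite ?mulr_ge0 ?ltW.
case: hN0 => hN0 N04; have [C hC] := hc N0 N04.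
pose c2 := (c1 + C + 2 * c1)%N.
have fn n : (N0 * f n <= N0 * c2 + 2 * n)%N.
  have [k ck hk] := hC n; have fk : (f n <= k)%N.
    by rewrite /f; case: ex_minnP => m _; apply; apply/asboolP.
  apply: leq_trans (_ : (N0 * k <= _)%N); first by rewrite leq_mul2l fk orbT.
  by apply: leq_trans hk _; rewrite /c2 !mulnDr; nia.
exists (Num.bound (2 * c2%:R / eps)) => // n /= hn.
rewrite !normr_nat.
have h1 : 2 * c2%:R <= eps * n%:R.
  rewrite [eps * _]mulrC -ler_pdivrMr //; apply: le_trans (ltW (archi_boundP _)) _.
    by apply: divr_ge0; [apply: mulr_ge0|apply: ltW].
  by rewrite ler_nat.
have N0R : 0 < N0%:R :> R by rewrite ltr0n (leq_trans _ N04).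
rewrite -(ler_pM2l N0R) -natrM.
have := fn n; rewrite -(ler_nat R) => /le_trans; apply.
rewrite natrD !natrM.
have n0 : 0 <= n%:R :> R by [].
have h2 : 4 * n%:R <= eps * N0%:R * n%:R by rewrite ler_wpM2r.
have h3 : N0%:R * (2 * c2%:R) <= N0%:R * (eps * n%:R) by rewrite ler_wpM2l // ltW.
rewrite -(ler_pM2l (x := 2)) //.
have -> : 2 * (N0%:R * c2%:R + 2 * n%:R) = N0%:R * (2 * c2%:R) + 4 * n%:R :> R.
  by ring.
have -> : 2 * (N0%:R * (eps * n%:R)) = N0%:R * (eps * n%:R) + eps * N0%:R * n%:R :> R.
  by ring.
exact: lerD.
Qed.
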